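(* Every analytic minimal timelike ruled surface of $\mathbb L^3$ is congruent to a part of one of the following surfaces: (i) a Lorentzian (i.e. timelike) plane; (ii) the helicoid of the 1st kind; (iii) the helicoid of the 2nd kind; (iv) the helicoid of the 3rd kind; (v) the conjugate surface of Enneper of the 2nd kind; (vi) a flat $B$-scroll over a null curve.
   Context: $\mathbb L^3$ is $\mathbb R^3$ with $\langle x,y\rangle=-x_1y_1+x_2y_2+x_3y_3$. A surface is timelike if its induced metric has signature $(1,1)$ everywhere, and minimal if its mean curvature vanishes. Congruent means equal up to an isometry of $\mathbb L^3$. Analytic means real analytic. A ruled surface in $\mathbb L^3$ is a surface $X(t,s)=\alpha(t)+s\,\beta(t)$, $t\in J_1$, $s\in J_2$ ($J_1,J_2$ open intervals), where $\alpha$ is a curve in $\mathbb L^3$ (the base curve) and $\beta$ is a transversal vector field along $\alpha$ (the director vector field). The named surfaces, with a real constant $c\neq0$ (on the parameter range where they are timelike immersions), are: Timelike helicoid of the 1st kind: $X=\frac1c(u,\ \sin v\cos u,\ \sin v\sin u)$. Timelike helicoid of the 2nd kind: $X=\frac1c(\cosh v\sinh u,\ \cosh v\cosh u,\ u)$. Timelike helicoid of the 3rd kind: $X=\frac1c(\sinh u\cosh v,\ v,\ \sinh u\sinh v)$. Conjugate of Enneper's timelike surface of the 2nd kind: $X=-\frac1{6c}(3u+3uv^2+u^3,\ 3v^2+3u^2-3,\ 3u-3uv^2-u^3)$, $v>0$. $B$-scroll: let $\alpha(t)$ be a lightlike (null) curve in $\mathbb L^3$ with Cartan frame $\{A,B,C\}$,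 i.e. vector fields along $\alpha$ with $\langle A,A\rangle=\langle B,B\rangle=0$, $\langle A,B\rangle=1$, $\langle A,C\rangle=\langle B,C\rangle=0$, $\langle C,C\rangle=1$, $\alpha'=A$, $C'=-aA-c(t)B$, where $a$ is a constant and $c(t)$ a nowhere vanishing function. The surface $X(t,s)=\alpha(t)+sB(t)$ is called a $B$-scroll over $\alpha$. It is flat when $B'\equiv0$ and $C'=-c(t)B$.
   Formalization: In (vi) the function c(t) of the flat B-scroll may have isolated zeros instead of being nowhere vanishing; as stated the claim fails for the minimal timelike cylinder (t+s, t^3, s), whose c vanishes on one ruling. *)

(* Defs.v *)
From Stdlib Require Import Reals.
From Coquelicot Require Import Coquelicot.
Open Scope R_scope.

(** * Lorentz-Minkowski space *)

(* The vector operations are Coquelicot's [plus] and [scal] on [R * R * R]. *)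
Notation L3 := (R * R * R)%type.

Definition x1 (p : L3) : R := fst (fst p).
Definition x2 (p : L3) : R := snd (fst p).
Definition x3 (p : L3) : R := snd p.

Definition lorentz (p q : L3) : R := - x1 p * x1 q + x2 p * x2 q + x3 p * x3 q.

(* The Lorentzian cross product: [lorentz (cross p q) r = det (p, q, r)]; it
   is the Euclidean one with the sign of the first coordinate changed. *)
Definition cross (p q : L3) : L3 :=
  (- (x2 p * x3 q - x3 p * x2 q),
   x3 p * x1 q - x1 p * x3 q,
   x1 p * x2 q - x2 p * x1 q).

Definition lin_comb (a b : R) (v w : L3) : L3 := plus (scal a v) (scal b w).

Definition lin_indep (v w : L3) : Prop :=
  forall a b : R, lin_comb a b v w = zero -> a = 0 /\ b = 0.

(* The span of [v] and [w] has an orthonormal pair of signature (-, +).  Such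
   a pair is linearly independent, hence a basis of the span; in particular
   [v] and [w] are then linearly independent. *)
Definition signature11 (v w : L3) : Prop :=
  exists a b c d : R,
    let e := lin_comb a b v w in
    let f := lin_comb c d v w in
    lorentz e e = -1 /\ lorentz f f = 1 /\ lorentz e f = 0.

Definition isometry (phi : L3 -> L3) : Prop :=
  exists (L : L3 -> L3) (p : L3),
    is_linear L /\
    (forall v w, lorentz (L v) (L w) = lorentz v w) /\
    (forall v, phi v = plus (L v) p).

Definition congruent_to_part (S T : L3 -> Prop) : Prop :=
  exists phi, isometry phi /\ forall p, S p -> T (phi p).

(** * Curves *)

Definition is_open_interval (J : R -> Prop) : Prop :=
  exists a b : Rbar, Rbar_lt a b /\ forall t, J t <-> Rbar_lt a t /\ Rbar_lt t b.

Definition analytic_on (J : R -> Prop) (f : R -> R) : Prop :=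
  forall t0, J t0 ->
    exists a : nat -> R, locally t0 (fun t => is_pseries a (t - t0) (f t)).

Definition smooth_on (J : R -> Prop) (f : R -> R) : Prop :=
  forall (n : nat) t, J t -> ex_derive_n f n t.

Definition coordinatewise (P : (R -> R) -> Prop) (f : R -> L3) : Prop :=
  P (fun t => x1 (f t)) /\ P (fun t => x2 (f t)) /\ P (fun t => x3 (f t)).

Definition analytic_curve (J : R -> Prop) := coordinatewise (analytic_on J).
Definition smooth_curve (J : R -> Prop) := coordinatewise (smooth_on J).

Definition Dcurve (f : R -> L3) (t : R) : L3 :=
  (Derive (fun r => x1 (f r)) t,
   Derive (fun r => x2 (f r)) t,
   Derive (fun r => x3 (f r)) t).

(** * Parametrized surfaces *)

Definition Du (X : R -> R -> L3) (u v : R) : L3 := Dcurve (fun r => X r v) u.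
Definition Dv (X : R -> R -> L3) (u v : R) : L3 := Dcurve (fun r => X u r) v.

Definition timelike_at (X : R -> R -> L3) (u v : R) : Prop :=
  signature11 (Du X u v) (Dv X u v).

Definition unit_normal (X : R -> R -> L3) (u v : R) : L3 :=
  let n := cross (Du X u v) (Dv X u v) in
  scal (/ sqrt (Rabs (lorentz n n))) n.

(* Half the trace of the shape operator.  On a timelike surface the unit
   normal is spacelike, so that no further sign enters. *)
Definition mean_curvature (X : R -> R -> L3) (u v : R) : R :=
  let E := lorentz (Du X u v) (Du X u v) in
  let F := lorentz (Du X u v) (Dv X u v) in
  let G := lorentz (Dv X u v) (Dv X u v) in
  let N := unit_normal X u v in
  let e := lorentz (Du (Du X) u v) N in
  let f := lorentz (Dv (Du X) u v) N in
  let g := lorentz (Dv (Dv X) u v) N in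
  (e * G - 2 * f * F + g * E) / (2 * (E * G - F ^ 2)).

Definition timelike (J1 J2 : R -> Prop) (X : R -> R -> L3) : Prop :=
  forall u v, J1 u -> J2 v -> timelike_at X u v.

Definition minimal (J1 J2 : R -> Prop) (X : R -> R -> L3) : Prop :=
  forall u v, J1 u -> J2 v -> mean_curvature X u v = 0.

Definition image (J1 J2 : R -> Prop) (X : R -> R -> L3) : L3 -> Prop :=
  fun p => exists u v, J1 u /\ J2 v /\ p = X u v.

Definition timelike_image (D : R -> R -> Prop) (X : R -> R -> L3) : L3 -> Prop :=
  fun p => exists u v, D u v /\ timelike_at X u v /\ p = X u v.

Definition ruled (alpha beta : R -> L3) (t s : R) : L3 :=
  plus (alpha t) (scal s (beta t)).

Definition transversal (J : R -> Prop) (alpha beta : R -> L3) : Prop :=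
  forall t, J t -> lin_indep (Dcurve alpha t) (beta t).

(** * The model surfaces *)

Definition plane (p v w : L3) : L3 -> Prop :=
  fun q => exists a b : R, q = plus p (lin_comb a b v w).

Definition lorentzian_plane (S : L3 -> Prop) : Prop :=
  exists p v w, signature11 v w /\ S = plane p v w.

Definition helicoid1 (c : R) : L3 -> Prop :=
  timelike_image (fun _ _ => True)
    (fun u v => scal (1 / c) (u, sin v * cos u, sin v * sin u)).

Definition helicoid2 (c : R) : L3 -> Prop :=
  timelike_image (fun _ _ => True)
    (fun u v => scal (1 / c) (cosh v * sinh u, cosh v * cosh u, u)).

Definition helicoid3 (c : R) : L3 -> Prop :=
  timelike_image (fun _ _ => True)
    (fun u v => scal (1 / c) (sinh u * cosh v, v, sinh u * sinh v)).

Definition conjugate_enneper2 (c : R) : L3 -> Prop :=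
  timelike_image (fun _ v => 0 < v)
    (fun u v => scal (- (1 / (6 * c)))
       (3 * u + 3 * u * v ^ 2 + u ^ 3,
        3 * v ^ 2 + 3 * u ^ 2 - 3,
        3 * u - 3 * u * v ^ 2 - u ^ 3)).

(* The function [c] may have isolated zeros.  They cannot be excluded: the
   timelike cylinder [(t + s, t ^ 3, s)] is minimal and ruled, and is the
   B-scroll of a null curve whose [c] vanishes exactly on the ruling [t = 0]. *)
Definition cartan_frame (I : R -> Prop) (alpha A B C : R -> L3)
    (a : R) (c : R -> R) : Prop :=
  smooth_curve I alpha /\ smooth_curve I A /\
  smooth_curve I B /\ smooth_curve I C /\
  forall t, I t ->
    lorentz (A t) (A t) = 0 /\ lorentz (B t) (B t) = 0 /\
    lorentz (A t) (B t) = 1 /\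
    lorentz (A t) (C t) = 0 /\ lorentz (B t) (C t) = 0 /\
    lorentz (C t) (C t) = 1 /\
    Dcurve alpha t = A t /\
    Dcurve C t = lin_comb (- a) (- c t) (A t) (B t) /\
    locally' t (fun r => c r <> 0).

Definition flat_B_scroll (S : L3 -> Prop) : Prop :=
  exists (I : R -> Prop) (alpha A B C : R -> L3) (a : R) (c : R -> R),
    is_open_interval I /\
    cartan_frame I alpha A B C a c /\
    (forall t, I t ->
       Dcurve B t = zero /\ Dcurve C t = scal (- c t) (B t)) /\
    S = image I (fun _ => True) (ruled alpha B).

(* Main.v *)
Require Import Defs.
From Stdlib Require Import Reals Lra Lia Psatz Classical ClassicalEpsilon Wf_nat Ranalysis5.
From Coquelicot Require Import Coquelicot.
Open Scope R_scope.

(** Write [G = <b, b>], [D = det (a', b, b')] and [Q = det (a', b, a'')] for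
    the surface [a(t) + s b(t)].  Its second derivative in [s] is zero, so
    minimality is an identity between polynomials of degree two in [s].  As it
    holds on an interval of values of [s], each coefficient vanishes
    ([minimal_ruled_equations]):
      [G Q = 2 D <a', b>],
      [G (det (a', b, b'') + det (b', b, a'')) = 2 D <b', b>],
      [G det (b', b, b'') = 0].
    All these functions of [t] are analytic, and analytic functions on an
    interval form an integral domain ([analytic_integral]).  Hence the proof
    splits according to which of [G], [D], [Q] vanish identically.

    If [D] and [Q] vanish, the normal [a' x b] keeps its direction and the
    surface lies in a plane ([planar_ruled_surface]).

    If [D] vanishes but [Q] does not, the first equation gives [G = 0].  A
    surface whose rulings are null is timelike and minimal only if their
    direction is constant.  Such a cylinder contains a null curve transversal
    to the rulings, over which it is a flat B-scroll; the function [c] of the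
    Cartan frame vanishes only where [Q] does, so at isolated points
    ([null_ruled_surface]).  Vanishing of [G] forces vanishing of [D], so one
    case is left.

    If [G D] is not identically zero, choose [t1] where it is not zero.  The
    third equation makes all rulings parallel to the plane orthogonal to
    [m = b x b'] at [t1] ([rulings_parallel_to_plane]).  In a frame adapted to
    the axis [m] and to [b(t1)] the other two equations say that the ruling
    turns at a rate proportional to its motion along the axis, and that the
    striction curve is the axis, or a cubic curve when the axis is null
    ([ruled_normal_form]).  The causal characters of [m] and [b(t1)] then
    decide between the three helicoids and the conjugate of Enneper's surface,
    and the sign of [E G - F ^ 2] selects the timelike part of the model
    ([skew_ruled_surface]).  A surface could a priori leave this case where
    [G D] vanishes at some other parameter; it does not, because the closed
    form persists at the first such parameter by continuity and, together
    with transversality, gives [G D <> 0] there. *)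

(** * Open intervals *)

Lemma open_interval_convex (J : R -> Prop) (u v t : R) :
  is_open_interval J -> J u -> J v -> u <= t <= v -> J t.
Proof.
  intros (a & b & _ & H) Hu Hv [H1 H2].
  apply H in Hu; apply H in Hv; apply H; destruct a, b; simpl in *; lra.
Qed.

Lemma open_interval_between (J : R -> Prop) (u v t : R) :
  is_open_interval J -> J u -> J v -> Rmin u v <= t <= Rmax u v -> J t.
Proof.
  intros HJ Hu Hv Ht.
  destruct (Rle_dec u v).
  - rewrite Rmin_left, Rmax_right in Ht by lra.
    exact (open_interval_convex J u v t HJ Hu Hv Ht).
  - rewrite Rmin_right, Rmax_left in Ht by lra.
    exact (open_interval_convex J v u t HJ Hv Hu Ht).
Qed.

Lemma open_interval_locally (J : R -> Prop) (t : R) :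
  is_open_interval J -> J t -> locally t J.
Proof.
  intros (a & b & _ & H) Ht. apply H in Ht.
  apply (filter_imp (fun t : R => Rbar_lt a t /\ Rbar_lt t b)).
  { intros y Hy; now apply H. }
  destruct Ht as [Ha Hb]. apply filter_and.
  - destruct a as [a| |]; simpl in *; [now apply open_gt|easy|].
    now apply filter_forall.
  - destruct b as [b| |]; simpl in *; [now apply open_lt| |easy].
    now apply filter_forall.
Qed.

Lemma open_interval_inhabited (J : R -> Prop) :
  is_open_interval J -> exists t, J t.
Proof.
  intros (a & b & Hab & H).
  destruct a as [a| |], b as [b| |]; simpl in Hab; try contradiction.
  - exists ((a + b) / 2); apply H; simpl; lra.
  - exists (a + 1); apply H; simpl; lra.
  - exists (b - 1); apply H; simpl; lra.
  - exists 0; apply H; simpl; lra.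
Qed.

Lemma locally_R (t : R) (P : R -> Prop) :
  locally t P <-> exists e, 0 < e /\ forall y, Rabs (y - t) < e -> P y.
Proof.
  split.
  - intros [e He]; exists (pos e); split; [apply e|]; intros y Hy; now apply He.
  - intros (e & He & H); exists (mkposreal e He); intros y Hy; now apply H.
Qed.

Lemma constant_of_zero_derivative (J : R -> Prop) (f : R -> R) :
  is_open_interval J -> (forall t, J t -> is_derive f t 0) ->
  forall u v, J u -> J v -> f u = f v.
Proof.
  intros HJ Hf.
  assert (H : forall u v, u < v -> J u -> J v -> f u = f v).
  { intros u v Huv Hu Hv; apply (eq_is_derive f u v); [|easy].
    intros t Ht; apply Hf. now apply (open_interval_convex J u v). }
  intros u v Hu Hv; destruct (Rtotal_order u v) as [?|[->|?]]; auto.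
  symmetry; auto.
Qed.

(** The indicator function of [P] is locally constant, so its derivative
    vanishes; this is connectedness of an interval without a supremum
    argument. *)
Lemma open_interval_connected (J P : R -> Prop) (t0 : R) :
  is_open_interval J -> J t0 -> P t0 ->
  (forall t, J t -> P t -> locally t P) ->
  (forall t, J t -> ~ P t -> locally t (fun r => ~ P r)) ->
  forall t, J t -> P t.
Proof.
  intros HJ Ht0 H0 Hopen Hclosed t Ht.
  set (f := fun t => if excluded_middle_informative (P t) then 1 else 0).
  assert (E : f t0 = f t).
  { apply (constant_of_zero_derivative J); auto. intros u Hu.
    destruct (excluded_middle_informative (P u)) as [Pu|Pu].
    - apply (is_derive_ext_loc (fun _ => 1)).
      + generalize (Hopen u Hu Pu); apply filter_imp; intros r Pr; unfold f.
        now destruct (excluded_middle_informative (P r)).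
      + apply (is_derive_const 1).
    - apply (is_derive_ext_loc (fun _ => 0)).
      + generalize (Hclosed u Hu Pu); apply filter_imp; intros r Pr; unfold f.
        now destruct (excluded_middle_informative (P r)).
      + apply (is_derive_const 0). }
  unfold f in E.
  destruct (excluded_middle_informative (P t)); auto.
  destruct (excluded_middle_informative (P t0)); [lra|easy].
Qed.

Lemma locally_nonzero (f : R -> R) (t : R) :
  continuous f t -> f t <> 0 -> locally t (fun r => f r <> 0).
Proof.
  intros Hc Ht. apply (Hc (fun y => y <> 0)).
  exists (mkposreal (Rabs (f t)) (Rabs_pos_lt _ Ht)).
  intros y Hy E; subst y.
  assert (Hy' : Rabs (0 - f t) < Rabs (f t)) by exact Hy.
  replace (0 - f t) with (- f t) in Hy' by ring. rewrite Rabs_Ropp in Hy'; lra.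
Qed.

Lemma vanishes_at_limit (f : R -> R) (t : R) (S : R -> Prop) :
  continuous f t -> (forall r, S r -> f r = 0) ->
  (forall e, 0 < e -> exists r, Rabs (r - t) < e /\ S r) -> f t = 0.
Proof.
  intros Hc HS Hlim. destruct (Req_dec (f t) 0) as [E|E]; [easy|exfalso].
  destruct (proj1 (locally_R _ _) (locally_nonzero f t Hc E)) as (e & He & H).
  destruct (Hlim e He) as (r & Hr & Sr). apply (H r Hr). now apply HS.
Qed.

(** Connectedness applied to the set of all [t] such that [f] has no zero
    between [t1] and [t].  Continuity makes this set open; a parameter outside
    it with no neighbourhood outside would be the only zero of [f] on its
    segment, which the last hypothesis excludes. *)
Lemma nonvanishing_propagates (J : R -> Prop) (f : R -> R) (t1 : R) :
  is_open_interval J -> J t1 -> f t1 <> 0 ->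
  (forall t, J t -> continuous f t) ->
  (forall t, J t -> t <> t1 ->
     (forall r, Rmin t1 t <= r <= Rmax t1 t -> r <> t -> f r <> 0) ->
     f t <> 0) ->
  forall t, J t -> f t <> 0.
Proof.
  intros HJ Ht1 H1 Hc Hend.
  assert (H : forall t, J t ->
            forall r, Rmin t1 t <= r <= Rmax t1 t -> f r <> 0).
  2:{ intros t Ht; apply (H t Ht); split; [apply Rmin_r|apply Rmax_r]. }
  apply (open_interval_connected J
           (fun t => forall r, Rmin t1 t <= r <= Rmax t1 t -> f r <> 0) t1);
    auto.
  - intros r; unfold Rmin, Rmax; destruct Rle_dec; intros Hr;
      replace r with t1 by lra; exact H1.
  - intros t Ht Hseg.
    assert (Hft : f t <> 0)
      by (apply Hseg; split; [apply Rmin_r|apply Rmax_r]).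
    destruct (proj1 (locally_R _ _) (locally_nonzero f t (Hc t Ht) Hft))
      as (e & He & Hloc).
    apply locally_R; exists e; split; [easy|]. intros u Hu r Hr.
    destruct (Rlt_dec (Rabs (r - t)) e) as [Hn|Hn]; [now apply Hloc|].
    apply Hseg. apply Rabs_def2 in Hu.
    unfold Rabs, Rmin, Rmax in *; repeat destruct Rle_dec;
      repeat destruct Rcase_abs; lra.
  - intros t Ht Hnot.
    assert (Hz : exists r, (Rmin t1 t <= r <= Rmax t1 t) /\ r <> t /\ f r = 0).
    { apply NNPP; intros Hno. apply Hnot.
      assert (Hs : forall r, Rmin t1 t <= r <= Rmax t1 t -> r <> t -> f r <> 0).
      { intros r Hr Hrt E; apply Hno; exists r; auto. }
      intros r Hr. destruct (Req_dec r t) as [->|Hrt]; [|now apply Hs].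
      destruct (Req_dec t t1) as [->|Htt]; [easy|now apply Hend]. }
    destruct Hz as (r & Hr & Hrt & E).
    apply locally_R; exists (Rabs (r - t)); split.
    { apply Rabs_pos_lt; lra. }
    intros u Hu H. apply (H r); [|easy]. clear H.
    unfold Rabs, Rmin, Rmax in *; repeat destruct Rle_dec;
      repeat destruct Rcase_abs; lra.
Qed.

Lemma is_derive_continuous (f : R -> R) (t d : R) : is_derive f t d -> continuous f t.
Proof.
  intros H; apply (ex_derive_continuous (V := R_NormedModule) f t).
  now exists d.
Qed.

Definition segment (u v t : R) : Prop := Rmin u v <= t <= Rmax u v.

Lemma segment_r (u v : R) : segment u v v.
Proof. split; [apply Rmin_r|apply Rmax_r]. Qed.

Lemma segment_trans (u v t s : R) : segment u v t -> segment u t s -> segment u v s.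
Proof.
  unfold segment, Rmin, Rmax; repeat destruct Rle_dec; lra.
Qed.

Lemma constant_on_segment (f : R -> R) (u v : R) :
  (forall t, segment u v t -> is_derive f t 0) -> f v = f u.
Proof.
  unfold segment; intros H. destruct (Rtotal_order u v) as [L|[->|L]]; [|easy|].
  - symmetry; apply (eq_is_derive f u v); [|easy]. intros t Ht; apply H.
    now rewrite Rmin_left, Rmax_right by lra.
  - apply (eq_is_derive f v u); [|easy]. intros t Ht; apply H.
    now rewrite Rmin_right, Rmax_left by lra.
Qed.

Lemma vanishes_at_segment_end (f : R -> R) (t1 t : R) :
  t <> t1 -> continuous f t ->
  (forall r, segment t1 t r -> r <> t -> f r = 0) -> f t = 0.
Proof.
  intros Htt Hc H.
  apply (vanishes_at_limit f t (fun r => segment t1 t r /\ r <> t) Hc).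
  { intros r [H1 H2]; auto. }
  intros e He. unfold segment, Rmin, Rmax.
  destruct (Rle_dec t1 t).
  - exists (Rmax t1 (t - e / 2)). unfold Rmax; destruct Rle_dec;
      (split; [apply Rabs_def1|]; lra).
  - exists (Rmin t1 (t + e / 2)). unfold Rmin; destruct Rle_dec;
      (split; [apply Rabs_def1|]; lra).
Qed.

Lemma continuous_nonzero_same_sign (J : R -> Prop) (f : R -> R) (u v : R) :
  is_open_interval J -> (forall t, J t -> continuous f t) ->
  (forall t, J t -> f t <> 0) -> J u -> J v -> 0 < f u -> 0 < f v.
Proof.
  intros HJ Hc Hn Hu Hv Hpos.
  apply (open_interval_connected J (fun t => 0 < f t) u HJ Hu Hpos); auto.
  - intros t Ht Hft. apply (Hc t Ht (fun y => 0 < y)). now apply open_gt.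
  - intros t Ht Hft. specialize (Hn t Ht).
    apply (filter_imp (fun r => f r < 0)); [intros r Hr; lra|].
    apply (Hc t Ht (fun y => y < 0)). apply open_lt. lra.
Qed.

(** * Real analytic functions *)

Definition power_series_at (t0 : R) (f : R -> R) : Prop :=
  exists a, Rbar_lt 0 (CV_radius a) /\
    locally t0 (fun t => f t = PSeries a (t - t0)).

Lemma locally_in_disk (a : nat -> R) (t0 : R) :
  Rbar_lt 0 (CV_radius a) ->
  locally t0 (fun t => Rbar_lt (Rabs (t - t0)) (CV_radius a)).
Proof.
  intros H. apply locally_R.
  destruct (CV_radius a) as [r| |]; simpl in *; [|exists 1; split; [lra|easy]|easy].
  exists r; split; auto.
Qed.

Lemma CV_radius_ge (a : nat -> R) (x : R) :
  ex_pseries a x -> Rbar_le (Rabs x) (CV_radius a).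
Proof.
  intros Hx.
  destruct (Rbar_le_lt_dec (Rabs x) (CV_radius a)) as [|Hlt]; [easy|].
  exfalso; apply (CV_disk_outside a x Hlt).
  refine (is_lim_seq_ext _ _ _ _ (ex_series_lim_0 _ Hx)); intros n.
  unfold scal; simpl; unfold mult; simpl. rewrite pow_n_pow; ring.
Qed.

Lemma analytic_onE (J : R -> Prop) (f : R -> R) :
  analytic_on J f <-> forall t0, J t0 -> power_series_at t0 f.
Proof.
  split; intros H t0 Ht0; destruct (H t0 Ht0) as [a Ha]; exists a.
  - split.
    + destruct (proj1 (locally_R _ _) Ha) as (e & He & Hs).
      apply Rbar_lt_le_trans with (Rabs (e / 2)).
      { simpl; rewrite Rabs_pos_eq; lra. }
      apply CV_radius_ge. exists (f (t0 + e / 2)).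
      specialize (Hs (t0 + e / 2)).
      replace (t0 + e / 2 - t0) with (e / 2) in Hs by ring.
      apply Hs. rewrite Rabs_pos_eq; lra.
    + generalize Ha; apply filter_imp; intros t Ht.
      symmetry; now apply is_pseries_unique.
  - destruct Ha as [Hr Ha].
    generalize (filter_and _ _ Ha (locally_in_disk a t0 Hr)); apply filter_imp.
    intros t [-> Ht]. now apply PSeries_correct, CV_radius_inside.
Qed.

Lemma CV_radius_const (c : R) :
  CV_radius (fun n => match n with O => c | S _ => 0 end) = p_infty.
Proof.
  set (a := fun n => _).
  assert (H : forall r : R, Rbar_le r (CV_radius a)).
  { intros r. apply (proj1 (CV_radius_bounded a)).
    exists (Rabs c). intros [|n]; unfold a; simpl.
    - rewrite Rmult_1_r; lra.
    - rewrite Rmult_0_l, Rabs_R0; apply Rabs_pos. }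
  destruct (CV_radius a) as [r| |]; [|easy|].
  - specialize (H (r + 1)); simpl in H; lra.
  - destruct (H 0).
Qed.

Lemma PSeries_const (c x : R) :
  PSeries (fun n => match n with O => c | S _ => 0 end) x = c.
Proof.
  rewrite PSeries_decr_1.
  - rewrite (PSeries_ext _ (fun _ => 0)); [|intros [|n]; reflexivity].
    rewrite PSeries_const_0; ring.
  - apply CV_radius_inside; rewrite CV_radius_const; exact I.
Qed.

Lemma analytic_const (J : R -> Prop) (c : R) : analytic_on J (fun _ => c).
Proof.
  apply analytic_onE; intros t0 _.
  exists (fun n => match n with O => c | S _ => 0 end). split.
  - rewrite CV_radius_const; exact I.
  - apply filter_forall; intros t; now rewrite PSeries_const.
Qed.

Lemma analytic_plus (J : R -> Prop) (f g : R -> R) :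
  analytic_on J f -> analytic_on J g -> analytic_on J (fun t => f t + g t).
Proof.
  intros Hf Hg t0 Ht0. destruct (Hf t0 Ht0) as [a Ha], (Hg t0 Ht0) as [b Hb].
  exists (PS_plus a b).
  generalize (filter_and _ _ Ha Hb); apply filter_imp; intros t [H1 H2].
  now apply (is_pseries_plus a b).
Qed.

Lemma analytic_mult (J : R -> Prop) (f g : R -> R) :
  analytic_on J f -> analytic_on J g -> analytic_on J (fun t => f t * g t).
Proof.
  intros Hf Hg t0 Ht0.
  destruct (proj1 (analytic_onE J f) Hf t0 Ht0) as (a & Ra & Ha).
  destruct (proj1 (analytic_onE J g) Hg t0 Ht0) as (b & Rb & Hb).
  exists (PS_mult a b).
  generalize (filter_and _ _ (filter_and _ _ Ha Hb)
    (filter_and _ _ (locally_in_disk a t0 Ra) (locally_in_disk b t0 Rb))).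
  apply filter_imp; intros t [[-> ->] [H1 H2]].
  apply is_pseries_mult; auto; now apply PSeries_correct, CV_radius_inside.
Qed.

Lemma analytic_ext (J : R -> Prop) (f g : R -> R) :
  (forall t, f t = g t) -> analytic_on J f -> analytic_on J g.
Proof.
  intros E Hf t0 Ht0. destruct (Hf t0 Ht0) as [a Ha]. exists a.
  generalize Ha; apply filter_imp; intros t; now rewrite E.
Qed.

Lemma analytic_minus (J : R -> Prop) (f g : R -> R) :
  analytic_on J f -> analytic_on J g -> analytic_on J (fun t => f t - g t).
Proof.
  intros Hf Hg. apply (analytic_ext J (fun t => f t + (-1) * g t)).
  { intros t; ring. }
  apply analytic_plus; auto. apply analytic_mult; auto using analytic_const.
Qed.

Lemma power_series_is_derive (a : nat -> R) (t0 t : R) :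
  Rbar_lt (Rabs (t - t0)) (CV_radius a) ->
  is_derive (fun r => PSeries a (r - t0)) t (PSeries (PS_derive a) (t - t0)).
Proof.
  intros H. replace (PSeries (PS_derive a) (t - t0))
    with (scal 1 (PSeries (PS_derive a) (t - t0)))
    by (unfold scal; simpl; unfold mult; simpl; ring).
  apply (is_derive_comp (PSeries a) (fun r => r - t0)).
  - now apply is_derive_PSeries.
  - auto_derive; auto; ring.
Qed.

Lemma analytic_is_derive (J : R -> Prop) (f : R -> R) (t : R) :
  analytic_on J f -> J t -> is_derive f t (Derive f t).
Proof.
  intros Hf Ht. apply Derive_correct.
  destruct (proj1 (analytic_onE J f) Hf t Ht) as (a & Ra & Ha).
  exists (PSeries (PS_derive a) (t - t)).
  apply (is_derive_ext_loc (fun r => PSeries a (r - t))).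
  { generalize Ha; apply filter_imp; auto. }
  apply power_series_is_derive. now rewrite Rminus_diag, Rabs_R0.
Qed.

Lemma analytic_continuous (J : R -> Prop) (f : R -> R) (t : R) :
  analytic_on J f -> J t -> continuous f t.
Proof.
  intros Hf Ht. apply (ex_derive_continuous (V := R_NormedModule) f t).
  exists (Derive f t). now apply (analytic_is_derive J).
Qed.

Lemma analytic_Derive (J : R -> Prop) (f : R -> R) :
  analytic_on J f -> analytic_on J (Derive f).
Proof.
  rewrite !analytic_onE. intros Hf t0 Ht0.
  destruct (Hf t0 Ht0) as (a & Ra & Ha).
  exists (PS_derive a). rewrite CV_radius_derive. split; [easy|].
  generalize (filter_and _ _ (locally_locally _ _ Ha) (locally_in_disk a t0 Ra)).
  apply filter_imp; intros t [Ht Hd]. apply is_derive_unique.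
  apply (is_derive_ext_loc (fun r => PSeries a (r - t0))).
  { generalize Ht; apply filter_imp; auto. }
  now apply power_series_is_derive.
Qed.

(** Dividing the power series by the lowest power that occurs in it leaves a
    continuous function with a nonzero value at the centre. *)
Lemma analytic_isolated_zero (J : R -> Prop) (f : R -> R) (t : R) :
  analytic_on J f -> J t ->
  locally t (fun r => f r = 0) \/ locally' t (fun r => f r <> 0).
Proof.
  intros Hf Ht.
  destruct (proj1 (analytic_onE J f) Hf t Ht) as (a & Ra & Ha).
  destruct (classic (exists n, a n <> 0)) as [Hn|Hn].
  - right.
    destruct (dec_inh_nat_subset_has_unique_least_element
                (fun n => a n <> 0) (fun n => classic _) Hn)
      as (n & [Hn0 Hmin] & _).
    set (b := PS_decr_n a n).
    assert (Hb : forall x, PSeries a x = x ^ n * PSeries b x).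
    { intros x; apply PSeries_decr_n_aux. intros k Hk.
      apply NNPP; intros H. specialize (Hmin k H). lia. }
    assert (Rb : Rbar_lt 0 (CV_radius b)).
    { destruct (proj1 (locally_R _ _) (locally_in_disk a 0 Ra)) as (e & He & Hd).
      apply Rbar_lt_le_trans with (Rabs (e / 2)).
      { simpl; rewrite Rabs_pos_eq; lra. }
      apply CV_radius_ge. apply ex_pseries_decr_n.
      - right; exists (/ (e / 2)).
        unfold mult, one; simpl; unfold mult, one; simpl. field; lra.
      - apply CV_radius_inside. rewrite <- (Rminus_0_r (e / 2)). apply Hd.
        rewrite Rminus_0_r, Rabs_pos_eq; lra. }
    assert (Hc : continuous (fun r => PSeries b (r - t)) t).
    { apply (ex_derive_continuous (V := R_NormedModule)). exists (PSeries (PS_derive b) (t - t)).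
      apply power_series_is_derive. now rewrite Rminus_diag, Rabs_R0. }
    assert (Hb0 : PSeries b (t - t) <> 0).
    { rewrite Rminus_diag, PSeries_0. unfold b, PS_decr_n.
      now rewrite Nat.add_0_r. }
    unfold locally', within.
    generalize (filter_and _ _ Ha (locally_nonzero _ t Hc Hb0)).
    apply filter_imp. intros r [-> Hr] Hrt. rewrite Hb.
    apply Rmult_integral_contrapositive_currified; [|easy].
    apply pow_nonzero; lra.
  - left. generalize Ha; apply filter_imp. intros r ->.
    rewrite (PSeries_ext _ (fun _ => 0)); [apply PSeries_const_0|].
    intros n; apply NNPP; intros H; apply Hn; now exists n.
Qed.

(** The points near which [f] is zero form an open set.  It is also closed,
    since near any other point the zeros of [f] are isolated. *)
Lemma analytic_identity (J : R -> Prop) (f : R -> R) (t0 : R) :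
  is_open_interval J -> analytic_on J f -> J t0 ->
  locally t0 (fun r => f r = 0) -> forall t, J t -> f t = 0.
Proof.
  intros HJ Hf Ht0 H0 t Ht.
  apply (locally_singleton t (fun r => f r = 0)).
  apply (open_interval_connected J (fun t => locally t (fun r => f r = 0)) t0);
    auto.
  - intros u _ Hu; now apply locally_locally.
  - intros u Hu Hnot.
    destruct (analytic_isolated_zero J f u Hf Hu) as [H|H]; [easy|].
    generalize (locally_locally _ _ H); apply filter_imp. intros r Hr Hz.
    destruct (Req_dec r u) as [->|Hru]; [easy|].
    exact (locally_singleton _ _ Hr Hru (locally_singleton _ _ Hz)).
Qed.

Lemma analytic_zeros_isolated (J : R -> Prop) (f : R -> R) (t0 : R) :
  is_open_interval J -> analytic_on J f -> J t0 -> f t0 <> 0 ->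
  forall t, J t -> locally' t (fun r => f r <> 0).
Proof.
  intros HJ Hf Ht0 H0 t Ht.
  destruct (analytic_isolated_zero J f t Hf Ht) as [H|H]; [|easy].
  now destruct H0; apply (analytic_identity J f t).
Qed.

(** Where [f] is not zero, [g] vanishes on a whole neighbourhood. *)
Lemma analytic_integral (J : R -> Prop) (f g : R -> R) :
  is_open_interval J -> analytic_on J f -> analytic_on J g ->
  (forall t, J t -> f t * g t = 0) ->
  (forall t, J t -> f t = 0) \/ (forall t, J t -> g t = 0).
Proof.
  intros HJ Hf Hg H.
  destruct (classic (exists t0, J t0 /\ f t0 <> 0)) as [(t0 & Ht0 & H0)|Hno].
  - right. apply (analytic_identity J g t0 HJ Hg Ht0).
    generalize (filter_and _ _ (open_interval_locally J t0 HJ Ht0)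
      (locally_nonzero f t0 (analytic_continuous J f t0 Hf Ht0) H0)).
    apply filter_imp. intros r [Hr Hfr].
    destruct (Rmult_integral _ _ (H r Hr)); easy.
  - left. intros t Ht. apply NNPP; intros E; apply Hno; now exists t.
Qed.

(** * Vectors of Lorentz space *)

Lemma L3_ext (p q : L3) : x1 p = x1 q -> x2 p = x2 q -> x3 p = x3 q -> p = q.
Proof.
  destruct p as [[p1 p2] p3], q as [[q1 q2] q3]; cbn; now intros -> -> ->.
Qed.

Lemma x1_mk (a b c : R) : x1 (a, b, c) = a. Proof. reflexivity. Qed.
Lemma x2_mk (a b c : R) : x2 (a, b, c) = b. Proof. reflexivity. Qed.
Lemma x3_mk (a b c : R) : x3 (a, b, c) = c. Proof. reflexivity. Qed.
Lemma x1_plus (p q : L3) : x1 (plus p q) = x1 p + x1 q. Proof. reflexivity. Qed.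
Lemma x2_plus (p q : L3) : x2 (plus p q) = x2 p + x2 q. Proof. reflexivity. Qed.
Lemma x3_plus (p q : L3) : x3 (plus p q) = x3 p + x3 q. Proof. reflexivity. Qed.
Lemma x1_scal (a : R) (p : L3) : x1 (scal a p) = a * x1 p. Proof. reflexivity. Qed.
Lemma x2_scal (a : R) (p : L3) : x2 (scal a p) = a * x2 p. Proof. reflexivity. Qed.
Lemma x3_scal (a : R) (p : L3) : x3 (scal a p) = a * x3 p. Proof. reflexivity. Qed.
Lemma x1_zero : x1 zero = 0. Proof. reflexivity. Qed.
Lemma x2_zero : x2 zero = 0. Proof. reflexivity. Qed.
Lemma x3_zero : x3 zero = 0. Proof. reflexivity. Qed.

Global Hint Rewrite x1_mk x2_mk x3_mk x1_plus x2_plus x3_plus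
  x1_scal x2_scal x3_scal x1_zero x2_zero x3_zero : coordinates.

Definition det (p q r : L3) : R := lorentz (cross p q) r.

Ltac coords :=
  unfold ruled, det, lin_comb, lorentz, cross; autorewrite with coordinates.
Ltac coords_in H :=
  unfold ruled, det, lin_comb, lorentz, cross in H;
  autorewrite with coordinates in H.
Ltac vec_ext := apply L3_ext; coords.

Lemma lorentz_plus_r (p q r : L3) :
  lorentz p (plus q r) = lorentz p q + lorentz p r.
Proof. coords; ring. Qed.

Lemma lorentz_scal_r (p q : L3) (a : R) :
  lorentz p (scal a q) = a * lorentz p q.
Proof. coords; ring. Qed.

Lemma lorentz_plus_l (p q r : L3) :
  lorentz (plus p q) r = lorentz p r + lorentz q r.
Proof. coords; ring. Qed.

Lemma lorentz_scal_l (p q : L3) (a : R) :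
  lorentz (scal a p) q = a * lorentz p q.
Proof. coords; ring. Qed.

Lemma lorentz_sym (p q : L3) : lorentz p q = lorentz q p.
Proof. coords; ring. Qed.

(** The sign is opposite to that of the Euclidean Lagrange identity because
    the metric has determinant -1. *)
Lemma lorentz_cross_cross (u v x y : L3) :
  lorentz (cross u v) (cross x y) =
  - (lorentz u x * lorentz v y - lorentz u y * lorentz v x).
Proof. coords; ring. Qed.

(** The Gram determinant of the orthonormal pair is -1, and it is the Gram
    determinant of [v] and [w] times a square. *)
Lemma signature11_gram_neg (v w : L3) :
  signature11 v w -> lorentz v v * lorentz w w - lorentz v w ^ 2 < 0.
Proof.
  intros (a & b & c & d & H1 & H2 & H3).
  assert (E : (a * d - b * c) ^ 2 * (lorentz v v * lorentz w w - lorentz v w ^ 2)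
    = lorentz (lin_comb a b v w) (lin_comb a b v w)
      * lorentz (lin_comb c d v w) (lin_comb c d v w)
      - lorentz (lin_comb a b v w) (lin_comb c d v w) ^ 2) by (coords; ring).
  rewrite H1, H2, H3 in E.
  assert (0 <= (a * d - b * c) ^ 2) by apply pow2_ge_0. nra.
Qed.

Lemma signature11_orthogonal (v w : L3) :
  lorentz v w = 0 -> lorentz v v < 0 -> 0 < lorentz w w -> signature11 v w.
Proof.
  intros H0 Hv Hw.
  exists (/ sqrt (- lorentz v v)), 0, 0, (/ sqrt (lorentz w w)).
  assert (Sv := sqrt_sqrt (- lorentz v v) ltac:(lra)).
  assert (Sw := sqrt_sqrt (lorentz w w) ltac:(lra)).
  assert (Pv := sqrt_lt_R0 (- lorentz v v) ltac:(lra)).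
  assert (Pw := sqrt_lt_R0 (lorentz w w) ltac:(lra)).
  set (a := sqrt (- lorentz v v)) in *. set (b := sqrt (lorentz w w)) in *.
  unfold lin_comb; cbv zeta.
  rewrite !lorentz_plus_l, !lorentz_plus_r, !lorentz_scal_l, !lorentz_scal_r,
    (lorentz_sym w v), H0.
  replace (lorentz v v) with (- (a * a)) by lra. rewrite <- Sw.
  repeat split; field; lra.
Qed.

Lemma signature11_scal (a : R) (v w : L3) :
  a <> 0 -> signature11 v w -> signature11 (scal a v) (scal a w).
Proof.
  intros Ha (k & l & m & n & H).
  exists (k / a), (l / a), (m / a), (n / a).
  assert (E : forall p q, lin_comb (p / a) (q / a) (scal a v) (scal a w)
            = lin_comb p q v w) by (intros p q; vec_ext; field; easy).
  now rewrite !E.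
Qed.

(** Cramer's rule, in the form that needs no inverse. *)
Lemma det_scal_expansion (p q r x : L3) :
  scal (det p q r) x = plus (plus (scal (lorentz x p) (cross q r))
    (scal (lorentz x q) (cross r p))) (scal (lorentz x r) (cross p q)).
Proof. vec_ext; ring. Qed.

Lemma gram_det (p q r : L3) :
  lorentz p p * (lorentz q q * lorentz r r - lorentz q r ^ 2)
  - lorentz p q * (lorentz p q * lorentz r r - lorentz q r * lorentz p r)
  + lorentz p r * (lorentz p q * lorentz q r - lorentz q q * lorentz p r)
  = - det p q r ^ 2.
Proof. coords; ring. Qed.

Lemma orthogonal_to_three (p q r x : L3) : det p q r <> 0 ->
  lorentz x p = 0 -> lorentz x q = 0 -> lorentz x r = 0 -> x = zero.
Proof.
  intros Hd Hp Hq Hr. assert (E := det_scal_expansion p q r x).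
  rewrite Hp, Hq, Hr in E.
  assert (E1 := f_equal x1 E). assert (E2 := f_equal x2 E).
  assert (E3 := f_equal x3 E). clear E Hp Hq Hr.
  autorewrite with coordinates in E1, E2, E3.
  vec_ext; apply Rmult_eq_reg_l with (det p q r); auto; lra.
Qed.

Lemma lorentz_nondegenerate (v : L3) : (forall w, lorentz v w = 0) -> v = zero.
Proof.
  intros H. assert (H1 := H (1, 0, 0)). assert (H2 := H (0, 1, 0)).
  assert (H3 := H (0, 0, 1)). coords_in H1; coords_in H2; coords_in H3.
  vec_ext; lra.
Qed.

Lemma lin_indep_r_nonzero (v w : L3) : lin_indep v w -> w <> zero.
Proof.
  intros H ->. destruct (H 0 1) as [_ E]; [|lra]. vec_ext; ring.
Qed.

Lemma lin_indep_cross (v w : L3) : lin_indep v w -> cross v w <> zero.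
Proof.
  intros H E. apply (lin_indep_r_nonzero v w H).
  assert (E1 := f_equal x1 E). assert (E2 := f_equal x2 E).
  assert (E3 := f_equal x3 E). coords_in E1; coords_in E2; coords_in E3.
  destruct (H (x1 w) (- x1 v)) as [H1 _]; [vec_ext; lra|].
  destruct (H (x2 w) (- x2 v)) as [H2 _]; [vec_ext; lra|].
  destruct (H (x3 w) (- x3 v)) as [H3 _]; [vec_ext; lra|].
  now vec_ext.
Qed.

(** Cauchy-Schwarz in the two spacelike coordinates. *)
Lemma timelike_orthogonal_spacelike (v w : L3) :
  lorentz v v < 0 -> lorentz v w = 0 -> w <> zero -> 0 < lorentz w w.
Proof.
  destruct v as [[v1 v2] v3], w as [[w1 w2] w3]. coords. intros Hv Hvw Hw.
  assert (E : v1 * w1 = v2 * w2 + v3 * w3) by lra.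
  assert (Hsq : v1 ^ 2 * w1 ^ 2 + (v2 * w3 - v3 * w2) ^ 2
                = (v2 ^ 2 + v3 ^ 2) * (w2 ^ 2 + w3 ^ 2)).
  { transitivity ((v1 * w1) ^ 2 + (v2 * w3 - v3 * w2) ^ 2); [ring|].
    rewrite E; ring. }
  assert (0 <= (v2 * w3 - v3 * w2) ^ 2) by apply pow2_ge_0.
  assert (0 < v1 ^ 2) by nra.
  assert (HW : 0 < w2 ^ 2 + w3 ^ 2).
  { destruct (Req_dec w2 0) as [-> |]; [destruct (Req_dec w3 0) as [-> |]|].
    - exfalso; apply Hw. assert (v1 * w1 = 0) by lra.
      destruct (Rmult_integral _ _ H1) as [-> | ->]; [lra|easy].
    - nra.
    - nra. }
  assert (v1 ^ 2 * w1 ^ 2 < v1 ^ 2 * (w2 ^ 2 + w3 ^ 2)) by nra.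
  assert (w1 ^ 2 < w2 ^ 2 + w3 ^ 2) by nra. lra.
Qed.

Lemma normalization (v : L3) : lorentz v v <> 0 ->
  exists k, k <> 0 /\ (0 < lorentz v v -> lorentz (scal k v) (scal k v) = 1) /\
    (lorentz v v < 0 -> lorentz (scal k v) (scal k v) = -1).
Proof.
  intros Hv. exists (/ sqrt (Rabs (lorentz v v))).
  assert (Hp := sqrt_lt_R0 _ (Rabs_pos_lt _ Hv)).
  assert (Hs := sqrt_sqrt _ (Rabs_pos (lorentz v v))).
  set (r := sqrt _) in *.
  split; [apply Rinv_neq_0_compat; lra|].
  rewrite lorentz_scal_l, lorentz_scal_r.
  split; intros H; [rewrite Rabs_pos_eq in Hs by lra|rewrite Rabs_left in Hs by lra].
  - rewrite <- Hs. field; lra.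
  - replace (lorentz v v) with (- (r * r)) by lra. field; lra.
Qed.

(** Subtract the multiple of [b] that cancels the first coordinate of [m]; the
    remainder is null with zero time component. *)
Lemma null_orthogonal_parallel (b m : L3) :
  lorentz b b = 0 -> lorentz m m = 0 -> lorentz b m = 0 -> b <> zero ->
  exists k : R, m = scal k b.
Proof.
  destruct b as [[b1 b2] b3], m as [[m1 m2] m3]. coords. intros Hb Hm Hbm Hne.
  assert (Hb1 : b1 <> 0).
  { intros ->. apply Hne. assert (b2 = 0) by nra. assert (b3 = 0) by nra.
    now subst. }
  exists (m1 / b1). set (k := m1 / b1).
  assert (Em : m1 = k * b1) by (unfold k; field; easy).
  assert (E : (m2 - k * b2) ^ 2 + (m3 - k * b3) ^ 2 = 0).
  { transitivity ((- m1 * m1 + m2 * m2 + m3 * m3)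
      - 2 * k * (- b1 * m1 + b2 * m2 + b3 * m3)
      + k ^ 2 * (- b1 * b1 + b2 * b2 + b3 * b3) + (m1 - k * b1) ^ 2); [ring|].
    rewrite Hb, Hm, Hbm, Em; ring. }
  assert (H2 := pow2_ge_0 (m2 - k * b2)). assert (H3 := pow2_ge_0 (m3 - k * b3)).
  vec_ext; [exact Em|nra|nra].
Qed.

(** [v], [w] and [v x w] form a basis, and [v x w] is parallel to [n]; the
    coefficients come from Cramer's rule. *)
Lemma orthogonal_complement_in_span (v w n q : L3) :
  signature11 v w -> n <> zero -> lorentz n v = 0 -> lorentz n w = 0 ->
  lorentz q n = 0 -> exists a b, q = lin_comb a b v w.
Proof.
  intros Hvw Hn Hnv Hnw Hq. apply signature11_gram_neg in Hvw.
  set (N := cross v w).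
  assert (HN : det v w N = - (lorentz v v * lorentz w w - lorentz v w ^ 2))
    by (unfold N; coords; ring).
  set (D := det v w N) in *.
  assert (HD : D <> 0) by lra.
  assert (En := det_scal_expansion v w N n). fold D N in En.
  rewrite Hnv, Hnw in En.
  assert (HqN : lorentz q N = 0).
  { assert (E : lorentz n N * lorentz q N = 0).
    { transitivity (D * lorentz q n); [|rewrite Hq; ring].
      rewrite <- (lorentz_scal_r q n D), En, !lorentz_plus_r, !lorentz_scal_r. ring. }
    destruct (Rmult_integral _ _ E) as [E'|]; [|easy].
    exfalso; apply Hn. rewrite E' in En.
    assert (E1 := f_equal x1 En). assert (E2 := f_equal x2 En).
    assert (E3 := f_equal x3 En). autorewrite with coordinates in E1, E2, E3.
    apply L3_ext; autorewrite with coordinates;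
      (apply Rmult_eq_reg_l with D; [lra|easy]). }
  exists ((- lorentz q v * lorentz w w + lorentz q w * lorentz v w) / D),
    ((lorentz q v * lorentz v w - lorentz q w * lorentz v v) / D).
  assert (Eq := det_scal_expansion v w N q). fold D N in Eq.
  rewrite HqN in Eq.
  transitivity (scal (/ D) (scal D q)).
  { apply L3_ext; autorewrite with coordinates; field; easy. }
  rewrite Eq.
  replace (cross w N) with (lin_comb (- lorentz w w) (lorentz v w) v w)
    by (unfold N; vec_ext; ring).
  replace (cross N v) with (lin_comb (lorentz v w) (- lorentz v v) v w)
    by (unfold N; vec_ext; ring).
  unfold lin_comb; apply L3_ext; autorewrite with coordinates; field; easy.
Qed.

(** * Differentiable curves *)

Lemma D_plus (f g : R -> R) (t a b : R) : is_derive f t a -> is_derive g t b ->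
  is_derive (fun r => f r + g r) t (a + b).
Proof. exact (is_derive_plus f g t a b). Qed.

Lemma D_minus (f g : R -> R) (t a b : R) : is_derive f t a -> is_derive g t b ->
  is_derive (fun r => f r - g r) t (a - b).
Proof. exact (is_derive_minus f g t a b). Qed.

Lemma D_opp (f : R -> R) (t a : R) : is_derive f t a ->
  is_derive (fun r => - f r) t (- a).
Proof. exact (is_derive_opp f t a). Qed.

Lemma D_mult (f g : R -> R) (t a b : R) : is_derive f t a -> is_derive g t b ->
  is_derive (fun r => f r * g r) t (a * g t + f t * b).
Proof. intros Hf Hg. apply (is_derive_mult f g t a b Hf Hg Rmult_comm). Qed.

Lemma D_div (f g : R -> R) (t a b : R) : is_derive f t a -> is_derive g t b ->
  g t <> 0 ->
  is_derive (fun r => f r / g r) t ((a * g t - f t * b) / g t ^ 2).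
Proof. exact (is_derive_div f g t a b). Qed.

Lemma D_const (c t : R) : is_derive (fun _ : R => c) t 0.
Proof. exact (is_derive_const c t). Qed.

Lemma D_id (t : R) : is_derive (fun r : R => r) t 1.
Proof. exact (is_derive_id t). Qed.

Lemma D_comp (f g : R -> R) (t a b : R) :
  is_derive f (g t) a -> is_derive g t b -> is_derive (fun r => f (g r)) t (b * a).
Proof. exact (is_derive_comp f g t a b). Qed.

Lemma D_ext (f g : R -> R) (t d : R) : (forall r, f r = g r) ->
  is_derive f t d -> is_derive g t d.
Proof. exact (is_derive_ext f g t d). Qed.

(* Computes the derivative of an arithmetic expression in functions whose
   derivatives are hypotheses; the denominators are left as goals. *)
Ltac derive :=
  lazymatch goal with
  | |- is_derive (fun _ => ?c) _ _ => apply (D_const c)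
  | |- is_derive (fun r => r) _ _ => apply D_id
  | |- is_derive (fun r => @?f r + @?g r) _ _ => apply (D_plus f g); derive
  | |- is_derive (fun r => @?f r - @?g r) _ _ => apply (D_minus f g); derive
  | |- is_derive (fun r => - @?f r) _ _ => apply (D_opp f); derive
  | |- is_derive (fun r => @?f r * @?g r) _ _ => apply (D_mult f g); derive
  | |- is_derive (fun r => @?f r / @?g r) _ _ =>
      apply (D_div f g); [derive|derive|]
  | _ => eassumption
  end.

Definition is_dcurve (f : R -> L3) (t : R) (v : L3) : Prop :=
  is_derive (fun r => x1 (f r)) t (x1 v) /\
  is_derive (fun r => x2 (f r)) t (x2 v) /\
  is_derive (fun r => x3 (f r)) t (x3 v).

Lemma Dcurve_eq (f : R -> L3) (t : R) (v : L3) :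
  is_dcurve f t v -> Dcurve f t = v.
Proof.
  intros (H1 & H2 & H3).
  apply L3_ext; unfold Dcurve; autorewrite with coordinates;
    now apply is_derive_unique.
Qed.

Lemma analytic_is_dcurve (J : R -> Prop) (f : R -> L3) (t : R) :
  analytic_curve J f -> J t -> is_dcurve f t (Dcurve f t).
Proof.
  intros (H1 & H2 & H3) Ht; unfold is_dcurve, Dcurve;
    autorewrite with coordinates; split; [|split].
  - exact (analytic_is_derive J (fun r => x1 (f r)) t H1 Ht).
  - exact (analytic_is_derive J (fun r => x2 (f r)) t H2 Ht).
  - exact (analytic_is_derive J (fun r => x3 (f r)) t H3 Ht).
Qed.

Lemma analytic_Dcurve (J : R -> Prop) (f : R -> L3) :
  analytic_curve J f -> analytic_curve J (Dcurve f).
Proof.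
  intros (H1 & H2 & H3); repeat split.
  - exact (analytic_Derive J (fun r => x1 (f r)) H1).
  - exact (analytic_Derive J (fun r => x2 (f r)) H2).
  - exact (analytic_Derive J (fun r => x3 (f r)) H3).
Qed.

Lemma analytic_lorentz (J : R -> Prop) (f g : R -> L3) :
  analytic_curve J f -> analytic_curve J g ->
  analytic_on J (fun t => lorentz (f t) (g t)).
Proof.
  intros (F1 & F2 & F3) (G1 & G2 & G3). unfold lorentz.
  apply (analytic_plus J
    (fun t => - x1 (f t) * x1 (g t) + x2 (f t) * x2 (g t))).
  2: now apply analytic_mult.
  apply (analytic_plus J (fun t => - x1 (f t) * x1 (g t))).
  2: now apply analytic_mult.
  apply (analytic_mult J (fun t => - x1 (f t))); [|easy].
  apply (analytic_ext J (fun t => 0 - x1 (f t))); [intros; ring|].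
  apply analytic_minus; auto using analytic_const.
Qed.

Lemma analytic_cross (J : R -> Prop) (f g : R -> L3) :
  analytic_curve J f -> analytic_curve J g ->
  analytic_curve J (fun t => cross (f t) (g t)).
Proof.
  intros (F1 & F2 & F3) (G1 & G2 & G3). repeat split; cbn.
  - apply (analytic_ext J
      (fun t => x3 (f t) * x2 (g t) - x2 (f t) * x3 (g t))); [intros; ring|].
    apply analytic_minus; apply analytic_mult; auto.
  - apply analytic_minus; apply analytic_mult; auto.
  - apply analytic_minus; apply analytic_mult; auto.
Qed.

Lemma analytic_det (J : R -> Prop) (f g h : R -> L3) :
  analytic_curve J f -> analytic_curve J g -> analytic_curve J h ->
  analytic_on J (fun t => det (f t) (g t) (h t)).
Proof.
  intros; apply analytic_lorentz; auto. now apply analytic_cross.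
Qed.

Lemma analytic_constant_curve (J : R -> Prop) (v : L3) :
  analytic_curve J (fun _ => v).
Proof. repeat split; apply analytic_const. Qed.

Lemma is_derive_lorentz (f g : R -> L3) (t : R) (f' g' : L3) :
  is_dcurve f t f' -> is_dcurve g t g' ->
  is_derive (fun r => lorentz (f r) (g r)) t
    (lorentz f' (g t) + lorentz (f t) g').
Proof.
  intros (F1 & F2 & F3) (G1 & G2 & G3). unfold lorentz.
  evar_last; [derive|ring].
Qed.

Lemma is_dcurve_const (v : L3) (t : R) : is_dcurve (fun _ => v) t zero.
Proof. split; [|split]; apply (is_derive_const (V := R_NormedModule)). Qed.

Lemma is_derive_lorentz_const (v : L3) (f : R -> L3) (t : R) (f' : L3) :
  is_dcurve f t f' -> is_derive (fun r => lorentz v (f r)) t (lorentz v f').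
Proof.
  intros Hf. evar_last.
  - exact (is_derive_lorentz (fun _ => v) f t zero f' (is_dcurve_const v t) Hf).
  - coords; ring.
Qed.

Lemma is_dcurve_mk (a b c : R -> R) (t : R) (v : L3) :
  is_derive a t (x1 v) -> is_derive b t (x2 v) -> is_derive c t (x3 v) ->
  is_dcurve (fun r => (a r, b r, c r)) t v.
Proof. now intros H1 H2 H3; split; [|split]. Qed.

Lemma is_dcurve_plus (f g : R -> L3) (t : R) (v w : L3) :
  is_dcurve f t v -> is_dcurve g t w ->
  is_dcurve (fun r => plus (f r) (g r)) t (plus v w).
Proof.
  intros (F1 & F2 & F3) (G1 & G2 & G3); split; [|split].
  - exact (D_plus _ _ _ _ _ F1 G1).
  - exact (D_plus _ _ _ _ _ F2 G2).
  - exact (D_plus _ _ _ _ _ F3 G3).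
Qed.

Lemma is_dcurve_scal (k : R -> R) (f : R -> L3) (t k' : R) (v : L3) :
  is_derive k t k' -> is_dcurve f t v ->
  is_dcurve (fun r => scal (k r) (f r)) t (plus (scal k' (f t)) (scal (k t) v)).
Proof.
  intros K (F1 & F2 & F3); split; [|split].
  - exact (D_mult _ _ _ _ _ K F1).
  - exact (D_mult _ _ _ _ _ K F2).
  - exact (D_mult _ _ _ _ _ K F3).
Qed.

Lemma is_dcurve_eq (f : R -> L3) (t : R) (v w : L3) :
  is_dcurve f t v -> v = w -> is_dcurve f t w.
Proof. now intros H <-. Qed.

Lemma is_dcurve_scal_const (k : R) (f : R -> L3) (t : R) (v : L3) :
  is_dcurve f t v -> is_dcurve (fun r => scal k (f r)) t (scal k v).
Proof.
  intros H. eapply is_dcurve_eq.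
  - exact (is_dcurve_scal (fun _ => k) f t 0 v (D_const k t) H).
  - vec_ext; ring.
Qed.

Lemma is_dcurve_combination (f g h : R -> R) (u v w : L3) (t f' g' h' : R) :
  is_derive f t f' -> is_derive g t g' -> is_derive h t h' ->
  is_dcurve (fun y => plus (plus (scal (f y) u) (scal (g y) v)) (scal (h y) w)) t
    (plus (plus (scal f' u) (scal g' v)) (scal h' w)).
Proof.
  intros Hf Hg Hh. eapply is_dcurve_eq.
  - apply is_dcurve_plus; [apply is_dcurve_plus|];
      (apply is_dcurve_scal; [eassumption|apply is_dcurve_const]).
  - apply L3_ext; autorewrite with coordinates; ring.
Qed.

Lemma is_dcurve_cross (f g : R -> L3) (t : R) (f' g' : L3) :
  is_dcurve f t f' -> is_dcurve g t g' ->
  is_dcurve (fun r => cross (f r) (g r)) t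
    (plus (cross f' (g t)) (cross (f t) g')).
Proof.
  intros (F1 & F2 & F3) (G1 & G2 & G3).
  apply is_dcurve_mk; coords; (evar_last; [derive|ring]).
Qed.

Lemma is_derive_normalized (a b c : R -> R) (t a' b' c' : R) :
  is_derive a t a' -> is_derive b t b' -> is_derive c t c' ->
  0 < a t ^ 2 + b t ^ 2 + c t ^ 2 ->
  a t * b' = b t * a' -> a t * c' = c t * a' ->
  is_derive (fun r => a r / sqrt (a r ^ 2 + b r ^ 2 + c r ^ 2)) t 0.
Proof.
  intros Ha Hb Hc Hpos E1 E2.
  assert (S := sqrt_sqrt _ (Rlt_le _ _ Hpos)).
  assert (P := sqrt_lt_R0 _ Hpos).
  evar_last.
  - apply D_div; [eassumption| |lra].
    apply is_derive_sqrt; [|exact Hpos].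
    apply (D_ext (fun r => a r * a r + b r * b r + c r * c r)).
    { intros r; ring. }
    derive.
  - set (s := sqrt _) in *.
    replace (a' * s - _) with
      ((a' * (s * s) - a t * (a' * a t + b' * b t + c' * c t)) / s)
      by (field; lra).
    rewrite S.
    replace (a' * _ - _) with (- b t * (a t * b' - b t * a')
      - c t * (a t * c' - c t * a')) by ring.
    rewrite E1, E2. field. split; exact (Rgt_not_eq _ _ P).
Qed.

(** The derivative of the Euclidean normalization of [n] is, up to a factor, the
    part of [n'] that is orthogonal to [n], which is zero here. *)
Lemma constant_direction (J : R -> Prop) (n n' : R -> L3) (t1 : R) :
  is_open_interval J -> J t1 ->
  (forall t, J t -> is_dcurve n t (n' t)) ->
  (forall t, J t -> cross (n t) (n' t) = zero) ->
  (forall t, J t -> n t <> zero) ->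
  forall t, J t -> exists k, k <> 0 /\ n t = scal k (n t1).
Proof.
  intros HJ Ht1 Hd Hc Hn.
  set (N := fun t => x1 (n t) ^ 2 + x2 (n t) ^ 2 + x3 (n t) ^ 2).
  assert (HN : forall t, J t -> 0 < N t).
  { intros t Ht. unfold N.
    assert (H1 := pow2_ge_0 (x1 (n t))). assert (H2 := pow2_ge_0 (x2 (n t))).
    assert (H3 := pow2_ge_0 (x3 (n t))).
    destruct (Req_dec (x1 (n t) ^ 2 + x2 (n t) ^ 2 + x3 (n t) ^ 2) 0); [|lra].
    exfalso; apply (Hn t Ht); vec_ext; nra. }
  assert (H : forall t, J t ->
     x1 (n t) / sqrt (N t) = x1 (n t1) / sqrt (N t1) /\
     x2 (n t) / sqrt (N t) = x2 (n t1) / sqrt (N t1) /\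
     x3 (n t) / sqrt (N t) = x3 (n t1) / sqrt (N t1)).
  { intros t Ht.
    assert (Hcr : forall r, J r ->
       x1 (n r) * x2 (n' r) = x2 (n r) * x1 (n' r) /\
       x1 (n r) * x3 (n' r) = x3 (n r) * x1 (n' r) /\
       x2 (n r) * x3 (n' r) = x3 (n r) * x2 (n' r)).
    { intros r Hr. specialize (Hc r Hr).
      assert (C1 := f_equal x1 Hc). assert (C2 := f_equal x2 Hc).
      assert (C3 := f_equal x3 Hc). coords_in C1; coords_in C2; coords_in C3.
      repeat split; lra. }
    repeat split.
    - apply (constant_of_zero_derivative J (fun t => x1 (n t) / sqrt (N t)));
        auto. intros r Hr. destruct (Hd r Hr) as (D1 & D2 & D3).
      destruct (Hcr r Hr) as (C1 & C2 & C3).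
      now apply (is_derive_normalized (fun t => x1 (n t)) (fun t => x2 (n t))
        (fun t => x3 (n t)) r (x1 (n' r)) (x2 (n' r)) (x3 (n' r))); auto; apply HN.
    - apply (constant_of_zero_derivative J (fun t => x2 (n t) / sqrt (N t)));
        auto. intros r Hr. destruct (Hd r Hr) as (D1 & D2 & D3).
      destruct (Hcr r Hr) as (C1 & C2 & C3). specialize (HN r Hr).
      apply (D_ext (fun t => x2 (n t) /
        sqrt (x2 (n t) ^ 2 + x1 (n t) ^ 2 + x3 (n t) ^ 2))).
      { intros u; unfold N; do 2 f_equal; ring. }
      apply (is_derive_normalized (fun t => x2 (n t)) (fun t => x1 (n t))
        (fun t => x3 (n t)) r (x2 (n' r)) (x1 (n' r)) (x3 (n' r))); auto.
      unfold N in HN; lra.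
    - apply (constant_of_zero_derivative J (fun t => x3 (n t) / sqrt (N t)));
        auto. intros r Hr. destruct (Hd r Hr) as (D1 & D2 & D3).
      destruct (Hcr r Hr) as (C1 & C2 & C3). specialize (HN r Hr).
      apply (D_ext (fun t => x3 (n t) /
        sqrt (x3 (n t) ^ 2 + x1 (n t) ^ 2 + x2 (n t) ^ 2))).
      { intros u; unfold N; do 2 f_equal; ring. }
      apply (is_derive_normalized (fun t => x3 (n t)) (fun t => x1 (n t))
        (fun t => x2 (n t)) r (x3 (n' r)) (x1 (n' r)) (x2 (n' r))); auto.
      unfold N in HN; lra. }
  intros t Ht. destruct (H t Ht) as (E1 & E2 & E3).
  assert (P := sqrt_lt_R0 _ (HN t Ht)). assert (P1 := sqrt_lt_R0 _ (HN t1 Ht1)).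
  exists (sqrt (N t) / sqrt (N t1)). split.
  { apply Rmult_integral_contrapositive_currified; [lra|].
    apply Rinv_neq_0_compat; lra. }
  assert (F : forall a b, a / sqrt (N t) = b / sqrt (N t1) ->
            a = sqrt (N t) / sqrt (N t1) * b).
  { intros a b E. replace a with (a / sqrt (N t) * sqrt (N t)) by (field; lra).
    rewrite E; field; lra. }
  vec_ext; now apply F.
Qed.

(** * The equations of a minimal ruled surface *)

Lemma is_dcurve_ruled (alpha beta : R -> L3) (t s : R) (a' b' : L3) :
  is_dcurve alpha t a' -> is_dcurve beta t b' ->
  is_dcurve (fun r => ruled alpha beta r s) t (plus a' (scal s b')).
Proof.
  intros Ha Hb. eapply is_dcurve_eq.
  - apply is_dcurve_plus; [exact Ha|].
    exact (is_dcurve_scal (fun _ => s) beta t 0 b' (D_const s t) Hb).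
  - vec_ext; ring.
Qed.

Lemma is_dcurve_affine (a b : L3) (s : R) :
  is_dcurve (fun r => plus a (scal r b)) s b.
Proof.
  eapply is_dcurve_eq.
  - apply is_dcurve_plus; [exact (is_dcurve_const a s)|].
    exact (is_dcurve_scal (fun r => r) (fun _ => b) s 1 zero (D_id s)
             (is_dcurve_const b s)).
  - vec_ext; ring.
Qed.

Lemma Dcurve_ext_loc (f g : R -> L3) (t : R) :
  locally t (fun r => f r = g r) -> Dcurve f t = Dcurve g t.
Proof.
  intros H; apply L3_ext; unfold Dcurve; autorewrite with coordinates;
    apply Derive_ext_loc; generalize H; apply filter_imp; now intros r ->.
Qed.

Lemma quadratic_vanishing (J : R -> Prop) (c0 c1 c2 : R) :
  is_open_interval J -> (forall s, J s -> c0 + c1 * s + c2 * s ^ 2 = 0) ->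
  c0 = 0 /\ c1 = 0 /\ c2 = 0.
Proof.
  intros HJ H. destruct (open_interval_inhabited J HJ) as [s Hs].
  destruct (proj1 (locally_R _ _) (open_interval_locally J s HJ Hs))
    as (e & He & Hl).
  (* A quadratic with the three roots [s] and [s + e / 2], [s - e / 2]. *)
  assert (H0 := H s Hs).
  assert (H1 := H (s + e / 2) (Hl _ ltac:(replace (s + e / 2 - s) with (e / 2)
    by ring; rewrite Rabs_pos_eq; lra))).
  assert (H2 := H (s - e / 2) (Hl _ ltac:(replace (s - e / 2 - s) with (- (e / 2))
    by ring; rewrite Rabs_Ropp, Rabs_pos_eq; lra))).
  assert (E2 : c2 = 0).
  { apply Rmult_eq_reg_r with (e * e); nra. }
  subst c2. assert (E1 : c1 = 0).
  { apply Rmult_eq_reg_r with e; nra. }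
  subst c1. repeat split; lra.
Qed.

(** The numerator of the mean curvature is a quadratic polynomial in [s]; the
    normalization of the unit normal only multiplies it by a nonzero factor. *)
Lemma minimal_ruled_equations (J1 J2 : R -> Prop) (alpha beta : R -> L3) :
  is_open_interval J1 -> is_open_interval J2 ->
  analytic_curve J1 alpha -> analytic_curve J1 beta ->
  timelike J1 J2 (ruled alpha beta) -> minimal J1 J2 (ruled alpha beta) ->
  forall t, J1 t ->
  let a' := Dcurve alpha t in let a'' := Dcurve (Dcurve alpha) t in
  let b := beta t in
  let b' := Dcurve beta t in let b'' := Dcurve (Dcurve beta) t in
  lorentz b b * det a' b a'' = 2 * det a' b b' * lorentz a' b /\
  lorentz b b * (det a' b b'' + det b' b a'') = 2 * det a' b b' * lorentz b' b /\
  lorentz b b * det b' b b'' = 0 /\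
  (forall s, J2 s -> signature11 (plus a' (scal s b')) b).
Proof.
  intros HJ1 HJ2 Ha Hb Htl Hmin t Ht a' a'' b b' b''.
  assert (Da : forall r, J1 r -> is_dcurve alpha r (Dcurve alpha r))
    by (intros; now apply (analytic_is_dcurve J1)).
  assert (Db : forall r, J1 r -> is_dcurve beta r (Dcurve beta r))
    by (intros; now apply (analytic_is_dcurve J1)).
  assert (Da2 := analytic_is_dcurve J1 _ t (analytic_Dcurve J1 _ Ha) Ht).
  assert (Db2 := analytic_is_dcurve J1 _ t (analytic_Dcurve J1 _ Hb) Ht).
  assert (Xt : forall r s, J1 r -> Du (ruled alpha beta) r s
            = plus (Dcurve alpha r) (scal s (Dcurve beta r))).
  { intros r s Hr. apply Dcurve_eq. apply is_dcurve_ruled; auto. }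
  assert (Xs : forall r s, Dv (ruled alpha beta) r s = beta r).
  { intros r s. apply Dcurve_eq. apply is_dcurve_affine. }
  assert (Xss : forall s, Dv (Dv (ruled alpha beta)) t s = zero).
  { intros s. unfold Dv at 1.
    rewrite (Dcurve_ext_loc _ (fun _ => beta t)).
    - apply Dcurve_eq, is_dcurve_const.
    - apply filter_forall; intros r; apply Xs. }
  assert (Xtt : forall s, Du (Du (ruled alpha beta)) t s = plus a'' (scal s b'')).
  { intros s. unfold Du at 1.
    rewrite (Dcurve_ext_loc _ (fun r => ruled (Dcurve alpha) (Dcurve beta) r s)).
    - apply Dcurve_eq. now apply is_dcurve_ruled.
    - generalize (open_interval_locally J1 t HJ1 Ht); apply filter_imp.
      intros r Hr; now apply Xt. }
  assert (Xts : forall s, Dv (Du (ruled alpha beta)) t s = b').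
  { intros s. unfold Dv.
    rewrite (Dcurve_ext_loc _ (fun r => plus a' (scal r b'))).
    - apply Dcurve_eq, is_dcurve_affine.
    - apply filter_forall; intros r; now apply Xt. }
  assert (Hs : forall s, J2 s -> signature11 (plus a' (scal s b')) b).
  { intros s Js. specialize (Htl t s Ht Js). unfold timelike_at in Htl.
    now rewrite Xt, Xs in Htl. }
  assert (Hpoly : forall s, J2 s ->
    lorentz b b * det (plus a' (scal s b')) b (plus a'' (scal s b''))
    - 2 * det a' b b' * (lorentz a' b + s * lorentz b' b) = 0).
  { intros s Js. specialize (Hmin t s Ht Js). specialize (Hs s Js).
    apply signature11_gram_neg in Hs.
    unfold mean_curvature, unit_normal in Hmin. cbv zeta in Hmin.
    rewrite Xt, Xs, Xss, Xtt, Xts in Hmin by easy.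
    fold a' b' b in Hmin.
    set (n := cross (plus a' (scal s b')) b) in *.
    assert (Hn : lorentz n n <> 0).
    { unfold n. rewrite lorentz_cross_cross, (lorentz_sym b (plus _ _)). intros E. nra. }
    assert (Hr : / sqrt (Rabs (lorentz n n)) <> 0).
    { apply Rinv_neq_0_compat, Rgt_not_eq, sqrt_lt_R0, Rabs_pos_lt, Hn. }
    set (k := / sqrt (Rabs (lorentz n n))) in *.
    assert (Hk : k * (lorentz b b * lorentz n (plus a'' (scal s b''))
       - 2 * lorentz n b' * lorentz (plus a' (scal s b')) b) = 0).
    { apply Rmult_eq_reg_r with
        (/ (2 * (lorentz (plus a' (scal s b')) (plus a' (scal s b'))
              * lorentz b b - lorentz (plus a' (scal s b')) b ^ 2))).
      2:{ apply Rinv_neq_0_compat; lra. }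
      rewrite Rmult_0_l, <- Hmin. unfold Rdiv. f_equal.
      rewrite !lorentz_scal_r, (lorentz_sym zero), (lorentz_sym b' n),
        (lorentz_sym (plus a'' _) n).
      replace (lorentz n zero) with 0 by (coords; ring). ring. }
    apply Rmult_integral in Hk. destruct Hk as [|Hk]; [easy|].
    rewrite <- Hk. rewrite lorentz_plus_l, lorentz_scal_l.
    replace (lorentz n b') with (det a' b b') by (unfold n; coords; ring).
    unfold det, n; ring. }
  destruct (quadratic_vanishing J2
    (lorentz b b * det a' b a'' - 2 * det a' b b' * lorentz a' b)
    (lorentz b b * (det a' b b'' + det b' b a'')
       - 2 * det a' b b' * lorentz b' b)
    (lorentz b b * det b' b b'') HJ2) as (E0 & E1 & E2).
  { intros s Js. rewrite <- (Hpoly s Js). coords; ring. }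
  repeat split; auto; lra.
Qed.

(** * Ruled surfaces with rulings parallel to a plane, in coordinates *)

(* In the lemmas below [(h, y, z)] are coordinates of the base curve, [h] along
   the axis, and [(0, p, q)] those of the ruling.  The metric on the plane
   [h = 0] is [y ^ 2 - kappa z ^ 2], up to a sign, and [W], [V] are the
   determinants of the ruling with its derivative and with the velocity of the
   base curve in that plane. *)

Definition differentiable_twice (J : R -> Prop) (f f1 f2 : R -> R) : Prop :=
  forall t, J t -> is_derive f t (f1 t) /\ is_derive f1 t (f2 t).

(** The orbit of [(1, 0)] under the one-parameter group of linear isometries of
    [y ^ 2 - kappa z ^ 2]: a circle, a line or a hyperbola for [kappa] equal to
    [-1], [0] or [1]. *)
Definition unit_speed_conic (kappa : R) (C S : R -> R) : Prop :=
  S 0 = 0 /\ forall u, C u ^ 2 - kappa * S u ^ 2 = 1 /\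
    is_derive C u (kappa * S u) /\ is_derive S u (C u).

(** Motion of the striction point in the plane of the rulings, in terms of the
    turning parameter.  There is none for [tau = 0]; for a null axis, where
    [tau = 1] couples the axis to the plane, it traces a cubic. *)
Definition center_drift (tau : R) (C S A B : R -> R) : Prop :=
  forall u, is_derive A u (- (2 * tau * (S u * C u))) /\
    is_derive B u (- (2 * tau * S u ^ 2)).

(** The quotient compares the speed at which the ruling turns with the speed
    along the axis.  The hypothesis says that the numerator of its derivative
    is zero. *)
Lemma axis_rate_constant (kappa : R) (h1 h2 p p1 p2 q q1 q2 : R -> R) (t1 t : R) :
  let g t := p t ^ 2 - kappa * q t ^ 2 in
  let W t := p t * q1 t - q t * p1 t in
  (forall s, segment t1 t s ->
     (is_derive h1 s (h2 s) /\ is_derive p s (p1 s) /\ is_derive p1 s (p2 s) /\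
      is_derive q s (q1 s) /\ is_derive q1 s (q2 s)) /\
     g s * (h1 s * (p s * q2 s - q s * p2 s) - h2 s * W s)
     = 2 * (p s * p1 s - kappa * q s * q1 s) * (h1 s * W s) /\
     g s <> 0 /\ h1 s <> 0) ->
  W t / (g t * h1 t) = W t1 / (g t1 * h1 t1).
Proof.
  intros g W H.
  apply (constant_on_segment (fun r => W r / (g r * h1 r))). intros s Hs.
  destruct (H s Hs) as ((Dh & Dp & Dp1 & Dq & Dq1) & E & Hg & Hh).
  apply (D_ext (fun r => W r / ((p r * p r - kappa * (q r * q r)) * h1 r))).
  { intros r; unfold g.
    now replace (p r ^ 2) with (p r * p r) by ring;
      replace (q r ^ 2) with (q r * q r) by ring. }
  unfold W. apply Rminus_diag_eq in E.
  assert (Hgh : g s * h1 s <> 0)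
    by now apply Rmult_integral_contrapositive_currified.
  assert (Hgh' : (p s * p s - kappa * (q s * q s)) * h1 s <> 0).
  { replace (p s * p s - kappa * (q s * q s)) with (g s); [easy|unfold g; ring]. }
  evar_last; [derive; exact Hgh'|].
  unfold Rdiv; apply Rmult_eq_0_compat_r.
  transitivity (g s * (h1 s * (p s * q2 s - q s * p2 s) - h2 s * W s)
    - 2 * (p s * p1 s - kappa * q s * q1 s) * (h1 s * W s)); [|exact E].
  unfold g, W; ring.
Qed.

(** The square of the difference of both sides, divided by [g], is constant,
    and it is zero at [t1]. *)
Lemma direction_on_conic (kappa c : R) (C S h h1 p p1 q q1 : R -> R) (t1 t : R) :
  unit_speed_conic kappa C S ->
  let g t := p t ^ 2 - kappa * q t ^ 2 in
  let u t := c * (h t - h t1) in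
  (forall s, segment t1 t s ->
     (is_derive h s (h1 s) /\ is_derive p s (p1 s) /\ is_derive q s (q1 s)) /\
     p s * q1 s - q s * p1 s = c * g s * h1 s /\ g s <> 0) ->
  q t1 = 0 -> p t * S (u t) = q t * C (u t).
Proof.
  intros [HS0 HCS] g u H Hq1.
  set (P := fun t => p t * S (u t) - q t * C (u t)).
  assert (E : P t * P t / g t = P t1 * P t1 / g t1).
  { apply (constant_on_segment (fun r => P r * P r / g r)). intros s Hs.
    destruct (H s Hs) as ((Dh & Dp & Dq) & E & Hg).
    destruct (HCS (u s)) as (_ & HC & HS).
    assert (Du : is_derive u s (c * h1 s)) by (unfold u; evar_last; [derive|ring]).
    assert (DC := D_comp C u s _ _ HC Du). assert (DS := D_comp S u s _ _ HS Du).
    assert (Dg : is_derive g s (2 * (p s * p1 s - kappa * q s * q1 s))).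
    { apply (D_ext (fun r => p r * p r - kappa * (q r * q r))).
      { intros r; unfold g; ring. }
      evar_last; [derive|ring]. }
    assert (DP : is_derive P s ((p s * p1 s - kappa * q s * q1 s) / g s * P s)).
    { unfold P at 1. evar_last; [derive|].
      replace (c * h1 s) with ((p s * q1 s - q s * p1 s) / g s)
        by (rewrite E; field; easy).
      unfold P, g in *. field; easy. }
    evar_last; [derive; easy|]. field; easy. }
  assert (E' : P t1 = 0).
  { unfold P, u. replace (c * (h t1 - h t1)) with 0 by ring.
    rewrite HS0, Hq1; ring. }
  destruct (H t (segment_r t1 t)) as (_ & _ & Hg).
  rewrite E' in E. assert (E2 : P t * P t = 0).
  { replace (P t * P t) with (P t * P t / g t * g t) by (field; easy).
    rewrite E; unfold Rdiv; ring. }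
  destruct (Rmult_integral _ _ E2) as [E3|E3]; unfold P in E3; lra.
Qed.

(** [(y - V p / W, z - V q / W)] is the striction point of the ruling seen along
    the axis: there the velocity in the plane is parallel to the ruling.  The
    two equations express [W'] and [V'] by lower derivatives; substituted in
    the derivative of that point they leave only the term in [tau]. *)
Lemma center_moves_by_drift (kappa tau c : R) (C S A B : R -> R)
    (h h1 h2 y y1 y2 z z1 z2 p p1 p2 q q1 q2 : R -> R) (t1 t : R) :
  unit_speed_conic kappa C S -> center_drift tau C S A B -> c <> 0 ->
  let g t := p t ^ 2 - kappa * q t ^ 2 in
  let W t := p t * q1 t - q t * p1 t in
  let V t := p t * z1 t - q t * y1 t in
  let u t := c * (h t - h t1) in
  (forall s, segment t1 t s ->
     (is_derive h s (h1 s) /\ is_derive y s (y1 s) /\ is_derive y1 s (y2 s) /\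
      is_derive z s (z1 s) /\ is_derive z1 s (z2 s) /\
      is_derive p s (p1 s) /\ is_derive p1 s (p2 s) /\
      is_derive q s (q1 s) /\ is_derive q1 s (q2 s)) /\
     g s * (h1 s * (p s * q2 s - q s * p2 s) - h2 s * W s)
     = 2 * (p s * p1 s - kappa * q s * q1 s) * (h1 s * W s) /\
     g s * (h1 s * (p s * z2 s - q s * y2 s) - h2 s * V s)
     = 2 * (h1 s * W s) * (y1 s * p s - kappa * z1 s * q s + tau * h1 s * q s) /\
     g s <> 0 /\ h1 s <> 0 /\ W s <> 0 /\ p s * S (u s) = q s * C (u s)) ->
  y t - V t * p t / W t - A (u t) / c = y t1 - V t1 * p t1 / W t1 - A (u t1) / c /\
  z t - V t * q t / W t - B (u t) / c = z t1 - V t1 * q t1 / W t1 - B (u t1) / c.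
Proof.
  intros [_ HCS] HAB Hc g W V u H.
  assert (Key : forall s, segment t1 t s ->
    is_derive W s (p s * q2 s - q s * p2 s) /\
    is_derive V s (p s * z2 s - q s * y2 s + (p1 s * z1 s - q1 s * y1 s)) /\
    is_derive (fun r => A (u r)) s (- (2 * tau * c * h1 s * p s * q s / g s)) /\
    is_derive (fun r => B (u r)) s (- (2 * tau * c * h1 s * q s ^ 2 / g s))).
  { intros s Hs.
    destruct (H s Hs) as ((Dh & Dy & Dy1 & Dz & Dz1 & Dp & Dp1 & Dq & Dq1)
      & E1 & E0 & Hg & Hh & HW & HP).
    destruct (HCS (u s)) as (H1 & _ & _). destruct (HAB (u s)) as (HA & HB).
    assert (Du : is_derive u s (c * h1 s)) by (unfold u; evar_last; [derive|ring]).
    set (mu := p s * C (u s) - kappa * q s * S (u s)).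
    assert (Ep : p s = mu * C (u s)).
    { unfold mu. transitivity (p s * (C (u s) ^ 2 - kappa * S (u s) ^ 2)
        + kappa * S (u s) * (p s * S (u s) - q s * C (u s))); [|ring].
      rewrite HP, H1; ring. }
    assert (Eq : q s = mu * S (u s)).
    { unfold mu. transitivity (q s * (C (u s) ^ 2 - kappa * S (u s) ^ 2)
        - C (u s) * (q s * C (u s) - p s * S (u s))); [|ring].
      rewrite HP, H1; ring. }
    assert (Eg : g s = mu ^ 2).
    { unfold g. rewrite Ep, Eq.
      transitivity (mu ^ 2 * (C (u s) ^ 2 - kappa * S (u s) ^ 2)); [ring|].
      rewrite H1; ring. }
    assert (Hmu : mu <> 0) by (intros E; apply Hg; rewrite Eg, E; ring).
    split; [|split; [|split]].
    - unfold W; evar_last; [derive|ring].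
    - unfold V; evar_last; [derive|ring].
    - evar_last; [exact (D_comp A u s _ _ HA Du)|]. rewrite Eg, Ep, Eq. field; easy.
    - evar_last; [exact (D_comp B u s _ _ HB Du)|]. rewrite Eg, Eq. field; easy. }
  assert (Alg : forall s, segment t1 t s ->
    p s * q2 s - q s * p2 s
    = (2 * (p s * p1 s - kappa * q s * q1 s) / g s + h2 s / h1 s) * W s /\
    p s * z2 s - q s * y2 s
    = 2 * W s * (y1 s * p s - kappa * z1 s * q s + tau * h1 s * q s) / g s
      + h2 s / h1 s * V s).
  { intros s Hs. destruct (H s Hs) as (_ & E1 & E0 & Hg & Hh & HW & _).
    set (W' := p s * q2 s - q s * p2 s) in *.
    set (V' := p s * z2 s - q s * y2 s) in *.
    split; (apply Rmult_eq_reg_l with (g s * h1 s);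
        [|now apply Rmult_integral_contrapositive_currified]).
    - transitivity (g s * (h1 s * W' - h2 s * W s) + g s * h2 s * W s); [ring|].
      rewrite E1. field; easy.
    - transitivity (g s * (h1 s * V' - h2 s * V s) + g s * h2 s * V s); [ring|].
      rewrite E0. field; easy. }
  split.
  - apply (constant_on_segment (fun t => y t - V t * p t / W t - A (u t) / c)).
    intros s Hs. destruct (Key s Hs) as (DW & DV & DA & _).
    destruct (Alg s Hs) as (EW & EV).
    destruct (H s Hs) as ((_ & Dy & _ & _ & _ & Dp & _ & Dq & _)
      & _ & _ & Hg & Hh & HW & _).
    evar_last; [derive; easy|].
    rewrite EW, EV. clear -Hg Hh HW Hc.
    unfold V, W, g in *. field; repeat split; easy.
  - apply (constant_on_segment (fun t => z t - V t * q t / W t - B (u t) / c)).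
    intros s Hs. destruct (Key s Hs) as (DW & DV & _ & DB).
    destruct (Alg s Hs) as (EW & EV).
    destruct (H s Hs) as ((_ & _ & _ & Dz & _ & Dp & _ & Dq & _)
      & _ & _ & Hg & Hh & HW & _).
    evar_last; [derive; easy|].
    rewrite EW, EV. clear -Hg Hh HW Hc.
    unfold V, W, g in *. field; repeat split; easy.
Qed.

(** On a segment from [t1] without zeros of [g], [h1] and [W], the three
    preceding lemmas give four closed identities.  They persist at the end of
    the segment by continuity.  There they make [(p, q)] a nonzero multiple of
    a point of the conic, so [g <> 0]; and [h1 = 0] would give [W = 0] and then
    [V = 0], against transversality.  So [g], [h1] and [W] have no zeros. *)
Lemma ruled_normal_form (J : R -> Prop) (kappa tau : R) (C S A B : R -> R)
    (h h1 h2 y y1 y2 z z1 z2 p p1 p2 q q1 q2 : R -> R) (t1 : R) :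
  unit_speed_conic kappa C S -> center_drift tau C S A B ->
  is_open_interval J -> J t1 ->
  differentiable_twice J h h1 h2 -> differentiable_twice J y y1 y2 ->
  differentiable_twice J z z1 z2 -> differentiable_twice J p p1 p2 ->
  differentiable_twice J q q1 q2 ->
  let g t := p t ^ 2 - kappa * q t ^ 2 in
  let W t := p t * q1 t - q t * p1 t in
  let V t := p t * z1 t - q t * y1 t in
  (forall t, J t -> g t * (h1 t * (p t * q2 t - q t * p2 t) - h2 t * W t)
     = 2 * (p t * p1 t - kappa * q t * q1 t) * (h1 t * W t)) ->
  (forall t, J t ->
     g t * (h1 t * (p t * z2 t - q t * y2 t) - h2 t * V t)
     = 2 * (h1 t * W t) * (y1 t * p t - kappa * z1 t * q t + tau * h1 t * q t)) ->
  (forall t, J t -> ~ (p t = 0 /\ q t = 0)) ->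
  (forall t, J t -> ~ (h1 t = 0 /\ V t = 0)) ->
  q t1 = 0 -> h1 t1 * W t1 <> 0 ->
  exists c y0 z0, c <> 0 /\ forall t, J t ->
    let u := c * (h t - h t1) in
    exists mu lambda, mu <> 0 /\ h1 t <> 0 /\
      p t = mu * C u /\ q t = mu * S u /\
      y t = y0 + A u / c + lambda * C u /\ z t = z0 + B u / c + lambda * S u /\
      W t = c * mu ^ 2 * h1 t /\ V t = c * mu * lambda * h1 t.
Proof.
  intros HCS HAB HJ Ht1 Hh Hy Hz Hp Hq g W V E1 E0 Hbeta Htr Hq1 HW1.
  assert (Hp1 : p t1 <> 0) by (intros E; now apply (Hbeta t1)).
  assert (Hg1 : g t1 <> 0).
  { unfold g; rewrite Hq1. replace (p t1 ^ 2 - _) with (p t1 * p t1) by ring.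
    now apply Rmult_integral_contrapositive_currified. }
  assert (Hh1 : h1 t1 <> 0) by (intros E; apply HW1; rewrite E; ring).
  assert (HW1' : W t1 <> 0) by (intros E; apply HW1; rewrite E; ring).
  set (c := W t1 / (g t1 * h1 t1)).
  assert (Hc : c <> 0).
  { apply Rmult_integral_contrapositive_currified; [easy|].
    now apply Rinv_neq_0_compat, Rmult_integral_contrapositive_currified. }
  set (u := fun t => c * (h t - h t1)).
  set (y0 := y t1 - V t1 * p t1 / W t1 - A (u t1) / c).
  set (z0 := z t1 - V t1 * q t1 / W t1 - B (u t1) / c).
  set (f := fun t => g t * (h1 t * W t)).
  assert (Hseg : forall t, J t -> (forall r, segment t1 t r -> f r <> 0) ->
    W t - c * g t * h1 t = 0 /\ p t * S (u t) - q t * C (u t) = 0 /\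
    (y t - y0 - A (u t) / c) * W t - V t * p t = 0 /\
    (z t - z0 - B (u t) / c) * W t - V t * q t = 0).
  { intros t Ht Hf.
    assert (Hin : forall r, segment t1 t r ->
       J r /\ g r <> 0 /\ h1 r <> 0 /\ W r <> 0).
    { intros r Hr. specialize (Hf r Hr). unfold f in Hf.
      split; [now apply (open_interval_between J t1 t)|].
      repeat split; intros E; apply Hf; rewrite E; ring. }
    assert (Hrate : forall r, segment t1 t r -> W r = c * g r * h1 r).
    { intros r Hr.
      assert (E : W r / (g r * h1 r) = c).
      { apply (axis_rate_constant kappa h1 h2 p p1 p2 q q1 q2). intros s Hs.
        destruct (Hin s (segment_trans _ _ _ _ Hr Hs)) as (Js & Hg & H1 & _).
        destruct (Hh s Js), (Hp s Js), (Hq s Js).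
        split; [tauto|]. split; [now apply E1|easy]. }
      destruct (Hin r Hr) as (_ & Hg & H1 & _).
      rewrite <- E; field; easy. }
    assert (Hdir : forall r, segment t1 t r -> p r * S (u r) = q r * C (u r)).
    { intros r Hr. apply (direction_on_conic kappa c C S h h1 p p1 q q1); auto.
      intros s Hs. assert (Hs' := segment_trans _ _ _ _ Hr Hs).
      destruct (Hin s Hs') as (Js & Hg & _).
      destruct (Hh s Js), (Hp s Js), (Hq s Js).
      split; [tauto|]. split; [now apply Hrate|easy]. }
    destruct (center_moves_by_drift kappa tau c C S A B h h1 h2 y y1 y2 z z1 z2
      p p1 p2 q q1 q2 t1 t HCS HAB Hc) as (EY & EZ).
    { intros s Hs. destruct (Hin s Hs) as (Js & Hg & H1 & HW).
      destruct (Hh s Js), (Hy s Js), (Hz s Js), (Hp s Js), (Hq s Js).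
      split; [tauto|]. split; [exact (E1 s Js)|]. split; [exact (E0 s Js)|].
      repeat split; auto. }
    fold (W t) (V t) (u t) (W t1) (V t1) (u t1) in EY, EZ.
    fold y0 in EY; fold z0 in EZ.
    destruct (Hin t (segment_r t1 t)) as (_ & _ & _ & HW).
    split; [rewrite Hrate; [ring|apply segment_r]|].
    split; [rewrite Hdir; [ring|apply segment_r]|].
    split; [rewrite <- EY|rewrite <- EZ]; field; easy. }
  clearbody c.
  (* Wherever the four identities hold, transversality excludes a zero
     of [f]. *)
  assert (Hvals : forall t, J t ->
    W t - c * g t * h1 t = 0 -> p t * S (u t) - q t * C (u t) = 0 ->
    (y t - y0 - A (u t) / c) * W t - V t * p t = 0 ->
    (z t - z0 - B (u t) / c) * W t - V t * q t = 0 ->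
    exists mu, p t = mu * C (u t) /\ q t = mu * S (u t) /\ mu <> 0 /\
      g t = mu ^ 2 /\ h1 t <> 0).
  { intros t Ht F1 F2 F3 F4.
    destruct HCS as [_ HCS]. destruct (HCS (u t)) as (H1 & _).
    exists (p t * C (u t) - kappa * q t * S (u t)).
    set (mu := p t * C (u t) - kappa * q t * S (u t)).
    assert (Ep : p t = mu * C (u t)).
    { unfold mu. transitivity (p t * (C (u t) ^ 2 - kappa * S (u t) ^ 2)
        + kappa * S (u t) * (p t * S (u t) - q t * C (u t))); [|ring].
      rewrite F2, H1; ring. }
    assert (Eq : q t = mu * S (u t)).
    { unfold mu. transitivity (q t * (C (u t) ^ 2 - kappa * S (u t) ^ 2)
        + C (u t) * (p t * S (u t) - q t * C (u t))); [|ring].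
      rewrite F2, H1; ring. }
    assert (Eg : g t = mu ^ 2).
    { unfold g. rewrite Ep, Eq.
      transitivity (mu ^ 2 * (C (u t) ^ 2 - kappa * S (u t) ^ 2)); [ring|].
      rewrite H1; ring. }
    assert (Hmu : mu <> 0).
    { intros E; apply (Hbeta t Ht); rewrite Ep, Eq, E; split; ring. }
    repeat split; auto. intros E.
    assert (EW : W t = 0).
    { apply Rminus_diag_uniq_sym in F1. rewrite <- F1, E; ring. }
    rewrite EW in F3, F4. apply (Htr t Ht). split; [easy|].
    destruct (Req_dec (V t) 0) as [EV|EV]; [easy|exfalso].
    apply (Hbeta t Ht).
    split; apply Rmult_eq_reg_l with (V t); auto; lra. }
  assert (Hnz : forall t, J t -> f t <> 0).
  { assert (Cu : forall t, J t -> is_derive u t (c * h1 t)).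
    { intros t Ht; destruct (Hh t Ht). unfold u; evar_last; [derive|ring]. }
    assert (DW : forall t, J t -> is_derive W t (p t * q2 t - q t * p2 t)).
    { intros t Ht; destruct (Hp t Ht), (Hq t Ht). unfold W.
      evar_last; [derive|ring]. }
    assert (DV : forall t, J t -> is_derive V t
       (p t * z2 t - q t * y2 t + (p1 t * z1 t - q1 t * y1 t))).
    { intros t Ht; destruct (Hp t Ht), (Hq t Ht), (Hy t Ht), (Hz t Ht).
      unfold V; evar_last; [derive|ring]. }
    assert (Dg : forall t, J t ->
      is_derive g t (2 * (p t * p1 t - kappa * q t * q1 t))).
    { intros t Ht; destruct (Hp t Ht), (Hq t Ht).
      apply (D_ext (fun r => p r * p r - kappa * (q r * q r))).
      { intros r; unfold g; ring. }
      evar_last; [derive|ring]. }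
    apply (nonvanishing_propagates J f t1); auto.
    - unfold f. now apply Rmult_integral_contrapositive_currified.
    - intros t Ht. specialize (DW t Ht). specialize (Dg t Ht).
      destruct (Hh t Ht). eapply is_derive_continuous. unfold f; derive.
    - intros t Ht Htt Hf.
      specialize (DW t Ht). specialize (DV t Ht). specialize (Dg t Ht).
      specialize (Cu t Ht).
      assert (DC := D_comp C u t _ _ (proj1 (proj2 (proj2 HCS (u t)))) Cu).
      assert (DS := D_comp S u t _ _ (proj2 (proj2 (proj2 HCS (u t)))) Cu).
      assert (DA := D_comp A u t _ _ (proj1 (HAB (u t))) Cu).
      assert (DB := D_comp B u t _ _ (proj2 (HAB (u t))) Cu).
      destruct (Hh t Ht), (Hp t Ht), (Hq t Ht), (Hy t Ht), (Hz t Ht).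
      assert (Hs : forall r, segment t1 t r -> r <> t ->
                forall r', segment t1 r r' -> f r' <> 0).
      { intros r Hr Hrt r' Hr'. apply Hf.
        - exact (segment_trans _ _ _ _ Hr Hr').
        - revert Hr Hr'. unfold segment, Rmin, Rmax; repeat destruct Rle_dec; lra. }
      assert (HJr : forall r, segment t1 t r -> J r).
      { intros r Hr; now apply (open_interval_between J t1 t). }
      assert (F1 : W t - c * g t * h1 t = 0).
      { apply (vanishes_at_segment_end
          (fun t => W t - c * g t * h1 t) t1 t Htt).
        - eapply is_derive_continuous; derive.
        - intros r Hr Hrt. now apply (Hseg r (HJr r Hr) (Hs r Hr Hrt)). }
      assert (F2 : p t * S (u t) - q t * C (u t) = 0).
      { apply (vanishes_at_segment_end
          (fun t => p t * S (u t) - q t * C (u t)) t1 t Htt).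
        - eapply is_derive_continuous; derive.
        - intros r Hr Hrt. now apply (Hseg r (HJr r Hr) (Hs r Hr Hrt)). }
      assert (F3 : (y t - y0 - A (u t) / c) * W t - V t * p t = 0).
      { apply (vanishes_at_segment_end
          (fun t => (y t - y0 - A (u t) / c) * W t - V t * p t) t1 t Htt).
        - eapply is_derive_continuous; derive; exact Hc.
        - intros r Hr Hrt. now apply (Hseg r (HJr r Hr) (Hs r Hr Hrt)). }
      assert (F4 : (z t - z0 - B (u t) / c) * W t - V t * q t = 0).
      { apply (vanishes_at_segment_end
          (fun t => (z t - z0 - B (u t) / c) * W t - V t * q t) t1 t Htt).
        - eapply is_derive_continuous; derive; exact Hc.
        - intros r Hr Hrt. now apply (Hseg r (HJr r Hr) (Hs r Hr Hrt)). }
      destruct (Hvals t Ht F1 F2 F3 F4) as (mu & _ & _ & Hmu & Eg & Hht).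
      apply Rminus_diag_uniq in F1. unfold f. rewrite F1, Eg.
      repeat apply Rmult_integral_contrapositive_currified; auto.
      all: now apply pow_nonzero. }
  exists c, y0, z0. split; [easy|]. intros t Ht u'. fold (u t) in u'; subst u'.
  destruct (Hseg t Ht) as (F1 & F2 & F3 & F4).
  { intros r Hr; apply Hnz; now apply (open_interval_between J t1 t). }
  destruct (Hvals t Ht F1 F2 F3 F4) as (mu & Ep & Eq & Hmu & Eg & Hht).
  apply Rminus_diag_uniq in F1, F3, F4. rewrite Eg in F1.
  exists mu, (V t / (c * mu * h1 t)).
  fold (u t).
  split; [exact Hmu|split; [exact Hht|split; [exact Ep|split; [exact Eq|]]]].
  repeat split.
  - apply Rmult_eq_reg_r with (c * mu * h1 t).
    2: repeat apply Rmult_integral_contrapositive_currified; auto.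
    transitivity (y0 * (c * mu * h1 t) + A (u t) * mu * h1 t + V t * C (u t));
      [|field; auto].
    apply Rmult_eq_reg_l with mu; [|easy].
    transitivity ((y t - y0 - A (u t) / c) * (c * mu ^ 2 * h1 t)
      + mu * (y0 * (c * mu * h1 t) + A (u t) * mu * h1 t)); [field; auto|].
    rewrite <- F1, F3, Ep. ring.
  - apply Rmult_eq_reg_r with (c * mu * h1 t).
    2: repeat apply Rmult_integral_contrapositive_currified; auto.
    transitivity (z0 * (c * mu * h1 t) + B (u t) * mu * h1 t + V t * S (u t));
      [|field; auto].
    apply Rmult_eq_reg_l with mu; [|easy].
    transitivity ((z t - z0 - B (u t) / c) * (c * mu ^ 2 * h1 t)
      + mu * (z0 * (c * mu * h1 t) + B (u t) * mu * h1 t)); [field; auto|].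
    rewrite <- F1, F4, Eq. ring.
  - rewrite F1; ring.
  - field; auto.
Qed.

(** * Adapted frames *)

(** [f0], [f1], [f2] act as covectors: the coordinates of [v] are its products
    with them, the first one along the axis.  For [tau = 0] the axis is
    orthogonal to the plane [f0 = 0]; for [delta = kappa = 0] and [tau = 1] it
    is a null line contained in that plane. *)
Definition adapted_frame (delta eps kappa tau : R) (f0 f1 f2 : L3) : Prop :=
  forall v w, lorentz v w =
    delta * (lorentz f0 v * lorentz f0 w)
    + eps * (lorentz f1 v * lorentz f1 w - kappa * (lorentz f2 v * lorentz f2 w))
    + tau * (lorentz f0 v * lorentz f2 w + lorentz f2 v * lorentz f0 w).

Lemma det_in_frame (f0 f1 f2 u v w : L3) :
  lorentz f0 u * (lorentz f1 v * lorentz f2 w - lorentz f2 v * lorentz f1 w)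
  - lorentz f1 u * (lorentz f0 v * lorentz f2 w - lorentz f2 v * lorentz f0 w)
  + lorentz f2 u * (lorentz f0 v * lorentz f1 w - lorentz f1 v * lorentz f0 w)
  = - det f0 f1 f2 * det u v w.
Proof. coords; ring. Qed.

Lemma frame_zero (delta eps kappa tau : R) (f0 f1 f2 v : L3) :
  adapted_frame delta eps kappa tau f0 f1 f2 ->
  lorentz f0 v = 0 -> lorentz f1 v = 0 -> lorentz f2 v = 0 -> v = zero.
Proof.
  intros Hf H0 H1 H2. apply lorentz_nondegenerate; intros w.
  rewrite Hf, H0, H1, H2; ring.
Qed.

(** Compare the determinants of the Gram matrices of the standard basis computed
    from both sides of the frame identity: the left one is [-1], the right one
    a multiple of [det f0 f1 f2 ^ 2]. *)
Lemma adapted_frame_det (delta eps kappa tau : R) (f0 f1 f2 : L3) :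
  adapted_frame delta eps kappa tau f0 f1 f2 -> det f0 f1 f2 <> 0.
Proof.
  intros Hf E.
  assert (H11 := Hf (1, 0, 0) (1, 0, 0)). assert (H12 := Hf (1, 0, 0) (0, 1, 0)).
  assert (H13 := Hf (1, 0, 0) (0, 0, 1)). assert (H22 := Hf (0, 1, 0) (0, 1, 0)).
  assert (H23 := Hf (0, 1, 0) (0, 0, 1)). assert (H33 := Hf (0, 0, 1) (0, 0, 1)).
  clear Hf.
  match type of H11 with _ = ?e => set (m11 := e) in * end.
  match type of H12 with _ = ?e => set (m12 := e) in * end.
  match type of H13 with _ = ?e => set (m13 := e) in * end.
  match type of H22 with _ = ?e => set (m22 := e) in * end.
  match type of H23 with _ = ?e => set (m23 := e) in * end.
  match type of H33 with _ = ?e => set (m33 := e) in * end.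
  assert (G : m11 * (m22 * m33 - m23 * m23) - m12 * (m12 * m33 - m23 * m13)
      + m13 * (m12 * m23 - m22 * m13)
    = det f0 f1 f2 ^ 2 * (eps * (- delta * eps * kappa - tau ^ 2))).
  { unfold m11, m12, m13, m22, m23, m33. coords. ring. }
  rewrite E, <- H11, <- H12, <- H13, <- H22, <- H23, <- H33 in G.
  coords_in G. lra.
Qed.

Lemma lorentz_comp_twice (J : R -> Prop) (f : R -> L3) (v : L3) :
  analytic_curve J f ->
  differentiable_twice J (fun t => lorentz v (f t))
    (fun t => lorentz v (Dcurve f t)) (fun t => lorentz v (Dcurve (Dcurve f) t)).
Proof.
  intros Hf t Ht; split; apply is_derive_lorentz_const.
  - now apply (analytic_is_dcurve J).
  - apply (analytic_is_dcurve J); [|easy]. now apply analytic_Dcurve.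
Qed.

(** The point with parameters [t], [s] in adapted coordinates, the axis [h]
    being measured from [h0].  The last inequality is [E G - F ^ 2 < 0] divided
    by a positive factor. *)
Definition normal_form (J1 J2 : R -> Prop) (alpha beta : R -> L3)
    (delta eps kappa tau : R) (f0 f1 f2 : L3) (C S A B : R -> R)
    (c h0 y0 z0 : R) : Prop :=
  forall t s, J1 t -> J2 s ->
    let u := c * (lorentz f0 (alpha t) - h0) in
    let X := ruled alpha beta t s in
    exists rho, lorentz f0 X = lorentz f0 (alpha t) /\
      lorentz f1 X = y0 + A u / c + rho * C u /\
      lorentz f2 X = z0 + B u / c + rho * S u /\
      eps * delta - kappa * (c * rho) ^ 2 + 2 * eps * tau * C u * (c * rho)
        - (tau * S u) ^ 2 < 0.

(** The determinants in the equations change by the constant factor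
    [- det f0 f1 f2] when they are computed in coordinates, so the equations
    keep their form.  The inequality comes from
    [E G - F ^ 2 = (mu h') ^ 2 (eps delta - kappa (c rho) ^ 2
       + 2 eps tau C c rho - (tau S) ^ 2)]. *)
Lemma axis_normal_form (J1 J2 : R -> Prop) (alpha beta : R -> L3)
    (delta eps kappa tau : R) (f0 f1 f2 : L3) (C S A B : R -> R) (t1 : R) :
  is_open_interval J1 -> is_open_interval J2 ->
  analytic_curve J1 alpha -> analytic_curve J1 beta ->
  transversal J1 alpha beta ->
  timelike J1 J2 (ruled alpha beta) -> minimal J1 J2 (ruled alpha beta) ->
  adapted_frame delta eps kappa tau f0 f1 f2 -> eps * eps = 1 -> tau * eps = tau ->
  unit_speed_conic kappa C S -> center_drift tau C S A B ->
  J1 t1 -> (forall t, J1 t -> lorentz f0 (beta t) = 0) ->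
  lorentz f2 (beta t1) = 0 ->
  det (Dcurve alpha t1) (beta t1) (Dcurve beta t1) <> 0 ->
  exists c y0 z0, c <> 0 /\
    normal_form J1 J2 alpha beta delta eps kappa tau f0 f1 f2 C S A B
      c (lorentz f0 (alpha t1)) y0 z0.
Proof.
  intros HJ1 HJ2 Ha Hb Htrans Htl Hmin Hf Heps Htau HCS HAB Ht1 Hh0 Hq1 HD.
  assert (Heqs := minimal_ruled_equations J1 J2 alpha beta HJ1 HJ2 Ha Hb Htl Hmin).
  cbv zeta in Heqs.
  assert (HK := adapted_frame_det _ _ _ _ _ _ _ Hf).
  assert (Hb' : forall t, J1 t -> lorentz f0 (Dcurve beta t) = 0).
  { intros t Ht.
    assert (D := is_derive_lorentz_const f0 beta t _ (analytic_is_dcurve J1 _ t Hb Ht)).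
    apply is_derive_unique in D. rewrite <- D.
    rewrite (Derive_ext_loc _ (fun _ => 0)); [apply Derive_const|].
    generalize (open_interval_locally J1 t HJ1 Ht); apply filter_imp. exact Hh0. }
  assert (Hb'' : forall t, J1 t -> lorentz f0 (Dcurve (Dcurve beta) t) = 0).
  { intros t Ht.
    assert (D := is_derive_lorentz_const f0 (Dcurve beta) t _
      (analytic_is_dcurve J1 _ t (analytic_Dcurve J1 _ Hb) Ht)).
    apply is_derive_unique in D. rewrite <- D.
    rewrite (Derive_ext_loc _ (fun _ => 0)); [apply Derive_const|].
    generalize (open_interval_locally J1 t HJ1 Ht); apply filter_imp. exact Hb'. }
  destruct (ruled_normal_form J1 kappa tau C S A B
    (fun t => lorentz f0 (alpha t)) (fun t => lorentz f0 (Dcurve alpha t))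
    (fun t => lorentz f0 (Dcurve (Dcurve alpha) t))
    (fun t => lorentz f1 (alpha t)) (fun t => lorentz f1 (Dcurve alpha t))
    (fun t => lorentz f1 (Dcurve (Dcurve alpha) t))
    (fun t => lorentz f2 (alpha t)) (fun t => lorentz f2 (Dcurve alpha t))
    (fun t => lorentz f2 (Dcurve (Dcurve alpha) t))
    (fun t => lorentz f1 (beta t)) (fun t => lorentz f1 (Dcurve beta t))
    (fun t => lorentz f1 (Dcurve (Dcurve beta) t))
    (fun t => lorentz f2 (beta t)) (fun t => lorentz f2 (Dcurve beta t))
    (fun t => lorentz f2 (Dcurve (Dcurve beta) t)) t1)
    as (c & y0 & z0 & Hc & H); auto using lorentz_comp_twice.
  - intros t Ht. destruct (Heqs t Ht) as (_ & E & _ & _).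
    apply (f_equal (fun r => eps * (- det f0 f1 f2 * r))) in E.
    specialize (Hh0 t Ht). specialize (Hb' t Ht). specialize (Hb'' t Ht).
    revert E.
    replace (eps * (- det f0 f1 f2 * (lorentz (beta t) (beta t) * _))) with
      (eps * lorentz (beta t) (beta t) *
       (- det f0 f1 f2 * det (Dcurve alpha t) (beta t) (Dcurve (Dcurve beta) t)
        + - det f0 f1 f2 * det (Dcurve beta t) (beta t) (Dcurve (Dcurve alpha) t)))
      by ring.
    replace (eps * (- det f0 f1 f2 * (2 * _ * _))) with
      (eps * (2 * (- det f0 f1 f2 * det (Dcurve alpha t) (beta t) (Dcurve beta t))
       * lorentz (Dcurve beta t) (beta t))) by ring.
    rewrite <- !det_in_frame, (Hf (beta t) (beta t)), (Hf (Dcurve beta t) (beta t)),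
      Hh0, Hb', Hb''. intros E.
    (* Only [eps * eps = 1] separates the two forms of the equation. *)
    match goal with |- ?l = ?r => transitivity (eps * eps * l);
      [rewrite Heps; ring|transitivity (eps * eps * r); [|rewrite Heps; ring]] end.
    etransitivity; [|etransitivity; [exact E|]]; ring.
  - intros t Ht. destruct (Heqs t Ht) as (E & _ & _ & _).
    apply (f_equal (fun r => eps * (- det f0 f1 f2 * r))) in E.
    specialize (Hh0 t Ht). specialize (Hb' t Ht).
    revert E.
    replace (eps * (- det f0 f1 f2 * (lorentz (beta t) (beta t) * _))) with
      (eps * lorentz (beta t) (beta t) *
       (- det f0 f1 f2 * det (Dcurve alpha t) (beta t) (Dcurve (Dcurve alpha) t)))
      by ring.
    replace (eps * (- det f0 f1 f2 * (2 * _ * _))) with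
      (eps * (2 * (- det f0 f1 f2 * det (Dcurve alpha t) (beta t) (Dcurve beta t))
       * lorentz (Dcurve alpha t) (beta t))) by ring.
    rewrite <- !det_in_frame, (Hf (beta t) (beta t)), (Hf (Dcurve alpha t) (beta t)),
      Hh0, Hb'. intros E.
    match goal with |- ?l = ?r => transitivity (eps * eps * l);
      [rewrite Heps; ring|transitivity (eps * eps * r); [|rewrite Heps; ring]] end.
    etransitivity; [|etransitivity; [exact E|]]; [ring|].
    (* [eps * tau] against [eps * eps * tau]. *)
    rewrite <- Htau at 1. ring.
  - intros t Ht [Ep Eq].
    apply (lin_indep_r_nonzero _ _ (Htrans t Ht)).
    apply (frame_zero delta eps kappa tau f0 f1 f2); auto.
  - intros t Ht [Eh EV]. specialize (Hh0 t Ht).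
    set (a' := Dcurve alpha t) in *. set (b := beta t) in *.
    assert (Hli : lin_indep a' b) by exact (Htrans t Ht).
    assert (Ep : lorentz f1 b = 0 /\ - lorentz f1 a' = 0).
    { apply Hli, (frame_zero delta eps kappa tau f0 f1 f2); auto;
        unfold lin_comb; rewrite lorentz_plus_r, !lorentz_scal_r;
        rewrite ?Eh, ?Hh0; lra. }
    assert (Eq : lorentz f2 b = 0 /\ - lorentz f2 a' = 0).
    { apply Hli, (frame_zero delta eps kappa tau f0 f1 f2); auto;
        unfold lin_comb; rewrite lorentz_plus_r, !lorentz_scal_r;
        rewrite ?Eh, ?Hh0; lra. }
    apply (lin_indep_r_nonzero _ _ Hli).
    apply (frame_zero delta eps kappa tau f0 f1 f2); tauto.
  - intros E. apply HD.
    apply Rmult_eq_reg_l with (- det f0 f1 f2); [|lra].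
    rewrite <- det_in_frame, Hh0, Hb' by easy.
    transitivity 0; [etransitivity; [|exact E]; ring|ring].
  - exists c, y0, z0. split; [easy|]. intros t s Ht Js u X.
    destruct (H t Ht) as (mu & lambda & Hmu & Hh & Ep & Eq & Ey & Ez & EW & EV).
    fold u in Ep, Eq, Ey, Ez.
    exists (lambda + s * mu).
    unfold X, ruled. rewrite !lorentz_plus_r, !lorentz_scal_r, Hh0 by easy.
    rewrite Ep, Eq, Ey, Ez.
    split; [ring|]. split; [ring|]. split; [ring|].
    destruct (Heqs t Ht) as (_ & _ & _ & Hs). specialize (Hs s Js).
    apply signature11_gram_neg in Hs.
    rewrite (Hf (beta t) (beta t)), (Hf (plus _ _) (beta t)),
      (Hf (plus _ _) (plus _ _)) in Hs.
    rewrite !lorentz_plus_r, !lorentz_scal_r, Hh0, Hb' in Hs by easy.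
    destruct HCS as [_ HCS]. destruct (HCS u) as (H1 & _).
    set (h' := lorentz f0 (Dcurve alpha t)) in *.
    set (y' := lorentz f1 (Dcurve alpha t)) in *.
    set (z' := lorentz f2 (Dcurve alpha t)) in *.
    set (p' := lorentz f1 (Dcurve beta t)) in *.
    set (q' := lorentz f2 (Dcurve beta t)) in *.
    rewrite Ep, Eq in Hs, EW, EV.
    set (Y := y' + s * p') in *. set (Z := z' + s * q') in *.
    assert (EK : C u * Z - S u * Y = c * h' * (lambda + s * mu)).
    { apply Rmult_eq_reg_l with mu; [|easy].
      transitivity (mu * C u * z' - mu * S u * y'
        + s * (mu * C u * q' - mu * S u * p')); [unfold Y, Z; ring|].
      rewrite EW, EV; ring. }
    match type of Hs with ?e < 0 => assert (E : e =
      mu ^ 2 * (eps * delta * h' ^ 2 * (C u ^ 2 - kappa * S u ^ 2)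
        - eps * eps * kappa * (C u * Z - S u * Y) ^ 2
        + 2 * eps * tau * h' * C u * (C u * Z - S u * Y)
        - (tau * h' * S u) ^ 2)) by ring end.
    rewrite E, H1, Heps, EK in Hs.
    match goal with |- ?e < 0 => destruct (Rlt_le_dec e 0) as [|Hn]; [easy|];
      exfalso; assert (0 <= (mu * h') ^ 2 * e) end.
    { apply Rmult_le_pos; [apply pow2_ge_0|exact Hn]. }
    match type of Hs with ?e < 0 => apply (Rlt_not_le _ _ Hs) end.
    eapply Rle_trans; [exact H0|apply Req_le; ring].
Qed.

(** Both sides of Lagrange's identity for [cross a u] give its product with
    [v] times its product with [w]. *)
Lemma orthonormal_frame (delta eps : R) (a u : L3) :
  delta = 1 \/ delta = -1 -> eps = 1 \/ eps = -1 ->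
  lorentz a a = delta -> lorentz u u = eps -> lorentz a u = 0 ->
  adapted_frame delta eps delta 0
    (scal delta a) (scal eps u) (scal (- (delta * eps)) (cross a u)).
Proof.
  intros Hd He Haa Huu Hau v w. rewrite !lorentz_scal_l.
  assert (E : lorentz (cross a u) v * lorentz (cross a u) w = - (
    lorentz a a * (lorentz u u * lorentz v w - lorentz u w * lorentz u v)
    - lorentz a u * (lorentz a u * lorentz v w - lorentz u w * lorentz a v)
    + lorentz a w * (lorentz a u * lorentz u v - lorentz u u * lorentz a v)))
    by (coords; ring).
  rewrite Haa, Huu, Hau in E.
  set (x := lorentz (cross a u) v) in *. set (y := lorentz (cross a u) w) in *.
  destruct Hd as [-> | ->], He as [-> | ->]; lra.
Qed.

Lemma null_frame_expansion (m n e : L3) :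
  lorentz m m = 0 -> lorentz n n = 0 -> lorentz m n = 1 ->
  lorentz e e = 1 -> lorentz m e = 0 -> lorentz n e = 0 ->
  forall v, v = plus (plus (scal (lorentz m v) n) (scal (lorentz e v) e))
                     (scal (lorentz n v) m).
Proof.
  intros Hmm Hnn Hmn Hee Hme Hne v.
  assert (Hd : det m n e <> 0).
  { intros E. assert (G := gram_det m n e).
    rewrite E, Hmm, Hnn, Hmn, Hee, Hme, Hne in G. lra. }
  set (w := plus _ _).
  assert (E : plus v (scal (-1) w) = zero).
  { apply (orthogonal_to_three m n e _ Hd); unfold w;
      repeat rewrite ?lorentz_plus_l, ?lorentz_scal_l;
      rewrite ?(lorentz_sym n m), ?(lorentz_sym e m), ?(lorentz_sym e n),
        ?Hmm, ?Hnn, ?Hmn, ?Hee, ?Hme, ?Hne, ?(lorentz_sym v); ring. }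
  assert (E1 := f_equal x1 E). assert (E2 := f_equal x2 E).
  assert (E3 := f_equal x3 E). autorewrite with coordinates in E1, E2, E3.
  apply L3_ext; lra.
Qed.

Lemma null_frame (m n e : L3) :
  lorentz m m = 0 -> lorentz n n = 0 -> lorentz m n = 1 ->
  lorentz e e = 1 -> lorentz m e = 0 -> lorentz n e = 0 ->
  adapted_frame 0 1 0 1 m e n.
Proof.
  intros Hmm Hnn Hmn Hee Hme Hne v w.
  rewrite (null_frame_expansion m n e Hmm Hnn Hmn Hee Hme Hne v) at 1.
  repeat rewrite ?lorentz_plus_l, ?lorentz_scal_l. ring.
Qed.

(** Add to [y] the multiple of [m] that makes it null. *)
Lemma null_partner (m y : L3) : lorentz m m = 0 -> lorentz m y <> 0 ->
  exists n, lorentz n n = 0 /\ lorentz m n = 1 /\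
    forall e, lorentz m e = 0 -> lorentz y e = 0 -> lorentz n e = 0.
Proof.
  intros Hm Hy.
  exists (plus (scal (/ lorentz m y) y)
    (scal (- lorentz y y / (2 * lorentz m y ^ 2)) m)).
  repeat rewrite ?lorentz_plus_l, ?lorentz_plus_r, ?lorentz_scal_l, ?lorentz_scal_r.
  rewrite (lorentz_sym y m), Hm. split; [field; easy|]. split; [field; easy|].
  intros e Hme Hye.
  rewrite lorentz_plus_l, !lorentz_scal_l, Hme, Hye; ring.
Qed.

(** * Isometries and points of the model surfaces *)

Lemma is_linear_lorentz (r : L3) :
  is_linear (fun v : L3 => lorentz r v : R_NormedModule).
Proof.
  assert (Hs : forall (a : R) (l : L3 -> R_NormedModule),
    is_linear l -> is_linear (fun v => scal a (l v) : R_NormedModule)).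
  { intros a l Hl. apply (is_linear_comp l (fun x => scal a x)); [easy|].
    apply (is_linear_scal_r (V := R_NormedModule)). exact Rmult_comm. }
  assert (Hp : forall l1 l2 : L3 -> R_NormedModule, is_linear l1 -> is_linear l2 ->
    is_linear (fun v => plus (l1 v) (l2 v) : R_NormedModule)).
  { intros l1 l2 H1 H2.
    apply (is_linear_comp (fun v => (l1 v, l2 v)) (fun x => plus (fst x) (snd x))).
    - now apply is_linear_prod.
    - apply is_linear_plus. }
  apply (is_linear_ext (fun v => plus (plus (scal (- x1 r) (x1 v : R_NormedModule))
    (scal (x2 r) (x2 v : R_NormedModule))) (scal (x3 r) (x3 v : R_NormedModule)))).
  { intros v; unfold lorentz, plus, scal; simpl; unfold mult; simpl; ring. }
  apply Hp; [apply Hp|]; apply Hs.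
  - apply (is_linear_comp (fun v : L3 => fst v) (fun v => fst v));
      apply is_linear_fst.
  - apply (is_linear_comp (fun v : L3 => fst v) (fun v => snd v));
      [apply is_linear_fst|apply is_linear_snd].
  - apply is_linear_snd.
Qed.

Lemma isometry_of_rows (r0 r1 r2 p : L3) :
  (forall v w, lorentz v w = - (lorentz r0 v * lorentz r0 w)
     + lorentz r1 v * lorentz r1 w + lorentz r2 v * lorentz r2 w) ->
  isometry (fun v => plus (lorentz r0 v, lorentz r1 v, lorentz r2 v) p).
Proof.
  intros H. exists (fun v => (lorentz r0 v, lorentz r1 v, lorentz r2 v)), p.
  split; [|split; [|easy]].
  - apply (is_linear_prod
      (fun v => (lorentz r0 v, lorentz r1 v) : prod_NormedModule _ R_NormedModule R_NormedModule)
      (fun v => lorentz r2 v : R_NormedModule)).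
    + apply (is_linear_prod (fun v => lorentz r0 v : R_NormedModule)
        (fun v => lorentz r1 v : R_NormedModule)); apply is_linear_lorentz.
    + apply is_linear_lorentz.
  - intros v w. rewrite (H v w).
    unfold lorentz at 1; autorewrite with coordinates; ring.
Qed.

Lemma is_derive_cosh (t : R) : is_derive cosh t (sinh t).
Proof. apply is_derive_Reals, derivable_pt_lim_cosh. Qed.

Lemma is_derive_sinh (t : R) : is_derive sinh t (cosh t).
Proof. apply is_derive_Reals, derivable_pt_lim_sinh. Qed.

Lemma cosh_sinh_1 (t : R) : cosh t ^ 2 - sinh t ^ 2 = 1.
Proof.
  unfold cosh, sinh. assert (H : exp t * exp (- t) = 1).
  { rewrite <- exp_plus, Rplus_opp_r; apply exp_0. }
  transitivity (exp t * exp (- t)); [field|exact H].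
Qed.

Lemma cosh_pos (t : R) : 0 < cosh t.
Proof.
  unfold cosh. assert (H := exp_pos t). assert (H' := exp_pos (- t)). lra.
Qed.

Lemma sin_cos_1 (t : R) : cos t ^ 2 + sin t ^ 2 = 1.
Proof. assert (H := sin2_cos2 t). unfold Rsqr in H. simpl; lra. Qed.

Lemma timelike_at_of_derivatives (X : R -> R -> L3) (u v : R) (Xu Xv : L3) :
  is_dcurve (fun r => X r v) u Xu -> is_dcurve (fun r => X u r) v Xv ->
  signature11 Xu Xv -> timelike_at X u v.
Proof.
  intros Hu Hv Hs. unfold timelike_at, Du, Dv.
  now rewrite (Dcurve_eq _ _ _ Hu), (Dcurve_eq _ _ _ Hv).
Qed.

Lemma helicoid1_point (c u r : R) : c <> 0 -> r ^ 2 < 1 ->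
  helicoid1 c (scal (1 / c) (u, r * cos u, r * sin u)).
Proof.
  intros Hc Hr.
  assert (Hr' : -1 <= r <= 1) by (split; nra).
  destruct (ex_intro (fun v => sin v = r) (asin r) (sin_asin r Hr')) as (v & <-).
  exists u, v. split; [easy|]. split; [|easy].
  assert (Hc2 := sin_cos_1 v). assert (Hu := sin_cos_1 u).
  assert (Dcu := is_derive_cos u : is_derive cos u (- sin u)).
  assert (Dsu := is_derive_sin u : is_derive sin u (cos u)).
  assert (Dsv := is_derive_sin v : is_derive sin v (cos v)).
  apply (timelike_at_of_derivatives _ u v (scal (1 / c) (1, - (sin v * sin u), sin v * cos u))
    (scal (1 / c) (0, cos v * cos u, cos v * sin u))).
  - apply (is_dcurve_scal_const (1 / c) (fun r => (r, sin v * cos r, sin v * sin r))).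
    apply is_dcurve_mk; autorewrite with coordinates; (evar_last; [derive|ring]).
  - apply (is_dcurve_scal_const (1 / c) (fun r => (u, sin r * cos u, sin r * sin u))).
    apply is_dcurve_mk; autorewrite with coordinates; (evar_last; [derive|ring]).
  - apply signature11_scal.
    { unfold Rdiv; rewrite Rmult_1_l; now apply Rinv_neq_0_compat. }
    apply signature11_orthogonal; coords.
    + ring.
    + replace (_ + _) with (-1 + sin v ^ 2 * (cos u ^ 2 + sin u ^ 2)) by ring.
      rewrite Hu. lra.
    + replace (_ + _) with (cos v ^ 2 * (cos u ^ 2 + sin u ^ 2)) by ring.
      rewrite Hu, Rmult_1_r. lra.
Qed.

Lemma exists_cosh (r : R) : 1 < r -> exists v, cosh v = r /\ 0 < sinh v ^ 2.
Proof.
  intros Hr. exists (arcsinh (sqrt (r ^ 2 - 1))).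
  set (v := arcsinh _). assert (Hs : sinh v = sqrt (r ^ 2 - 1)) by apply sinh_arcsinh.
  assert (H1 := cosh_sinh_1 v). assert (Hp := cosh_pos v).
  assert (H2 : sinh v ^ 2 = r ^ 2 - 1).
  { rewrite Hs. apply pow2_sqrt. nra. }
  split; nra.
Qed.

Lemma helicoid2_point (c u r : R) : c <> 0 -> 1 < r ->
  helicoid2 c (scal (1 / c) (r * sinh u, r * cosh u, u)).
Proof.
  intros Hc Hr. destruct (exists_cosh r Hr) as (v & <- & Hv).
  exists u, v. split; [easy|]. split; [|easy].
  assert (Hu := cosh_sinh_1 u). assert (Hv' := cosh_sinh_1 v).
  assert (Dcu := is_derive_cosh u). assert (Dsu := is_derive_sinh u).
  assert (Dcv := is_derive_cosh v).
  apply (timelike_at_of_derivatives _ u v (scal (1 / c) (cosh v * cosh u, cosh v * sinh u, 1))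
    (scal (1 / c) (sinh v * sinh u, sinh v * cosh u, 0))).
  - apply (is_dcurve_scal_const (1 / c) (fun r => (cosh v * sinh r, cosh v * cosh r, r))).
    apply is_dcurve_mk; autorewrite with coordinates; (evar_last; [derive|ring]).
  - apply (is_dcurve_scal_const (1 / c) (fun r => (cosh r * sinh u, cosh r * cosh u, u))).
    apply is_dcurve_mk; autorewrite with coordinates; (evar_last; [derive|ring]).
  - apply signature11_scal.
    { unfold Rdiv; rewrite Rmult_1_l; now apply Rinv_neq_0_compat. }
    apply signature11_orthogonal; coords.
    + ring.
    + replace (_ + _) with (1 - cosh v ^ 2 * (cosh u ^ 2 - sinh u ^ 2)) by ring.
      rewrite Hu. lra.
    + replace (_ + _) with (sinh v ^ 2 * (cosh u ^ 2 - sinh u ^ 2)) by ring.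
      rewrite Hu. lra.
Qed.

Lemma helicoid3_point (c v r : R) : c <> 0 ->
  helicoid3 c (scal (1 / c) (r * cosh v, v, r * sinh v)).
Proof.
  intros Hc. rewrite <- (sinh_arcsinh r). set (u := arcsinh r).
  exists u, v. split; [easy|]. split; [|easy].
  assert (Hu := cosh_sinh_1 u). assert (Hv := cosh_sinh_1 v).
  assert (Dcv := is_derive_cosh v). assert (Dsv := is_derive_sinh v).
  assert (Dsu := is_derive_sinh u).
  apply (timelike_at_of_derivatives _ u v (scal (1 / c) (cosh u * cosh v, 0, cosh u * sinh v))
    (scal (1 / c) (sinh u * sinh v, 1, sinh u * cosh v))).
  - apply (is_dcurve_scal_const (1 / c) (fun r => (sinh r * cosh v, v, sinh r * sinh v))).
    apply is_dcurve_mk; autorewrite with coordinates; (evar_last; [derive|ring]).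
  - apply (is_dcurve_scal_const (1 / c) (fun r => (sinh u * cosh r, r, sinh u * sinh r))).
    apply is_dcurve_mk; autorewrite with coordinates; (evar_last; [derive|ring]).
  - apply signature11_scal.
    { unfold Rdiv; rewrite Rmult_1_l; now apply Rinv_neq_0_compat. }
    assert (0 <= sinh u ^ 2) by apply pow2_ge_0.
    apply signature11_orthogonal; coords.
    + ring.
    + replace (_ + _) with (- (cosh u ^ 2 * (cosh v ^ 2 - sinh v ^ 2))) by ring.
      rewrite Hv. lra.
    + replace (_ + _) with (1 + sinh u ^ 2 * (cosh v ^ 2 - sinh v ^ 2)) by ring.
      rewrite Hv. lra.
Qed.

Lemma conjugate_enneper2_point (c u w : R) : c <> 0 -> 0 < w ->
  conjugate_enneper2 c (scal (- (1 / (6 * c)))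
    (3 * u + 3 * u * w + u ^ 3, 3 * w + 3 * u ^ 2 - 3, 3 * u - 3 * u * w - u ^ 3)).
Proof.
  intros Hc Hw. assert (Hv := sqrt_lt_R0 w Hw).
  rewrite <- (pow2_sqrt w (Rlt_le _ _ Hw)). set (v := sqrt w) in *.
  exists u, v. split; [easy|]. split; [|easy].
  apply (timelike_at_of_derivatives _ u v
    (scal (- (1 / (6 * c))) (3 + 3 * v ^ 2 + 3 * u ^ 2, 6 * u, 3 - 3 * v ^ 2 - 3 * u ^ 2))
    (scal (- (1 / (6 * c))) (6 * u * v, 6 * v, - (6 * u * v)))).
  - apply (is_dcurve_scal_const _ (fun u => (3 * u + 3 * u * v ^ 2 + u ^ 3,
      3 * v ^ 2 + 3 * u ^ 2 - 3, 3 * u - 3 * u * v ^ 2 - u ^ 3))).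
    apply is_dcurve_mk; autorewrite with coordinates; auto_derive; auto; ring.
  - apply (is_dcurve_scal_const _ (fun v => (3 * u + 3 * u * v ^ 2 + u ^ 3,
      3 * v ^ 2 + 3 * u ^ 2 - 3, 3 * u - 3 * u * v ^ 2 - u ^ 3))).
    apply is_dcurve_mk; autorewrite with coordinates; auto_derive; auto; ring.
  - apply signature11_scal.
    { apply Ropp_neq_0_compat. unfold Rdiv; rewrite Rmult_1_l.
      apply Rinv_neq_0_compat. lra. }
    assert (0 < v ^ 2) by (apply pow_lt; lra).
    apply signature11_orthogonal; coords.
    + ring.
    + replace (_ + _) with (- (36 * v ^ 2)) by ring. lra.
    + replace (_ + _) with (36 * v ^ 2) by ring. lra.
Qed.

(** * Skew ruled surfaces: helicoids and the conjugate of Enneper's surface *)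

Lemma trigonometric_conic : unit_speed_conic (-1) cos sin.
Proof.
  split; [apply sin_0|]. intros u. assert (H := sin_cos_1 u).
  split; [lra|]. split; [|exact (is_derive_sin u)].
  evar_last; [exact (is_derive_cos u)|]. simpl; ring.
Qed.

Lemma hyperbolic_conic : unit_speed_conic 1 cosh sinh.
Proof.
  split; [apply sinh_0|]. intros u. assert (H := cosh_sinh_1 u).
  split; [lra|]. split; [|exact (is_derive_sinh u)].
  evar_last; [exact (is_derive_cosh u)|]. simpl; ring.
Qed.

Lemma parabolic_conic : unit_speed_conic 0 (fun _ => 1) (fun u => u).
Proof.
  split; [easy|]. intros u. split; [ring|]. split; [|apply D_id].
  evar_last; [apply D_const|ring].
Qed.

Lemma no_drift (C S : R -> R) : center_drift 0 C S (fun _ => 0) (fun _ => 0).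
Proof. intros u; split; (evar_last; [apply D_const|ring]). Qed.

Lemma parabolic_drift : center_drift 1 (fun _ => 1) (fun u => u)
  (fun u => - u ^ 2) (fun u => - (2 / 3) * u ^ 3).
Proof.
  intros u; split; auto_derive; auto; field.
Qed.

Lemma congruent_helicoid1 (J1 J2 : R -> Prop) (alpha beta : R -> L3)
    (f0 f1 f2 : L3) (c h0 y0 z0 : R) : c <> 0 ->
  adapted_frame (-1) 1 (-1) 0 f0 f1 f2 ->
  normal_form J1 J2 alpha beta (-1) 1 (-1) 0 f0 f1 f2 cos sin
    (fun _ => 0) (fun _ => 0) c h0 y0 z0 ->
  congruent_to_part (image J1 J2 (ruled alpha beta)) (helicoid1 c).
Proof.
  intros Hc Hf H.
  exists (fun v => plus (lorentz f0 v, lorentz f1 v, lorentz f2 v)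
                     (- h0, - y0, - z0)).
  split.
  - apply isometry_of_rows. intros v w. rewrite (Hf v w); ring.
  - intros p (t & s & Ht & Hs & ->).
    destruct (H t s Ht Hs) as (rho & E0 & E1 & E2 & Hlt).
    rewrite E0, E1, E2. set (u := c * _) in *.
    replace (plus _ _) with (scal (1 / c) (u, (c * rho) * cos u, (c * rho) * sin u)).
    + apply helicoid1_point; [easy|lra].
    + apply L3_ext; autorewrite with coordinates; unfold u; field; easy.
Qed.

Lemma congruent_helicoid3 (J1 J2 : R -> Prop) (alpha beta : R -> L3)
    (f0 f1 f2 : L3) (c h0 y0 z0 : R) : c <> 0 ->
  adapted_frame 1 (-1) 1 0 f0 f1 f2 ->
  normal_form J1 J2 alpha beta 1 (-1) 1 0 f0 f1 f2 cosh sinh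
    (fun _ => 0) (fun _ => 0) c h0 y0 z0 ->
  congruent_to_part (image J1 J2 (ruled alpha beta)) (helicoid3 c).
Proof.
  intros Hc Hf H.
  exists (fun v => plus (lorentz f1 v, lorentz f0 v, lorentz f2 v)
                     (- y0, - h0, - z0)).
  split.
  - apply isometry_of_rows. intros v w. rewrite (Hf v w); ring.
  - intros p (t & s & Ht & Hs & ->).
    destruct (H t s Ht Hs) as (rho & E0 & E1 & E2 & Hlt).
    rewrite E0, E1, E2. set (u := c * _) in *.
    replace (plus _ _) with (scal (1 / c) ((c * rho) * cosh u, u, (c * rho) * sinh u)).
    + now apply helicoid3_point.
    + apply L3_ext; autorewrite with coordinates; unfold u; field; easy.
Qed.

(** The axis [m] of the null frame goes to [(1, 0, -1)], its partner [n] to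
    [(-1/2, 0, -1/2)]; the parameter [v ^ 2] of the model is affine in [rho]. *)
Lemma congruent_conjugate_enneper2 (J1 J2 : R -> Prop) (alpha beta : R -> L3)
    (f0 f1 f2 : L3) (c h0 y0 z0 : R) : c <> 0 ->
  adapted_frame 0 1 0 1 f0 f1 f2 ->
  normal_form J1 J2 alpha beta 0 1 0 1 f0 f1 f2 (fun _ => 1) (fun u => u)
    (fun u => - u ^ 2) (fun u => - (2 / 3) * u ^ 3) c h0 y0 z0 ->
  congruent_to_part (image J1 J2 (ruled alpha beta)) (conjugate_enneper2 c).
Proof.
  intros Hc Hf H.
  exists (fun v => plus (lorentz (plus f2 (scal (-1 / 2) f0)) v, lorentz f1 v,
                         lorentz (plus (scal (-1) f2) (scal (-1 / 2) f0)) v)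
                     (- z0 + h0 / 2, - y0 + 1 / (2 * c), z0 + h0 / 2)).
  split.
  - apply isometry_of_rows. intros v w.
    rewrite (Hf v w), !lorentz_plus_l, !lorentz_scal_l. field.
  - intros p (t & s & Ht & Hs & ->).
    destruct (H t s Ht Hs) as (rho & E0 & E1 & E2 & Hlt).
    rewrite !lorentz_plus_l, !lorentz_scal_l, E0, E1, E2. set (u := c * _) in *.
    replace (lorentz f0 (alpha t)) with (u / c + h0) by (unfold u; field; easy).
    set (w := u ^ 2 - 2 * (c * rho)).
    replace (plus _ _) with (scal (- (1 / (6 * c)))
      (3 * u + 3 * u * w + u ^ 3, 3 * w + 3 * u ^ 2 - 3, 3 * u - 3 * u * w - u ^ 3)).
    + apply conjugate_enneper2_point; [easy|unfold w; lra].
    + unfold w; apply L3_ext; autorewrite with coordinates; field; easy.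
Qed.

(** The timelike part of the full ruled helicoid has the two sheets [rho > 1 / c]
    and [rho < - 1 / c] (for positive [c]), while the model is one of them.  A
    connected surface lies in one sheet, and the half turn about the axis,
    [k = -1], exchanges them. *)
Lemma congruent_helicoid2 (J1 J2 : R -> Prop) (alpha beta : R -> L3)
    (f0 f1 f2 : L3) (c h0 y0 z0 : R) : c <> 0 ->
  is_open_interval J1 -> is_open_interval J2 ->
  analytic_curve J1 alpha -> analytic_curve J1 beta ->
  adapted_frame 1 1 1 0 f0 f1 f2 ->
  normal_form J1 J2 alpha beta 1 1 1 0 f0 f1 f2 cosh sinh
    (fun _ => 0) (fun _ => 0) c h0 y0 z0 ->
  congruent_to_part (image J1 J2 (ruled alpha beta)) (helicoid2 c).
Proof.
  intros Hc HJ1 HJ2 Ha Hb Hf H.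
  set (Y := fun t s => c * (lorentz f1 (ruled alpha beta t s) - y0)).
  assert (HY : forall t s, J1 t -> J2 s -> Y t s <> 0).
  { intros t s Ht Hs. destruct (H t s Ht Hs) as (rho & _ & E1 & _ & Hlt).
    unfold Y. rewrite E1. set (u := c * _) in *. assert (Hp := cosh_pos u).
    replace (c * _) with (c * rho * cosh u) by (field; easy).
    apply Rmult_integral_contrapositive_currified; [|lra].
    intros E; rewrite E in Hlt; lra. }
  assert (Hsign : forall k, k <> 0 -> forall t s t' s', J1 t -> J2 s -> J1 t' ->
            J2 s' -> 0 < k * Y t s -> 0 < k * Y t' s').
  { intros k Hk t s t' s' Ht Hs Ht' Hs' Hpos.
    apply (continuous_nonzero_same_sign J2 (fun s => k * Y t' s) s s' HJ2);
      [| |exact Hs|exact Hs'|].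
    - intros r Hr.
      assert (D := is_derive_lorentz_const f1 _ r _
        (is_dcurve_affine (alpha t') (beta t') r)).
      eapply is_derive_continuous. unfold Y, ruled. derive.
    - intros r Hr. apply Rmult_integral_contrapositive_currified; auto.
    - apply (continuous_nonzero_same_sign J1 (fun t => k * Y t s) t t' HJ1);
        [| |exact Ht|exact Ht'|exact Hpos].
      + intros r Hr.
        assert (D := is_derive_lorentz_const f1 _ r _ (is_dcurve_ruled alpha beta r s _ _
          (analytic_is_dcurve J1 alpha r Ha Hr) (analytic_is_dcurve J1 beta r Hb Hr))).
        eapply is_derive_continuous. unfold Y. derive.
      + intros r Hr. apply Rmult_integral_contrapositive_currified; auto. }
  destruct (open_interval_inhabited J1 HJ1) as [t0 Ht0].
  destruct (open_interval_inhabited J2 HJ2) as [s0 Hs0].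
  assert (Hk : exists k, k * k = 1 /\ 0 < k * Y t0 s0).
  { assert (Hn := HY t0 s0 Ht0 Hs0).
    destruct (Rlt_dec 0 (Y t0 s0)); [exists 1|exists (-1)]; lra. }
  destruct Hk as (k & Hk & Hpos).
  assert (Hk0 : k <> 0) by (intros E; rewrite E in Hk; lra).
  exists (fun v => plus (lorentz (scal k f2) v, lorentz (scal k f1) v, lorentz f0 v)
                     (- (k * z0), - (k * y0), - h0)).
  split.
  - apply isometry_of_rows. intros v w. rewrite (Hf v w), !lorentz_scal_l.
    transitivity (lorentz f0 v * lorentz f0 w + (k * k) *
      (lorentz f1 v * lorentz f1 w - lorentz f2 v * lorentz f2 w)); [|ring].
    rewrite Hk; ring.
  - intros p (t & s & Ht & Hs & ->).
    assert (Hts := Hsign k Hk0 t0 s0 t s Ht0 Hs0 Ht Hs Hpos). unfold Y in Hts.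
    destruct (H t s Ht Hs) as (rho & E0 & E1 & E2 & Hlt).
    rewrite E1 in Hts. rewrite !lorentz_scal_l, E0, E1, E2.
    set (u := c * (lorentz f0 (alpha t) - h0)) in *. assert (Hp := cosh_pos u).
    set (r := k * (c * rho)).
    assert (Hr : 1 < r).
    { assert (0 < r * cosh u).
      { eapply Rlt_le_trans; [exact Hts|]. apply Req_le. unfold r. field; easy. }
      assert (r ^ 2 = (c * rho) ^ 2).
      { unfold r. transitivity ((k * k) * (c * rho) ^ 2); [ring|].
        rewrite Hk; ring. }
      assert (0 < r) by nra. nra. }
    replace (plus _ _) with (scal (1 / c) (r * sinh u, r * cosh u, u)).
    + now apply helicoid2_point.
    + unfold r, u; apply L3_ext; autorewrite with coordinates; field; easy.
Qed.

(** Near [t1] the vector [b x b'] is not zero, and it has constant direction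
    since [(b x b') x (b x b'') = det (b', b, b'') b].  So the ruling stays
    orthogonal to its value at [t1], near [t1] and then everywhere by the
    identity theorem. *)
Lemma rulings_parallel_to_plane (J : R -> Prop) (beta : R -> L3) (t1 : R) :
  is_open_interval J -> analytic_curve J beta -> J t1 ->
  (forall t, J t -> det (Dcurve beta t) (beta t) (Dcurve (Dcurve beta) t) = 0) ->
  cross (beta t1) (Dcurve beta t1) <> zero ->
  forall t, J t -> lorentz (cross (beta t1) (Dcurve beta t1)) (beta t) = 0.
Proof.
  intros HJ Hb Ht1 Hdet Hm.
  set (m := fun t => cross (beta t) (Dcurve beta t)).
  assert (Hb' := analytic_Dcurve J _ Hb).
  assert (Am : analytic_curve J m) by now apply analytic_cross.
  assert (Am2 : analytic_on J (fun t => x1 (m t) ^ 2 + x2 (m t) ^ 2 + x3 (m t) ^ 2)).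
  { destruct Am as (A1 & A2 & A3).
    apply (analytic_ext J (fun t => x1 (m t) * x1 (m t) + x2 (m t) * x2 (m t)
      + x3 (m t) * x3 (m t))); [intros; ring|].
    apply (analytic_plus J (fun t => x1 (m t) * x1 (m t) + x2 (m t) * x2 (m t))).
    2: now apply analytic_mult.
    apply (analytic_plus J (fun t => x1 (m t) * x1 (m t))); now apply analytic_mult. }
  assert (Hm2 : x1 (m t1) ^ 2 + x2 (m t1) ^ 2 + x3 (m t1) ^ 2 <> 0).
  { intros E. apply Hm. fold (m t1).
    assert (H1 := pow2_ge_0 (x1 (m t1))). assert (H2 := pow2_ge_0 (x2 (m t1))).
    assert (H3 := pow2_ge_0 (x3 (m t1))). vec_ext; nra. }
  destruct (proj1 (locally_R _ _) (filter_and _ _ (open_interval_locally J t1 HJ Ht1)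
    (locally_nonzero _ t1 (analytic_continuous J _ t1 Am2 Ht1) Hm2)))
    as (e & He & Hloc).
  set (K := fun t => Rabs (t - t1) < e).
  assert (HK : is_open_interval K).
  { exists (t1 - e), (t1 + e). split; [simpl; lra|]. intros t; unfold K; simpl.
    split; [intros H; apply Rabs_def2 in H; lra|intros H; apply Rabs_def1; lra]. }
  assert (HK1 : K t1) by (unfold K; rewrite Rminus_diag, Rabs_R0; exact He).
  apply (analytic_identity J (fun t => lorentz (m t1) (beta t)) t1 HJ); auto.
  { apply (analytic_lorentz J (fun _ => m t1)); auto using analytic_constant_curve. }
  apply locally_R; exists e; split; [easy|]. intros t Ht.
  destruct (constant_direction K m
    (fun t => plus (cross (Dcurve beta t) (Dcurve beta t))
                   (cross (beta t) (Dcurve (Dcurve beta) t))) t1 HK HK1)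
    with (t := t) as (k & Hk & E); auto.
  - intros r Hr. apply is_dcurve_cross.
    + apply (analytic_is_dcurve J); auto. apply (proj1 (Hloc r Hr)).
    + apply (analytic_is_dcurve J); auto. apply (proj1 (Hloc r Hr)).
  - intros r Hr. assert (E := Hdet r (proj1 (Hloc r Hr))). unfold m.
    transitivity (scal (det (Dcurve beta r) (beta r) (Dcurve (Dcurve beta) r))
      (beta r)); [vec_ext; ring|rewrite E; vec_ext; ring].
  - intros r Hr E. apply (proj2 (Hloc r Hr)). rewrite E; coords; ring.
  - apply Rmult_eq_reg_l with k; [|easy].
    rewrite <- lorentz_scal_l, <- E. unfold m. coords; ring.
Qed.

(** The adapted frame consists of the axis [m = b x b'], the ruling at [t1] and
    a third vector; a null axis needs a null partner instead, for which the
    velocity of the base curve is available because [D <> 0].  A nonzero vector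
    orthogonal to a timelike one is spacelike, so four cases remain. *)
Lemma skew_ruled_surface (J1 J2 : R -> Prop) (alpha beta : R -> L3) (t1 : R) :
  is_open_interval J1 -> is_open_interval J2 ->
  analytic_curve J1 alpha -> analytic_curve J1 beta ->
  transversal J1 alpha beta ->
  timelike J1 J2 (ruled alpha beta) -> minimal J1 J2 (ruled alpha beta) ->
  J1 t1 -> lorentz (beta t1) (beta t1) <> 0 ->
  det (Dcurve alpha t1) (beta t1) (Dcurve beta t1) <> 0 ->
  let M := image J1 J2 (ruled alpha beta) in
  (exists c : R, c <> 0 /\ congruent_to_part M (helicoid1 c)) \/
  (exists c : R, c <> 0 /\ congruent_to_part M (helicoid2 c)) \/
  (exists c : R, c <> 0 /\ congruent_to_part M (helicoid3 c)) \/
  (exists c : R, c <> 0 /\ congruent_to_part M (conjugate_enneper2 c)).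
Proof.
  intros HJ1 HJ2 Ha Hb Htrans Htl Hmin Ht1 HG HD M.
  assert (Heqs := minimal_ruled_equations J1 J2 alpha beta HJ1 HJ2 Ha Hb Htl Hmin).
  cbv zeta in Heqs.
  set (b := beta t1) in *. set (m := cross b (Dcurve beta t1)).
  assert (Hma : lorentz m (Dcurve alpha t1) <> 0).
  { intros E; apply HD; rewrite <- E; unfold m; coords; ring. }
  assert (Hm0 : m <> zero).
  { intros E; apply Hma; rewrite E; coords; ring. }
  assert (Hmb : lorentz m b = 0) by (unfold m; coords; ring).
  assert (Hb' := analytic_Dcurve J1 _ Hb).
  assert (Hb'' := analytic_Dcurve J1 _ Hb').
  assert (Hpar : forall t, J1 t -> lorentz m (beta t) = 0).
  { apply (rulings_parallel_to_plane J1 beta t1); auto.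
    destruct (analytic_integral J1 (fun t => lorentz (beta t) (beta t))
      (fun t => det (Dcurve beta t) (beta t) (Dcurve (Dcurve beta) t))) as [E|E]; auto.
    - now apply analytic_lorentz.
    - now apply analytic_det.
    - intros t Ht. apply (Heqs t Ht).
    - now destruct HG; apply E. }
  destruct (normalization b HG) as (kb & Hkb & Hb1 & Hb2).
  assert (Haxis : forall delta eps km : R, delta = 1 \/ delta = -1 -> eps = 1 \/ eps = -1 ->
    lorentz (scal km m) (scal km m) = delta ->
    lorentz (scal kb b) (scal kb b) = eps -> forall C S,
    unit_speed_conic delta C S ->
    exists f0 f1 f2 c h0 y0 z0, adapted_frame delta eps delta 0 f0 f1 f2 /\ c <> 0 /\
      normal_form J1 J2 alpha beta delta eps delta 0 f0 f1 f2 C S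
        (fun _ => 0) (fun _ => 0) c h0 y0 z0).
  { intros delta eps km Hd He Hmd Hbe C S HCS.
    assert (Hf := orthonormal_frame delta eps (scal km m) (scal kb b) Hd He Hmd Hbe).
    specialize (Hf ltac:(rewrite lorentz_scal_l, lorentz_scal_r, Hmb; ring)).
    destruct (axis_normal_form J1 J2 alpha beta _ _ _ _ _ _ _ C S
      (fun _ => 0) (fun _ => 0) t1 HJ1 HJ2 Ha Hb
      Htrans Htl Hmin Hf) with (2 := Rmult_0_l eps) (3 := HCS) (4 := no_drift C S)
      as (c & y0 & z0 & Hc & H); auto.
    - destruct He as [-> | ->]; ring.
    - intros t Ht. rewrite !lorentz_scal_l, Hpar by easy; ring.
    - unfold b; coords; ring.
    - do 3 eexists. exists c. do 3 eexists. split; [exact Hf|]. split; [exact Hc|].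
      exact H. }
  destruct (Req_dec (lorentz m m) 0) as [Hmm|Hmm].
  - do 3 right.
    assert (Hbpos : 0 < lorentz b b).
    { destruct (Rtotal_order (lorentz b b) 0) as [Hn|[Hn|Hn]]; [|easy|lra].
      exfalso. rewrite lorentz_sym in Hmb.
      assert (Hc := timelike_orthogonal_spacelike b m Hn Hmb Hm0). lra. }
    specialize (Hb1 Hbpos). set (e := scal kb b) in *.
    assert (Hme : lorentz m e = 0) by (unfold e; rewrite lorentz_scal_r, Hmb; ring).
    destruct (null_partner m (plus (Dcurve alpha t1)
      (scal (- lorentz (Dcurve alpha t1) e) e)) Hmm) as (n & Hnn & Hmn & Hn).
    { rewrite lorentz_plus_r, lorentz_scal_r, Hme. lra. }
    assert (Hne : lorentz n e = 0).
    { apply Hn; [easy|]. rewrite lorentz_plus_l, lorentz_scal_l, Hb1; ring. }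
    assert (Hf := null_frame m n e Hmm Hnn Hmn Hb1 Hme Hne).
    destruct (axis_normal_form J1 J2 alpha beta _ _ _ _ _ _ _ (fun _ => 1)
      (fun u => u) (fun u => - u ^ 2) (fun u => - (2 / 3) * u ^ 3) t1 HJ1 HJ2 Ha Hb
      Htrans Htl Hmin Hf) with (3 := parabolic_conic) (4 := parabolic_drift)
      as (c & y0 & z0 & Hc & H); auto; try ring.
    + apply Rmult_eq_reg_l with kb; [|easy].
      change (beta t1) with b. rewrite <- lorentz_scal_r. fold e. lra.
    + exists c. split; [easy|].
      exact (congruent_conjugate_enneper2 J1 J2 alpha beta m e n c _ y0 z0 Hc Hf H).
  - destruct (normalization m Hmm) as (km & Hkm & Hm1 & Hm2).
    destruct (Rtotal_order (lorentz m m) 0) as [Hn|[Hn|Hn]]; [|easy|].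
    + left.
      assert (Hbpos : 0 < lorentz b b).
      { apply (timelike_orthogonal_spacelike m b Hn Hmb).
        intros E; apply HG; rewrite E; coords; ring. }
      destruct (Haxis (-1) 1 km ltac:(auto) ltac:(auto) (Hm2 Hn) (Hb1 Hbpos) cos sin
        trigonometric_conic) as (f0 & f1 & f2 & c & h0 & y0 & z0 & Hf & Hc & H).
      exists c; split; [easy|]. now apply (congruent_helicoid1 J1 J2 _ _ f0 f1 f2 c h0 y0 z0).
    + right. destruct (Rtotal_order (lorentz b b) 0) as [Hbn|[Hbn|Hbn]]; [|easy|].
      * right; left.
        destruct (Haxis 1 (-1) km ltac:(auto) ltac:(auto) (Hm1 Hn) (Hb2 Hbn) cosh sinh
          hyperbolic_conic) as (f0 & f1 & f2 & c & h0 & y0 & z0 & Hf & Hc & H).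
        exists c; split; [easy|]. now apply (congruent_helicoid3 J1 J2 _ _ f0 f1 f2 c h0 y0 z0).
      * left.
        destruct (Haxis 1 1 km ltac:(auto) ltac:(auto) (Hm1 Hn) (Hb1 Hbn) cosh sinh
          hyperbolic_conic) as (f0 & f1 & f2 & c & h0 & y0 & z0 & Hf & Hc & H).
        exists c; split; [easy|]. now apply (congruent_helicoid2 J1 J2 _ _ f0 f1 f2 c h0 y0 z0).
Qed.

(** * Planes *)

Lemma isometry_id : isometry (fun v => v).
Proof.
  exists (fun v => v), zero. split; [apply is_linear_id|]. split; [easy|].
  intros v. symmetry; apply (plus_zero_r v).
Qed.

(** The normal [n = a' x b] satisfies
    [n x n' = det (a', b, a'') b - det (a', b, b') a'], so its direction is
    constant. *)
Lemma planar_ruled_surface (J1 J2 : R -> Prop) (alpha beta : R -> L3) :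
  is_open_interval J1 -> is_open_interval J2 ->
  analytic_curve J1 alpha -> analytic_curve J1 beta ->
  transversal J1 alpha beta -> timelike J1 J2 (ruled alpha beta) ->
  minimal J1 J2 (ruled alpha beta) ->
  (forall t, J1 t -> det (Dcurve alpha t) (beta t) (Dcurve beta t) = 0) ->
  (forall t, J1 t -> det (Dcurve alpha t) (beta t) (Dcurve (Dcurve alpha) t) = 0) ->
  exists P, lorentzian_plane P /\
    congruent_to_part (image J1 J2 (ruled alpha beta)) P.
Proof.
  intros HJ1 HJ2 Ha Hb Htrans Htl Hmin HD HQ.
  assert (Heqs := minimal_ruled_equations J1 J2 alpha beta HJ1 HJ2 Ha Hb Htl Hmin).
  cbv zeta in Heqs.
  destruct (open_interval_inhabited J1 HJ1) as [t1 Ht1].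
  destruct (open_interval_inhabited J2 HJ2) as [s1 Hs1].
  set (n := fun t => cross (Dcurve alpha t) (beta t)).
  assert (Hn0 : forall t, J1 t -> n t <> zero).
  { intros t Ht. apply lin_indep_cross. exact (Htrans t Ht). }
  assert (Hdir : forall t, J1 t -> exists k, k <> 0 /\ n t = scal k (n t1)).
  { apply (constant_direction J1 n (fun t => plus (cross (Dcurve (Dcurve alpha) t) (beta t))
      (cross (Dcurve alpha t) (Dcurve beta t)))); auto.
    - intros t Ht. apply is_dcurve_cross.
      + apply (analytic_is_dcurve J1); auto. now apply analytic_Dcurve.
      + now apply (analytic_is_dcurve J1).
    - intros t Ht. unfold n.
      transitivity (plus (scal (det (Dcurve alpha t) (beta t) (Dcurve (Dcurve alpha) t)) (beta t))
        (scal (- det (Dcurve alpha t) (beta t) (Dcurve beta t)) (Dcurve alpha t))).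
      + vec_ext; ring.
      + rewrite HD, HQ by easy. vec_ext; ring. }
  assert (Horth : forall t, J1 t -> lorentz (n t1) (Dcurve alpha t) = 0 /\
            lorentz (n t1) (beta t) = 0 /\ lorentz (n t1) (Dcurve beta t) = 0).
  { intros t Ht. destruct (Hdir t Ht) as (k & Hk & E).
    assert (F : forall v, lorentz (n t) v = 0 -> lorentz (n t1) v = 0).
    { intros v Hv. rewrite E, lorentz_scal_l in Hv.
      destruct (Rmult_integral _ _ Hv); easy. }
    repeat split; apply F; [unfold n; coords; ring|unfold n; coords; ring|].
    now apply HD. }
  set (v := plus (Dcurve alpha t1) (scal s1 (Dcurve beta t1))).
  assert (Hsig : signature11 v (beta t1)) by now apply (Heqs t1 Ht1).
  exists (plane (alpha t1) v (beta t1)). split.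
  { now exists (alpha t1), v, (beta t1). }
  exists (fun p => p). split; [apply isometry_id|].
  intros p (t & s & Ht & Hs & ->).
  destruct (Horth t1 Ht1) as (O1 & O2 & O3). destruct (Horth t Ht) as (_ & O5 & _).
  destruct (orthogonal_complement_in_span v (beta t1) (n t1)
    (plus (ruled alpha beta t s) (scal (-1) (alpha t1)))) as (a & b & E); auto.
  - unfold v. rewrite lorentz_plus_r, lorentz_scal_r, O1, O3; ring.
  - rewrite lorentz_sym. unfold ruled.
    rewrite !lorentz_plus_r, !lorentz_scal_r, O5.
    assert (Ec : lorentz (n t1) (alpha t) = lorentz (n t1) (alpha t1)).
    { apply (constant_of_zero_derivative J1 (fun t => lorentz (n t1) (alpha t)) HJ1);
        auto.
      intros r Hr. rewrite <- (proj1 (Horth r Hr)). apply is_derive_lorentz_const.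
      now apply (analytic_is_dcurve J1). }
    rewrite Ec; ring.
  - exists a, b. rewrite <- E. apply L3_ext; autorewrite with coordinates; ring.
Qed.

(** * Smooth functions, inverse functions and antiderivatives *)

(** A chain of [n] derivatives on [J].  Unlike iterated total derivatives it
    is stable under arithmetic by a direct induction. *)
Fixpoint differentiable_n (J : R -> Prop) (n : nat) (f : R -> R) : Prop :=
  match n with
  | O => True
  | S n => exists g, (forall t, J t -> is_derive f t (g t)) /\ differentiable_n J n g
  end.

Definition smooth (J : R -> Prop) (f : R -> R) : Prop :=
  forall n, differentiable_n J n f.

Lemma differentiable_n_S (J : R -> Prop) (n : nat) (f : R -> R) :
  differentiable_n J (S n) f -> differentiable_n J n f.
Proof.
  revert f; induction n as [|n IH]; intros f H; [exact I|].
  destruct H as (g & Hg & H). exists g; auto.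
Qed.

Lemma differentiable_n_const (J : R -> Prop) (c : R) (n : nat) :
  differentiable_n J n (fun _ => c).
Proof.
  revert c; induction n as [|n IH]; intros c; [exact I|].
  exists (fun _ => 0). split; [|apply IH]. intros t _; apply D_const.
Qed.

Lemma differentiable_n_id (J : R -> Prop) (n : nat) :
  differentiable_n J n (fun t => t).
Proof.
  destruct n as [|n]; [exact I|].
  exists (fun _ => 1). split; [|apply differentiable_n_const].
  intros t _; apply D_id.
Qed.

Lemma differentiable_n_plus (J : R -> Prop) (n : nat) (f g : R -> R) :
  differentiable_n J n f -> differentiable_n J n g ->
  differentiable_n J n (fun t => f t + g t).
Proof.
  revert f g; induction n as [|n IH]; intros f g Hf Hg; [exact I|].
  destruct Hf as (f' & Df & Hf), Hg as (g' & Dg & Hg).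
  exists (fun t => f' t + g' t). split; [|auto].
  intros t Ht. specialize (Df t Ht). specialize (Dg t Ht). derive.
Qed.

Lemma differentiable_n_mult (J : R -> Prop) (n : nat) (f g : R -> R) :
  differentiable_n J n f -> differentiable_n J n g ->
  differentiable_n J n (fun t => f t * g t).
Proof.
  revert f g; induction n as [|n IH]; intros f g Hf Hg; [exact I|].
  assert (Hf0 := differentiable_n_S J n f Hf).
  assert (Hg0 := differentiable_n_S J n g Hg).
  destruct Hf as (f' & Df & Hf), Hg as (g' & Dg & Hg).
  exists (fun t => f' t * g t + f t * g' t).
  split; [|apply differentiable_n_plus; auto].
  intros t Ht. specialize (Df t Ht). specialize (Dg t Ht). derive.
Qed.

Lemma differentiable_n_inv (J : R -> Prop) (n : nat) (f : R -> R) :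
  (forall t, J t -> f t <> 0) -> differentiable_n J n f ->
  differentiable_n J n (fun t => 1 / f t).
Proof.
  intros Hn; induction n as [|n IH]; intros Hf; [exact I|].
  assert (IH' := IH (differentiable_n_S J n f Hf)).
  destruct Hf as (f' & Df & Hf).
  exists (fun t => -1 * f' t * (1 / f t * (1 / f t))). split.
  - intros t Ht. specialize (Df t Ht). specialize (Hn t Ht).
    evar_last; [derive; easy|field; easy].
  - apply differentiable_n_mult; apply differentiable_n_mult; auto.
    apply differentiable_n_const.
Qed.

Lemma smooth_derivative (J : R -> Prop) (f g : R -> R) :
  (forall t, J t -> is_derive f t (g t)) -> smooth J g -> smooth J f.
Proof. intros Hd Hg [|n]; [exact I|]. exists g; auto. Qed.

Lemma analytic_smooth (J : R -> Prop) (f : R -> R) : analytic_on J f -> smooth J f.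
Proof.
  intros Hf n; revert f Hf; induction n as [|n IH]; intros f Hf; [exact I|].
  exists (Derive f). split; [|now apply IH, analytic_Derive].
  intros t Ht; now apply (analytic_is_derive J).
Qed.

Lemma smooth_smooth_on (J : R -> Prop) (f : R -> R) :
  is_open_interval J -> smooth J f -> smooth_on J f.
Proof.
  intros HJ Hf [|n] t Ht; [exact I|].
  assert (Hn := Hf (S n)). clear Hf. revert f Hn t Ht.
  induction n as [|n IH]; intros f (g & Dg & Hg) t Ht.
  - exists (g t); now apply Dg.
  - destruct (IH g Hg t Ht) as [l Hl]. exists l.
    apply (is_derive_ext_loc (Derive_n g n)); [|exact Hl].
    generalize (open_interval_locally J t HJ Ht); apply filter_imp; intros r Hr.
    replace (S n) with (n + 1)%nat by lia. rewrite <- Derive_n_comp.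
    apply Derive_n_ext_loc.
    generalize (open_interval_locally J r HJ Hr); apply filter_imp; intros q Hq.
    symmetry. apply is_derive_unique. now apply Dg.
Qed.

Lemma open_interval_of_convex (I : R -> Prop) :
  (exists y, I y) -> (forall u v y, I u -> I v -> u <= y <= v -> I y) ->
  (forall y, I y -> exists u v, I u /\ I v /\ u < y < v) -> is_open_interval I.
Proof.
  intros [y0 Hy0] Hconv Hopen.
  assert (Hl := Glb_Rbar_correct I). assert (Hu := Lub_Rbar_correct I).
  destruct Hl as [Hl1 Hl2], Hu as [Hu1 Hu2].
  assert (Hin : forall y, I y -> Rbar_lt (Glb_Rbar I) y /\ Rbar_lt y (Lub_Rbar I)).
  { intros y Hy. destruct (Hopen y Hy) as (u & v & Iu & Iv & Huv). split.
    - apply Rbar_le_lt_trans with u; [now apply Hl1|simpl; lra].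
    - apply Rbar_lt_le_trans with v; [simpl; lra|now apply Hu1]. }
  exists (Glb_Rbar I), (Lub_Rbar I). split.
  - apply Rbar_lt_trans with y0; now apply Hin.
  - intros y. split; [apply Hin|]. intros [H1 H2].
    assert (Eu : exists u, I u /\ u <= y).
    { apply NNPP; intros Hno. apply (Rbar_lt_not_le _ _ H1). apply Hl2.
      intros u Iu. simpl. destruct (Rle_dec y u); [easy|].
      exfalso; apply Hno; exists u; split; [easy|lra]. }
    assert (Ev : exists v, I v /\ y <= v).
    { apply NNPP; intros Hno. apply (Rbar_lt_not_le _ _ H2). apply Hu2.
      intros v Iv. simpl. destruct (Rle_dec v y); [easy|].
      exfalso; apply Hno; exists v; split; [easy|lra]. }
    destruct Eu as (u & Iu & Lu), Ev as (v & Iv & Lv).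
    now apply (Hconv u v).
Qed.

Lemma increasing_of_positive_derivative (J : R -> Prop) (f f' : R -> R) :
  is_open_interval J -> (forall t, J t -> is_derive f t (f' t)) ->
  (forall t, J t -> 0 < f' t) -> forall u v, J u -> J v -> u < v -> f u < f v.
Proof.
  intros (a & b & _ & H) Hd Hp u v Hu Hv Huv.
  apply H in Hu; apply H in Hv.
  apply (incr_function f a b f'); try easy; intros; [apply Hd|apply Hp]; now apply H.
Qed.

(** Monotonicity gives the inverse and its continuity; the derivative is the
    limit of the reciprocal slope along the inverse. *)
Lemma inverse_function (J : R -> Prop) (x x' : R -> R) :
  is_open_interval J -> (forall t, J t -> is_derive x t (x' t)) ->
  (forall t, J t -> 0 < x' t) ->
  exists (I : R -> Prop) (xi : R -> R), is_open_interval I /\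
    (forall t, J t -> I (x t) /\ xi (x t) = t) /\
    (forall y, I y -> J (xi y) /\ x (xi y) = y /\ is_derive xi y (1 / x' (xi y))).
Proof.
  intros HJ Hd Hp.
  assert (Hinc := increasing_of_positive_derivative J x x' HJ Hd Hp).
  assert (Hroom : forall t e, J t -> 0 < e ->
    exists d, 0 < d /\ d < e /\ J (t - d) /\ J (t + d)).
  { intros t e Ht He.
    destruct (proj1 (locally_R _ _) (open_interval_locally J t HJ Ht)) as (r & Hr & Hl).
    exists (Rmin r e / 2). assert (Hm := Rmin_l r e). assert (Hm' := Rmin_r r e).
    assert (0 < Rmin r e) by (apply Rmin_pos; lra).
    split; [lra|]. split; [lra|].
    split; apply Hl; apply Rabs_def1; lra. }
  set (I := fun y => exists t, J t /\ x t = y).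
  assert (Hch : exists xi, forall y, I y -> J (xi y) /\ x (xi y) = y).
  { exists (fun y => epsilon (inhabits 0) (fun t => J t /\ x t = y)).
    intros y Hy. apply (epsilon_spec (inhabits 0) (fun t => J t /\ x t = y) Hy). }
  destruct Hch as [xi Hxi].
  assert (Hinv : forall t, J t -> xi (x t) = t).
  { intros t Ht. destruct (Hxi (x t)) as [H1 H2]; [now exists t|].
    destruct (Rtotal_order (xi (x t)) t) as [Hl|[->|Hl]]; [|easy|].
    - assert (H := Hinc _ _ H1 Ht Hl); lra.
    - assert (H := Hinc _ _ Ht H1 Hl); lra. }
  assert (HI : is_open_interval I).
  { apply open_interval_of_convex.
    - destruct (open_interval_inhabited J HJ) as [t Ht]. exists (x t), t; auto.
    - intros u v y (tu & Htu & <-) (tv & Htv & <-) [[H1|H1] [H2|H2]];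
        [|now exists tv|now exists tu|now exists tu].
      assert (Hlt : tu < tv).
      { destruct (Rtotal_order tu tv) as [|[->|Hl]]; [easy|lra|].
        assert (H := Hinc _ _ Htv Htu Hl); lra. }
      destruct (IVT_interv (fun t => x t - y) tu tv) as (t & Ht & E); try lra.
      + intros a Ha. apply continuity_pt_filterlim.
        assert (D := Hd a (open_interval_convex J tu tv a HJ Htu Htv Ha)).
        apply (is_derive_continuous (fun t => x t - y) a (x' a - 0)); derive.
      + exists t. split; [now apply (open_interval_convex J tu tv)|lra].
    - intros y (t & Ht & <-). destruct (Hroom t 1 Ht Rlt_0_1) as (d & Hd0 & _ & J1 & J2).
      exists (x (t - d)), (x (t + d)). split; [now exists (t - d)|].
      split; [now exists (t + d)|]. split; apply Hinc; auto; lra. }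
  exists I, xi. split; [easy|]. split; [intros t Ht; split; [now exists t|auto]|].
  intros y Hy. destruct (Hxi y Hy) as [HJt Exi]. split; [easy|]. split; [easy|].
  set (t := xi y) in *.
  assert (Hc : continuous xi y).
  { apply filterlim_locally. intros e.
    destruct (Hroom t e HJt (cond_pos e)) as (d & Hd0 & Hde & J1 & J2).
    assert (L1 := Hinc _ _ J1 HJt ltac:(lra)). assert (L2 := Hinc _ _ HJt J2 ltac:(lra)).
    rewrite Exi in L1, L2.
    generalize (filter_and _ _ (open_interval_locally I y HI Hy)
      (filter_and _ _ (open_gt _ _ L1) (open_lt _ _ L2))).
    apply filter_imp. intros r (Ir & R1 & R2).
    destruct (Hxi r Ir) as [Jr Er]. rewrite <- Er in R1, R2.
    change (Rabs (xi r - t) < e). apply Rabs_def1.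
    - destruct (Rlt_dec (xi r) (t + d)); [lra|].
      destruct (Req_dec (xi r) (t + d)) as [E|E]; [rewrite E in R2; lra|].
      assert (H := Hinc _ _ J2 Jr ltac:(lra)); lra.
    - destruct (Rlt_dec (t - d) (xi r)); [lra|].
      destruct (Req_dec (xi r) (t - d)) as [E|E]; [rewrite E in R1; lra|].
      assert (H := Hinc _ _ Jr J1 ltac:(lra)); lra. }
  (* The slope function of Caratheodory, continuous at [t]. *)
  set (phi := fun r => if excluded_middle_informative (r = t) then x' t
                       else (x r - x t) / (r - t)).
  assert (Hphi_t : phi t = x' t).
  { unfold phi. now destruct excluded_middle_informative. }
  assert (Hphi : continuous phi t).
  { apply filterlim_locally. intros e. rewrite Hphi_t.
    assert (D := proj1 (is_derive_Reals _ _ _) (Hd t HJt)).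
    destruct (D e (cond_pos e)) as [d Hd'].
    apply (proj2 (locally_R t _)). exists d. split; [apply cond_pos|]. intros r Hr.
    change (Rabs (phi r - x' t) < e). unfold phi.
    destruct excluded_middle_informative as [->|Hne].
    - rewrite Rminus_diag, Rabs_R0; apply cond_pos.
    - specialize (Hd' (r - t) ltac:(lra) Hr).
      now replace (t + (r - t)) with r in Hd' by ring. }
  assert (Hq : continuous (fun r => / phi (xi r)) y).
  { apply (continuous_comp xi (fun r => / phi r)); [easy|]. fold t.
    apply (continuous_comp phi Rinv); [easy|].
    rewrite Hphi_t. apply continuous_Rinv. specialize (Hp t HJt); lra. }
  apply is_derive_Reals. intros e He.
  destruct (proj1 (locally_R _ _) (filter_and _ _ (open_interval_locally I y HI Hy)
    (proj1 (filterlim_locally _ _) Hq (mkposreal e He)))) as (d & Hd0 & Hl).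
  exists (mkposreal d Hd0). intros k Hk Hkd. simpl in Hkd.
  destruct (Hl (y + k)) as [Iy Hb].
  { now replace (y + k - y) with k by ring. }
  change (Rabs (/ phi (xi (y + k)) - / phi (xi y)) < e) in Hb.
  fold t in Hb. rewrite Hphi_t in Hb.
  destruct (Hxi (y + k) Iy) as [Jk Ek].
  assert (Hne : xi (y + k) <> t).
  { intros E. rewrite E, Exi in Ek. lra. }
  fold t. replace ((xi (y + k) - t) / k - 1 / x' t)
    with (/ phi (xi (y + k)) - / x' t); [easy|].
  unfold phi. destruct excluded_middle_informative as [|_]; [easy|].
  rewrite Ek, Exi. specialize (Hp t HJt). field. repeat split; lra.
Qed.

(** The derivative of [f o xi] is [(f' / x') o xi], which has the same form. *)
Lemma smooth_comp_inverse (J I : R -> Prop) (x' xi f : R -> R) :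
  (forall y, I y -> J (xi y) /\ is_derive xi y (1 / x' (xi y))) ->
  (forall t, J t -> x' t <> 0) -> smooth J x' -> smooth J f ->
  smooth I (fun y => f (xi y)).
Proof.
  intros Hxi Hne Hx Hf n. specialize (Hf n). revert f Hf.
  induction n as [|n IH]; intros f Hf; [exact Logic.I|].
  destruct Hf as (g & Dg & Hg).
  exists (fun y => g (xi y) * (1 / x' (xi y))). split.
  - intros y Hy. destruct (Hxi y Hy) as [HJ D].
    evar_last; [apply D_comp; [now apply Dg|exact D]|ring].
  - apply (IH (fun t => g t * (1 / x' t))).
    apply differentiable_n_mult; [easy|]. apply differentiable_n_inv; auto.
Qed.

Lemma continuous_has_antiderivative (I : R -> Prop) (f : R -> R) :
  is_open_interval I -> (forall y, I y -> continuous f y) ->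
  exists F, forall y, I y -> is_derive F y (f y).
Proof.
  intros HI Hf. destruct (open_interval_inhabited I HI) as [y0 Hy0].
  exists (fun y => RInt f y0 y). intros y Hy.
  apply (is_derive_RInt f (fun y => RInt f y0 y) y0 y); [|now apply Hf].
  generalize (open_interval_locally I y HI Hy); apply filter_imp; intros r Hr.
  apply (RInt_correct f), ex_RInt_continuous. intros z Hz.
  apply Hf. now apply (open_interval_between I y0 r).
Qed.

(** * Null rulings: flat B-scrolls *)

Lemma smooth_curve_combination (I : R -> Prop) (f g h : R -> R) (u v w : L3) :
  is_open_interval I -> smooth I f -> smooth I g -> smooth I h ->
  smooth_curve I (fun y => plus (plus (scal (f y) u) (scal (g y) v)) (scal (h y) w)).
Proof.
  intros HI Hf Hg Hh.
  assert (H : forall a b c : R, smooth_on I (fun y => f y * a + g y * b + h y * c)).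
  { intros a b c. apply smooth_smooth_on; [easy|]. intros n.
    apply differentiable_n_plus; [apply differentiable_n_plus|];
      apply differentiable_n_mult; auto using differentiable_n_const. }
  split; [|split]; [apply (H (x1 u) (x1 v) (x1 w))|apply (H (x2 u) (x2 v) (x2 w))
    |apply (H (x3 u) (x3 v) (x3 w))].
Qed.

(** Take the null coordinate [x = <m, a>] as parameter and write the third
    coordinate of the base curve as [H(x)].  The curve
    [x n + H(x) e + Y(x) m] is null when [2 Y' + H' ^ 2 = 0].  Its Cartan frame
    is [A = n + H' e + Y' m], [B = m], [C = e - H' m], whence [C' = - H'' B];
    and [H''] is a nonzero multiple of the determinant of the last
    hypothesis. *)
Lemma null_cylinder_flat_B_scroll (J : R -> Prop) (alpha : R -> L3) (m n e : L3) :
  is_open_interval J -> analytic_curve J alpha ->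
  lorentz m m = 0 -> lorentz n n = 0 -> lorentz m n = 1 ->
  lorentz e e = 1 -> lorentz m e = 0 -> lorentz n e = 0 ->
  (forall t, J t -> 0 < lorentz m (Dcurve alpha t)) ->
  (forall t, J t -> locally' t (fun r =>
     det (Dcurve alpha r) m (Dcurve (Dcurve alpha) r) <> 0)) ->
  exists T, flat_B_scroll T /\ forall t s, J t -> T (plus (alpha t) (scal s m)).
Proof.
  intros HJ Ha Hmm Hnn Hmn Hee Hme Hne Hpos Hdet.
  assert (Hf := null_frame m n e Hmm Hnn Hmn Hee Hme Hne).
  assert (Hexp := null_frame_expansion m n e Hmm Hnn Hmn Hee Hme Hne).
  set (x1' := fun t => lorentz m (Dcurve alpha t)).
  set (x2' := fun t => lorentz m (Dcurve (Dcurve alpha) t)).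
  set (z1' := fun t => lorentz e (Dcurve alpha t)).
  set (z2' := fun t => lorentz e (Dcurve (Dcurve alpha) t)).
  assert (Hx : differentiable_twice J (fun t => lorentz m (alpha t)) x1' x2')
    by now apply lorentz_comp_twice.
  assert (Hz : differentiable_twice J (fun t => lorentz e (alpha t)) z1' z2')
    by now apply lorentz_comp_twice.
  assert (Sx : smooth J x1').
  { apply analytic_smooth, (analytic_lorentz J (fun _ => m));
      [apply analytic_constant_curve|now apply analytic_Dcurve]. }
  assert (Sz : smooth J z1').
  { apply analytic_smooth, (analytic_lorentz J (fun _ => e));
      [apply analytic_constant_curve|now apply analytic_Dcurve]. }
  assert (Hne' : forall t, J t -> x1' t <> 0).
  { intros t Ht. apply Rgt_not_eq, Hpos, Ht. }
  destruct (inverse_function J (fun t => lorentz m (alpha t)) x1' HJ)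
    as (I & xi & HI & HJI & HIJ); auto.
  { intros t Ht; exact (proj1 (Hx t Ht)). }
  set (H := fun y => lorentz e (alpha (xi y))).
  (* [H1] and [H2] are the first two derivatives of [H]. *)
  set (H1 := fun y => z1' (xi y) * (1 / x1' (xi y))).
  set (H2 := fun y => (z2' (xi y) * x1' (xi y) - z1' (xi y) * x2' (xi y))
                      / x1' (xi y) ^ 3).
  assert (DH : forall y, I y -> is_derive H y (H1 y)).
  { intros y Hy. destruct (HIJ y Hy) as (Hj & _ & D). destruct (Hz _ Hj) as [Dz _].
    evar_last; [exact (D_comp (fun t => lorentz e (alpha t)) xi y _ _ Dz D)|].
    unfold H1; ring. }
  assert (DH1 : forall y, I y -> is_derive H1 y (H2 y)).
  { intros y Hy. destruct (HIJ y Hy) as (Hj & _ & D).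
    destruct (Hz _ Hj) as [_ Dz]. destruct (Hx _ Hj) as [_ Dx].
    assert (Dz' := D_comp z1' xi y _ _ Dz D). assert (Dx' := D_comp x1' xi y _ _ Dx D).
    specialize (Hne' _ Hj). unfold H1.
    evar_last; [derive; easy|]. unfold H2. field; easy. }
  assert (SH1 : smooth I H1).
  { apply (smooth_comp_inverse J I x1' xi (fun t => z1' t * (1 / x1' t))); auto.
    - intros y Hy; split; apply (HIJ y Hy).
    - intros k; apply differentiable_n_mult; [apply Sz|].
      apply differentiable_n_inv; auto. }
  assert (SH : smooth I H) by now apply (smooth_derivative I H H1).
  destruct (continuous_has_antiderivative I (fun y => - (1 / 2) * (H1 y * H1 y)) HI) as [Y DY].
  { intros y Hy. specialize (DH1 y Hy).
    apply (is_derive_continuous (fun y => - (1 / 2) * (H1 y * H1 y)) y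
      (0 * (H1 y * H1 y) + - (1 / 2) * (H2 y * H1 y + H1 y * H2 y))). derive. }
  assert (SY1 : smooth I (fun y => - (1 / 2) * (H1 y * H1 y))).
  { intros k; apply differentiable_n_mult; [apply differentiable_n_const|].
    apply differentiable_n_mult; apply SH1. }
  assert (SY : smooth I Y) by now apply (smooth_derivative I Y _ DY).
  assert (Sc : forall c, smooth I (fun _ => c))
    by (intros c k; apply differentiable_n_const).
  set (comb := fun (f g h : R -> R) y =>
    plus (plus (scal (f y) n) (scal (g y) e)) (scal (h y) m) : L3).
  set (gamma := comb (fun y => y) H Y).
  set (A := comb (fun _ => 1) H1 (fun y => - (1 / 2) * (H1 y * H1 y))).
  set (C := comb (fun _ => 0) (fun _ => 1) (fun y => -1 * H1 y)).
  set (B := comb (fun _ => 0) (fun _ => 0) (fun _ => 1)).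
  assert (EB : forall y, B y = m).
  { intros y. unfold B, comb; apply L3_ext; autorewrite with coordinates; ring. }
  assert (Dcomb : forall (f g h : R -> R) (y f' g' h' : R), is_derive f y f' ->
    is_derive g y g' -> is_derive h y h' -> Dcurve (comb f g h) y
    = plus (plus (scal f' n) (scal g' e)) (scal h' m)).
  { intros f g h y f' g' h' D1 D2 D3. apply Dcurve_eq.
    exact (is_dcurve_combination f g h n e m y f' g' h' D1 D2 D3). }
  assert (DB : forall y, Dcurve B y = zero).
  { intros y. unfold B.
    rewrite (Dcomb _ _ _ y 0 0 0 (D_const 0 y) (D_const 0 y) (D_const 1 y)).
    apply L3_ext; autorewrite with coordinates; ring. }
  assert (DC : forall y, I y -> Dcurve C y = scal (- H2 y) (B y)).
  { intros y Hy. unfold C.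
    etransitivity.
    { exact (Dcomb _ _ _ y 0 0 _ (D_const 0 y) (D_const 1 y)
        (D_mult _ _ _ _ _ (D_const (-1) y) (DH1 y Hy))). }
    rewrite EB.
    apply L3_ext; autorewrite with coordinates; ring. }
  assert (Dgamma : forall y, I y -> Dcurve gamma y = A y).
  { intros y Hy. unfold gamma.
    exact (Dcomb _ _ _ y _ _ _ (D_id y) (DH y Hy) (DY y Hy)). }
  exists (image I (fun _ => True) (ruled gamma B)). split.
  - unfold flat_B_scroll. exists I. exists gamma. exists A. exists B. exists C. exists 0. exists H2.
    split; [exact HI|]. split; [|split; [|reflexivity]].
    + split; [|split; [|split; [|split]]].
      * exact (smooth_curve_combination I _ _ _ n e m HI (differentiable_n_id I) SH SY).
      * exact (smooth_curve_combination I _ _ _ n e m HI (Sc 1) SH1 SY1).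
      * exact (smooth_curve_combination I _ _ _ n e m HI (Sc 0) (Sc 0) (Sc 1)).
      * exact (smooth_curve_combination I _ _ _ n e m HI (Sc 0) (Sc 1)
          (fun k => differentiable_n_mult I k _ _ (Sc (-1) k) (SH1 k))).
      * intros y Hy. rewrite EB. unfold A, C, comb.
        repeat rewrite ?lorentz_plus_r, ?lorentz_scal_r, ?lorentz_plus_l, ?lorentz_scal_l.
        rewrite ?(lorentz_sym e m), ?(lorentz_sym e n), ?(lorentz_sym n m),
          ?Hmm, ?Hnn, ?Hmn, ?Hee, ?Hme, ?Hne.
        split; [field|]. split; [easy|]. split; [ring|]. split; [field|].
        split; [ring|]. split; [ring|]. split; [|split].
        -- exact (Dgamma y Hy).
        -- change (Dcurve C y = lin_comb (- 0) (- H2 y) (A y) m).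
           rewrite DC, EB by easy. unfold lin_comb.
           apply L3_ext; autorewrite with coordinates; ring.
        -- destruct (HIJ y Hy) as (Hj & Exi & D).
           destruct (proj1 (locally_R _ _) (Hdet _ Hj)) as (d & Hd & Hl).
           assert (Cxi := is_derive_continuous xi y _ D).
           apply (fun H => proj1 (filterlim_locally _ _) H (mkposreal d Hd)) in Cxi.
           unfold locally', within.
           generalize (filter_and _ _ (open_interval_locally I y HI Hy) Cxi).
           apply filter_imp. intros r (Ir & Hr) Hry.
           destruct (HIJ r Ir) as (Jr & Er & _).
           specialize (Hl (xi r) Hr). unfold H2. intros E.
           assert (Hxr := Hne' _ Jr).
           apply Hl.
           { intros E'. apply Hry. now rewrite <- Er, E', Exi. }
           apply Rmult_eq_reg_l with (- det m e n).
           2:{ apply Ropp_neq_0_compat, (adapted_frame_det 0 1 0 1), Hf. }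
           rewrite <- det_in_frame, Hmm, (lorentz_sym e m), Hme, (lorentz_sym n m), Hmn.
           fold (x1' (xi r)) (x2' (xi r)) (z1' (xi r)) (z2' (xi r)).
           transitivity (- (x1' (xi r) ^ 3) *
             ((z2' (xi r) * x1' (xi r) - z1' (xi r) * x2' (xi r)) / x1' (xi r) ^ 3));
             [field; easy|rewrite E; ring].
    + intros y Hy. now split; [apply DB|apply DC].
  - intros t s Ht. destruct (HJI t Ht) as (HIx & Exi).
    exists (lorentz m (alpha t)), (lorentz n (alpha t) + s - Y (lorentz m (alpha t))).
    split; [easy|]. split; [easy|].
    unfold ruled. rewrite EB. unfold gamma, comb, H. rewrite Exi.
    rewrite (Hexp (alpha t)) at 1.
    apply L3_ext; autorewrite with coordinates; ring.
Qed.

(** [E G - F ^ 2 = - <a', b> ^ 2] gives the first claim, and then [G Q = 2 D <a', b>]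
    gives [D = 0].  The vector [b x b'] is null and orthogonal to the null
    vector [b], so it is a multiple of [b]; its product with [a'] is [D]. *)
Lemma null_rulings (J1 J2 : R -> Prop) (alpha beta : R -> L3) :
  is_open_interval J1 -> is_open_interval J2 ->
  analytic_curve J1 alpha -> analytic_curve J1 beta ->
  timelike J1 J2 (ruled alpha beta) -> minimal J1 J2 (ruled alpha beta) ->
  (forall t, J1 t -> lorentz (beta t) (beta t) = 0) ->
  forall t, J1 t -> lorentz (Dcurve alpha t) (beta t) <> 0 /\
    cross (beta t) (Dcurve beta t) = zero.
Proof.
  intros HJ1 HJ2 Ha Hb Htl Hmin HG t Ht.
  assert (Heqs := minimal_ruled_equations J1 J2 alpha beta HJ1 HJ2 Ha Hb Htl Hmin t Ht).
  cbv zeta in Heqs. destruct Heqs as (E0 & _ & _ & Hs).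
  destruct (open_interval_inhabited J2 HJ2) as [s Js]. specialize (Hs s Js).
  assert (Db := analytic_is_dcurve J1 beta t Hb Ht).
  assert (Hbb' : lorentz (beta t) (Dcurve beta t) = 0).
  { assert (D := is_derive_unique _ _ _ (is_derive_lorentz _ _ _ _ _ Db Db)).
    rewrite (Derive_ext_loc _ (fun _ => 0)), Derive_const in D.
    - rewrite (lorentz_sym (Dcurve beta t)) in D. lra.
    - generalize (open_interval_locally J1 t HJ1 Ht); apply filter_imp. exact HG. }
  apply signature11_gram_neg in Hs.
  rewrite (HG t Ht), (lorentz_plus_l _ _ (beta t)), (lorentz_scal_l _ (beta t)),
    (lorentz_sym (Dcurve beta t) (beta t)), Hbb' in Hs.
  assert (HF : lorentz (Dcurve alpha t) (beta t) <> 0).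
  { intros E; rewrite E in Hs. lra. }
  split; [easy|].
  assert (Hb0 : beta t <> zero).
  { intros E; apply HF; rewrite E; coords; ring. }
  assert (HD : det (Dcurve alpha t) (beta t) (Dcurve beta t) = 0).
  { rewrite (HG t Ht), Rmult_0_l in E0. symmetry in E0.
    destruct (Rmult_integral _ _ E0); [lra|easy]. }
  destruct (null_orthogonal_parallel (beta t) (cross (beta t) (Dcurve beta t)))
    as [k Ek]; auto.
  { rewrite lorentz_cross_cross, (HG t Ht), (lorentz_sym (Dcurve beta t) (beta t)), Hbb'; ring. }
  { coords; ring. }
  assert (Hk : k * lorentz (Dcurve alpha t) (beta t) = 0).
  { transitivity (lorentz (Dcurve alpha t) (cross (beta t) (Dcurve beta t))).
    - rewrite Ek. symmetry; apply lorentz_scal_r.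
    - rewrite <- HD. coords; ring. }
  destruct (Rmult_integral _ _ Hk) as [-> |]; [|easy].
  rewrite Ek. apply L3_ext; autorewrite with coordinates; ring.
Qed.

Lemma null_ruled_surface (J1 J2 : R -> Prop) (alpha beta : R -> L3) :
  is_open_interval J1 -> is_open_interval J2 ->
  analytic_curve J1 alpha -> analytic_curve J1 beta ->
  timelike J1 J2 (ruled alpha beta) -> minimal J1 J2 (ruled alpha beta) ->
  (forall t, J1 t -> lorentz (beta t) (beta t) = 0) ->
  (exists t, J1 t /\ det (Dcurve alpha t) (beta t) (Dcurve (Dcurve alpha) t) <> 0) ->
  exists T, flat_B_scroll T /\
    congruent_to_part (image J1 J2 (ruled alpha beta)) T.
Proof.
  intros HJ1 HJ2 Ha Hb Htl Hmin HG (t0 & Ht0 & HQ0).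
  assert (Hnull := null_rulings J1 J2 alpha beta HJ1 HJ2 Ha Hb Htl Hmin HG).
  set (F0 := lorentz (Dcurve alpha t0) (beta t0)).
  assert (Hdir : forall t, J1 t -> exists k, k <> 0 /\ beta t = scal k (beta t0)).
  { apply (constant_direction J1 beta (Dcurve beta)); auto.
    - intros t Ht; now apply (analytic_is_dcurve J1).
    - intros t Ht; now apply Hnull.
    - intros t Ht E. apply (proj1 (Hnull t Ht)). rewrite E; coords; ring. }
  destruct (Hnull t0 Ht0) as [HF0 _]. fold F0 in HF0.
  (* The sign makes the null coordinate increasing. *)
  set (m := scal F0 (beta t0) : L3).
  assert (Hm0 : forall t, J1 t -> lorentz m (Dcurve alpha t) <> 0).
  { intros t Ht E. apply (proj1 (Hnull t Ht)).
    destruct (Hdir t Ht) as (k & Hk & ->). rewrite lorentz_scal_r.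
    unfold m in E. rewrite lorentz_scal_l, lorentz_sym in E.
    destruct (Rmult_integral _ _ E) as [|E']; [easy|]. rewrite E'; ring. }
  assert (Hpos : forall t, J1 t -> 0 < lorentz m (Dcurve alpha t)).
  { intros t Ht.
    apply (continuous_nonzero_same_sign J1 (fun t => lorentz m (Dcurve alpha t)) t0 t);
      auto.
    - intros r Hr. apply (analytic_continuous J1); [|easy].
      apply (analytic_lorentz J1 (fun _ => m));
        [apply analytic_constant_curve|now apply analytic_Dcurve].
    - unfold m. rewrite lorentz_scal_l, lorentz_sym. fold F0. nra. }
  assert (Hmm : lorentz m m = 0).
  { unfold m. rewrite lorentz_scal_l, lorentz_scal_r, HG by easy; ring. }
  destruct (null_partner m (Dcurve alpha t0) Hmm (Hm0 t0 Ht0))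
    as (n & Hnn & Hmn & _).
  destruct (null_cylinder_flat_B_scroll J1 alpha m n (cross m n)) as (T & HT & Hin);
    auto.
  - rewrite lorentz_cross_cross, (lorentz_sym n m), Hmm, Hmn; ring.
  - coords; ring.
  - coords; ring.
  - intros t Ht.
    assert (HQ : forall r, J1 r -> locally' r (fun r =>
              det (Dcurve alpha r) (beta r) (Dcurve (Dcurve alpha) r) <> 0)).
    { apply (analytic_zeros_isolated J1 _ t0); auto.
      apply analytic_det; auto using analytic_Dcurve. }
    specialize (HQ t Ht). unfold locally', within in *.
    generalize (filter_and _ _ (open_interval_locally J1 t HJ1 Ht) HQ).
    apply filter_imp. intros r [Hr Hq] Hrt E. apply (Hq Hrt).
    destruct (Hdir r Hr) as (k & Hk & ->).
    assert (E' : F0 * det (Dcurve alpha r) (beta t0) (Dcurve (Dcurve alpha) r) = 0).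
    { rewrite <- E. unfold m. coords; ring. }
    destruct (Rmult_integral _ _ E') as [|E'']; [easy|].
    transitivity (k * det (Dcurve alpha r) (beta t0) (Dcurve (Dcurve alpha) r));
      [coords; ring|rewrite E''; ring].
  - exists T. split; [easy|]. exists (fun p => p). split; [apply isometry_id|].
    intros p (t & s & Ht & Hs & ->).
    destruct (Hdir t Ht) as (k & Hk & E).
    replace (ruled alpha beta t s) with (plus (alpha t) (scal (s * k / F0) m)); auto.
    unfold ruled, m. rewrite E. apply L3_ext; autorewrite with coordinates; field; easy.
Qed.

(** * The classification *)

Theorem theorem1p3 (J1 J2 : R -> Prop) (alpha beta : R -> L3)
    (hJ1 : is_open_interval J1) (hJ2 : is_open_interval J2)
    (halpha : analytic_curve J1 alpha) (hbeta : analytic_curve J1 beta)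
    (htransversal : transversal J1 alpha beta)
    (htimelike : timelike J1 J2 (ruled alpha beta))
    (hminimal : minimal J1 J2 (ruled alpha beta)) :
  let M := image J1 J2 (ruled alpha beta) in
  (exists P, lorentzian_plane P /\ congruent_to_part M P) \/
  (exists c : R, c <> 0 /\ congruent_to_part M (helicoid1 c)) \/
  (exists c : R, c <> 0 /\ congruent_to_part M (helicoid2 c)) \/
  (exists c : R, c <> 0 /\ congruent_to_part M (helicoid3 c)) \/
  (exists c : R, c <> 0 /\ congruent_to_part M (conjugate_enneper2 c)) \/
  (exists T, flat_B_scroll T /\ congruent_to_part M T).
Proof.
  intros M.
  assert (Heqs := minimal_ruled_equations J1 J2 alpha beta hJ1 hJ2 halpha hbeta
    htimelike hminimal). cbv zeta in Heqs.
  assert (Aa' := analytic_Dcurve J1 _ halpha). assert (Ab' := analytic_Dcurve J1 _ hbeta).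
  assert (Aa'' := analytic_Dcurve J1 _ Aa').
  set (G := fun t => lorentz (beta t) (beta t)).
  set (D := fun t => det (Dcurve alpha t) (beta t) (Dcurve beta t)).
  set (Q := fun t => det (Dcurve alpha t) (beta t) (Dcurve (Dcurve alpha) t)).
  assert (AG : analytic_on J1 G) by now apply analytic_lorentz.
  assert (AD : analytic_on J1 D) by now apply analytic_det.
  assert (AQ : analytic_on J1 Q) by now apply analytic_det.
  destruct (classic (exists t, J1 t /\ G t * D t <> 0)) as [(t1 & Ht1 & H1)|Hno].
  - assert (HG : G t1 <> 0) by (intros E; apply H1; rewrite E; ring).
    assert (HD : D t1 <> 0) by (intros E; apply H1; rewrite E; ring).
    destruct (skew_ruled_surface J1 J2 alpha beta t1) as [H|[H|[H|H]]]; auto 10.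
  - assert (HGD : forall t, J1 t -> G t * D t = 0).
    { intros t Ht; apply NNPP; intros E; apply Hno; now exists t. }
    assert (HD : forall t, J1 t -> D t = 0).
    { destruct (analytic_integral J1 G D hJ1 AG AD HGD) as [HG|]; [|easy].
      intros t Ht.
      destruct (null_rulings J1 J2 alpha beta hJ1 hJ2 halpha hbeta htimelike hminimal
        HG t Ht) as [_ E].
      unfold D. transitivity (lorentz (cross (beta t) (Dcurve beta t)) (Dcurve alpha t));
        [coords; ring|rewrite E; coords; ring]. }
    destruct (classic (exists t, J1 t /\ Q t <> 0)) as [HQ|HQ].
    + do 5 right. apply null_ruled_surface; auto.
      destruct (analytic_integral J1 G Q hJ1 AG AQ) as [HG|HQ0]; [|easy|].
      * intros t Ht. destruct (Heqs t Ht) as (E & _). unfold G, Q. rewrite E.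
        fold (D t). rewrite HD by easy. ring.
      * destruct HQ as (t & Ht & HQ). now destruct HQ; apply HQ0.
    + left. apply planar_ruled_surface; auto.
      intros t Ht; apply NNPP; intros E; apply HQ; now exists t.
Qed.
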